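(* Let $V$ be a weak quantum vertex algebra with a constant $\mathcal{S}$-map (with fixed $\mathcal{S}$) such that Assumption A holds for $\widetilde{U}(V)$, and let $U$ be an $\widetilde{A}(V)$-module. Then $L(U)=\tilde{M}(U)/J(U)$ is an $\mathbb{N}$-graded $\phi$-coordinated $V$-module (with $Y_{L(U)}(v,x)=\sum_{n\in\mathbb{Z}}v[n]x^{-n}$) with $U$ as the degree zero subspace. Furthermore, if $U$ is an irreducible $\widetilde{A}(V)$-module, then $L(U)$ is an irreducible $\mathbb{N}$-graded $\phi$-coordinated $V$-module.
   Context: All vector spaces are over $\mathbb{C}$; $\mathbb{N}=\{0,1,2,\dots\}$, $\mathbb{Z}_+=\{1,2,\dots\}$; $\delta(x)=\sum_{n\in\mathbb{Z}}x^n$; binomial expressions are expanded in nonnegative powers of the second variable. A weak quantum vertex algebra with a constant $\mathcal{S}$-map is a vector space $V$ with a linear map $Y(\cdot,x):V\to \mathrm{Hom}(V,V((x)))$, $Y(v,x)=\sum_{n}v_nx^{-n-1}$, and $\mathbf{1}\in V$ such that $Y(\mathbf{1},x)v=v$, $Y(v,x)\mathbf{1}\in V[[x]]$, $\lim_{x\to0}Y(v,x)\mathbf{1}=v$, and for any $u,v\in V$ there exist finitely many $u^{(i)},v^{(i)}\in V$ with $$x_0^{-1}\delta\left(\tfrac{x_1-x_2}{x_0}\right)Y(u,x_1)Y(v,x_2)-x_0^{-1}\delta\left(\tfrac{x_2-x_1}{-x_0}\right)\sum_{i=1}^{r}Y(v^{(i)},x_2)Y(u^{(i)},x_1)=x_2^{-1}\delta\left(\tfrac{x_1-x_0}{x_2}\right)Y(Y(u,x_0)v,x_2).\quad(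 * )$$ A linear operator $\mathcal{S}$ on $V\otimes V$ is fixed such that for all $u,v\in V$, $( * )$ holds with $u^{(i)},v^{(i)}$ given by $\mathcal{S}(v\otimes u)=\sum_{i=1}^rv^{(i)}\otimes u^{(i)}$. Put $\mathcal{D}v=v_{-2}\mathbf{1}$. A $\phi$-coordinated $V$-module ($\phi(x,z)=xe^z$) is a vector space $W$ with a linear map $Y_W(\cdot,x):V\to(\mathrm{End}\,W)[[x,x^{-1}]]$, $Y_W(v,x)=\sum_{n}v_{[n]}x^{-n}$, such that $Y_W(v,x)w\in W((x))$, $Y_W(\mathbf{1},x)=1_W$, and for $u,v\in V$ there is $k\in\mathbb{N}$ with $(x_1-x_2)^kY_W(u,x_1)Y_W(v,x_2)\in\mathrm{Hom}(W,W((x_1,x_2)))$, where $W((x_1,x_2))=W[[x_1,x_2]][x_1^{-1},x_2^{-1}]$, and $(e^{x_0}-1)^kY_W(Y(u,x_0)v,x_2)=\left((x_1/x_2-1)^kY_W(u,x_1)Y_W(v,x_2)\right)|_{x_1=x_2e^{x_0}}$. It is $\mathbb{N}$-graded if $W=\bigoplus_{n\in\mathbb{N}}W[n]$ with $v_{[m]}W[n]\subset W[n-m]$ ($W[p]=0$ for $p<0$); irreducible means nonzero without proper nonzero graded submodules. $\widetilde{A}(V)=V/\widetilde{O}(V)$, where $\widetilde{O}(V)$ is the span of $\mathrm{Res}_x\frac{e^x}{(e^x-1)^2}Y(u,x)v$ $(u,v\in V)$ (which contains $\mathcal{D}V$), an associative algebra with product induced by $u*v=\mathrm{Res}_x\frac{e^x}{e^x-1}Y(u,x)v$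 and identity $\mathbf{1}+\widetilde{O}(V)$. $\widetilde{U}(V)$ is the associative algebra with generators $u[n]$ (linear in $u$), $u\in V$, $n\in\mathbb{Z}$, and relations $\mathbf{1}[n]=\delta_{n,0}$, $(\mathcal{D}u)[n]=-nu[n]$, $$u[m]v[n]-\sum_{i=1}^rv^{(i)}[n]u^{(i)}[m]=\sum_{j\ge0}\frac{m^j}{j!}(u_jv)[m+n].$$ It is $\mathbb{Z}$-graded by $\deg u[n]=-n$. Let $\widetilde{U}(V)^0$ be the subalgebra generated by all $u[0]$, and $\widetilde{U}(V)^{\pm}$ the subalgebra generated by all $u[\mp n]$, $u\in V$, $n\in\mathbb{Z}_+$. $B(V)$ is the associative algebra with generators $u[n]$, $u\in V$, $n\in\mathbb{N}$, and the same relations restricted to $m,n\ge0$. There is an algebra homomorphism $\pi:B(V)\to\widetilde{U}(V)$, $u[n]\mapsto u[n]$, with image $\widetilde{U}(V)^0\widetilde{U}(V)^-$, and an algebra homomorphism $\psi:B(V)\to\widetilde{A}(V)$, $\psi(u[m])=\delta_{m,0}(u+\widetilde{O}(V))$. Assumption A: $\widetilde{U}(V)\simeq\widetilde{U}(V)^+\otimes\widetilde{U}(V)^0\widetilde{U}(V)^-$ as a vector space (via multiplication). An $\widetilde{A}(V)$-module $U$ is viewed as a $B(V)$-module via $\psi$; $\tilde{M}(U)=\widetilde{U}(V)\otimes_{B(V)}U$, an $\mathbb{N}$-graded $\widetilde{U}(V)$-module with $\deg(1\otimes U)=0$. Under Assumption A, the map $\theta_U:U\to\tilde{M}(U)[0]$,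 $u\mapsto1\otimes u$, is taken to be a $B(V)$-module isomorphism (recorded in the setting as a consequence of Assumption A), and $\tilde{M}(U)[0]$ is identified with $U$. Let $P_0:\tilde{M}(U)\to U$ be the projection onto degree zero; for $u^*\in U^*$, $w\in\tilde{M}(U)$ put $\langle u^*,w\rangle=\langle u^*,P_0(w)\rangle$. Set $$J(U)=\{w\in\tilde{M}(U)\mid\langle u^*,aw\rangle=0\text{ for all }u^*\in U^*,\ a\in\widetilde{U}(V)\},$$ a graded $\widetilde{U}(V)$-submodule, and $L(U)=\tilde{M}(U)/J(U)$. *)

(* Defs.v *)
From HB Require Import structures.
From mathcomp Require Import all_boot all_order all_algebra.
From mathcomp Require Import finmap.
From mathcomp Require Import boolp classical_sets fsbigop reals.
From mathcomp Require Import complex.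
From mathcomp Require Import monalg.

Set Implicit Arguments.
Unset Strict Implicit.
Unset Printing Implicit Defensive.

Import GRing.Theory.

Local Open Scope classical_set_scope.
Local Open Scope quotient_scope.
Local Open Scope ring_scope.

Section Span.
Variables (K : fieldType) (V : lmodType K).
Implicit Type S : set V.

Inductive in_span S : V -> Prop :=
| in_span0 : in_span S 0
| in_span_gen v : S v -> in_span S v
| in_spanD u v : in_span S u -> in_span S v -> in_span S (u + v)
| in_spanZ a v : in_span S v -> in_span S (a *: v).

Definition lspan S : {pred V} := fun v => `[< in_span S v >].

Lemma lspanP S v : reflect (in_span S v) (v \in lspan S).
Proof. exact: asboolP. Qed.

Lemma lspan_gen S v : S v -> v \in lspan S.
Proof. by move=> Sv; apply/lspanP; exact: in_span_gen. Qed.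

Lemma lspan_submod_closed S : submod_closed (lspan S).
Proof.
split=> [|a u v /lspanP Su /lspanP Sv]; apply/lspanP; first exact: in_span0.
by apply: in_spanD => //; apply: in_spanZ.
Qed.
HB.instance Definition _ S :=
  GRing.isSubmodClosed.Build K V (lspan S) (lspan_submod_closed S).

Record subsp S := Subsp { subsp_val : V; _ : subsp_val \in lspan S }.
HB.instance Definition _ S := [isSub for @subsp_val S].
HB.instance Definition _ S := [Choice of subsp S by <:].
HB.instance Definition _ S := [SubChoice_isSubLmodule of subsp S by <:].

Definition is_subspace S : Prop :=
  S 0 /\ forall a u v, S u -> S v -> S (a *: u + v).

End Span.

Section VQuot.
Variables (K : fieldType) (V : lmodType K) (S : set V).

Definition vquot := Quotient.quot (lspan S).
HB.instance Definition _ := GRing.Zmodule.on vquot.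

Definition vpi (v : V) : vquot := \pi_(Quotient.quot (lspan S)) v.
Definition vrepr (x : vquot) : V := repr (x : Quotient.quot (lspan S)).

Lemma vreprK x : vpi (vrepr x) = x.
Proof. exact: reprK. Qed.

Lemma vpi_eq u v : (vpi u = vpi v) <-> (u - v \in lspan S).
Proof. by rewrite Quotient.idealrBE /vpi; split=> [->|/eqP]. Qed.

Lemma vpiD u v : vpi (u + v) = vpi u + vpi v.
Proof. by rewrite /vpi !piE. Qed.

Definition vqscale (a : K) (x : vquot) : vquot := vpi (a *: vrepr x).

Lemma vqscaleE a v : vqscale a (vpi v) = vpi (a *: v).
Proof. by apply/vpi_eq; rewrite -scalerBr rpredZ//; apply/vpi_eq; rewrite vreprK. Qed.

Fact vqscaleA a b x : vqscale a (vqscale b x) = vqscale (a * b) x.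
Proof. by rewrite -(vreprK x) !vqscaleE scalerA. Qed.
Fact vqscale1 : left_id 1 vqscale.
Proof. by move=> x; rewrite -(vreprK x) vqscaleE scale1r. Qed.
Fact vqscaleDr : right_distributive vqscale +%R.
Proof.
move=> a x y; rewrite -(vreprK x) -(vreprK y) -vpiD !vqscaleE -vpiD.
by rewrite scalerDr.
Qed.
Fact vqscaleDl x : {morph vqscale^~ x : a b / a + b}.
Proof. by move=> a b; rewrite /= -(vreprK x) !vqscaleE -vpiD scalerDl. Qed.
HB.instance Definition _ := GRing.Zmodule_isLmodule.Build K vquot
  vqscaleA vqscale1 vqscaleDr vqscaleDl.

Fact vpi_linear : linear vpi.
Proof. by move=> a u v; rewrite vpiD -vqscaleE. Qed.
HB.instance Definition _ := GRing.isLinear.Build K V vquot *:%R vpi vpi_linear.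

(* Meaningful when f is linear and vanishes on S: see vqliftE. *)
Definition vqlift (T : Type) (f : V -> T) (x : vquot) : T := f (vrepr x).

Lemma vqliftE (W : lmodType K) (f : V -> W) : linear f ->
  (forall v, S v -> f v = 0) -> forall v, vqlift f (vpi v) = f v.
Proof.
move=> fl fS v.
pose F : {linear V -> W} := HB.pack f (GRing.isLinear.Build K V W *:%R f fl).
rewrite -[f]/(F : V -> W); apply/eqP; rewrite -subr_eq0 -linearB; apply/eqP.
have /vpi_eq/lspanP : vpi (vrepr (vpi v)) = vpi v by rewrite vreprK.
elim=> [|||] => [|u /fS//|u w _ fu _ fw|a u _ fu]; first exact: linear0.
  by rewrite linearD fu fw addr0.
by rewrite linearZ_LR fu scaler0.
Qed.

Lemma vqlift_linear (W : lmodType K) (f : V -> W) : linear f ->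
  (forall v, S v -> f v = 0) -> linear (vqlift f).
Proof.
move=> fl fS a x y; rewrite -(vreprK x) -(vreprK y) -(linearP vpi).
rewrite !vqliftE //; exact: fl.
Qed.

End VQuot.

Section LinearExtension.
Variables (K : fieldType) (X : choiceType) (W : lmodType K) (h : X -> W).

(* {malg K[X]} is the vector space with basis X. *)
Definition lext (g : {malg K[X]}) : W := \sum_(x <- msupp g) g@_x *: h x.

Lemma lextEw (d : {fset X}) g : (msupp g `<=` d)%fset ->
  lext g = \sum_(x <- d) g@_x *: h x.
Proof.
move=> le; rewrite [LHS](big_fset_incl _ le) => //= x xd /mcoeff_outdom ->.
by rewrite scale0r.
Qed.

Fact lext_linear : linear lext.
Proof.
move=> a g1 g2; pose d := (msupp g1 `|` msupp g2)%fset.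
have l1 : (msupp g1 `<=` d)%fset by exact: fsubsetUl.
have l2 : (msupp g2 `<=` d)%fset by exact: fsubsetUr.
have l3 : (msupp (a *: g1 + g2) `<=` d)%fset.
  apply: (fsubset_trans (msuppD_le _ _)); apply: fsetSU; exact: msuppZ_le.
rewrite (lextEw l1) (lextEw l2) (lextEw l3) scaler_sumr -big_split /=.
by apply: eq_bigr => x _; rewrite mcoeffD mcoeffZ scalerDl scalerA.
Qed.
HB.instance Definition _ :=
  GRing.isLinear.Build K {malg K[X]} W *:%R lext lext_linear.

Lemma lextU x : lext << x >> = h x.
Proof.
by rewrite /lext msuppU oner_eq0 big_seq_fset1 mcoeffUU scale1r.
Qed.

End LinearExtension.

Section Tensor.
Variables (K : fieldType) (V W : lmodType K).

Inductive tens_rel : set {malg K[(V * W)%type]} :=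
| tens_rel_l a v v' w :
    tens_rel (<< (a *: v + v', w) >> - (a *: << (v, w) >> + << (v', w) >>))
| tens_rel_r a v w w' :
    tens_rel (<< (v, a *: w + w') >> - (a *: << (v, w) >> + << (v, w') >>)).

Definition tens := vquot tens_rel.
HB.instance Definition _ := GRing.Lmodule.on tens.

Definition tmk (v : V) (w : W) : tens := vpi tens_rel << (v, w) >>.

Lemma tmk_linearl w : linear (tmk^~ w).
Proof.
move=> a v v'; rewrite /tmk -linearP; apply/vpi_eq/lspan_gen.
exact: tens_rel_l.
Qed.

Lemma tmk_linearr v : linear (tmk v).
Proof.
move=> a w w'; rewrite /tmk -linearP; apply/vpi_eq/lspan_gen.
exact: tens_rel_r.
Qed.

(* Meaningful when h is bilinear: see tliftE. *)
Definition tlift (Z : lmodType K) (h : V -> W -> Z) : tens -> Z :=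
  vqlift (lext (fun p : V * W => h p.1 p.2)).

Section Lift.
Variables (Z : lmodType K) (h : V -> W -> Z).
Hypotheses (hl : forall w, linear (h^~ w)) (hr : forall v, linear (h v)).

Let lext_kill g : tens_rel g -> lext (fun p : V * W => h p.1 p.2) g = 0.
Proof.
case=> [a v v' w|a v w w']; rewrite linearB linearP /= !lextU /=.
  by rewrite (hl w a v v') subrr.
by rewrite (hr v a w w') subrr.
Qed.

Lemma tliftE v w : tlift h (tmk v w) = h v w.
Proof. by rewrite /tlift vqliftE ?lextU //; exact: lext_linear. Qed.

Lemma tlift_linear : linear (tlift h).
Proof. by apply: vqlift_linear => //; exact: lext_linear. Qed.
End Lift.

Lemma tmk0l w : tmk 0 w = 0.
Proof.
have := tmk_linearl w 1 0 0; rewrite !scale1r addr0 => /eqP.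
by rewrite -subr_eq subrr => /eqP.
Qed.

Lemma tmkZl a v w : tmk (a *: v) w = a *: tmk v w.
Proof. by have := tmk_linearl w a v 0; rewrite !addr0 tmk0l addr0. Qed.

Lemma tens_ind (P : tens -> Prop) :
  P 0 -> (forall x y, P x -> P y -> P (x + y)) ->
  (forall v w, P (tmk v w)) -> forall x, P x.
Proof.
move=> P0 PD Pt x; rewrite -(vreprK x) (monalgE (vrepr x)) linear_sum.
elim/big_ind: _ => // -[v w] _.
set c := _@_ _.
suff e : tmk (c *: v) w = vpi tens_rel << c *g (v, w) >>.
  by have := Pt (c *: v) w; rewrite e.
rewrite tmkZl -linearZ; congr vpi.
by apply/malgP => k; rewrite mcoeffZ !mcoeffU mulrnAr mulr1.
Qed.

End Tensor.

(* Formal expressions for the elements of the free associative unital K-algebra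
   on X. *)
Inductive aterm (K X : Type) : Type :=
| TGen of X
| TZero
| TAdd of aterm K X & aterm K X
| TOpp of aterm K X
| TScale of K & aterm K X
| TOne
| TMul of aterm K X & aterm K X.
Arguments TGen {K X} _.
Arguments TZero {K X}.
Arguments TOne {K X}.

HB.instance Definition _ (K X : Type) := gen_eqMixin (aterm K X).
HB.instance Definition _ (K X : Type) := gen_choiceMixin (aterm K X).

Section PresentedAlgebra.
Variables (K : fieldType) (X : Type).
Local Notation term := (aterm K X).
Variable rel : term -> term -> Prop.

(* The smallest congruence on expressions that contains the K-algebra axioms
   and rel. *)
Inductive acong : term -> term -> Prop :=
| acong_refl s : acong s s
| acong_sym s t : acong s t -> acong t s
| acong_trans s t r : acong s t -> acong t r -> acong s r
| acong_Add s s' t t' : acong s s' -> acong t t' ->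
    acong (TAdd s t) (TAdd s' t')
| acong_Opp s s' : acong s s' -> acong (TOpp s) (TOpp s')
| acong_Scale a s s' : acong s s' -> acong (TScale a s) (TScale a s')
| acong_Mul s s' t t' : acong s s' -> acong t t' ->
    acong (TMul s t) (TMul s' t')
| acong_addA s t r : acong (TAdd s (TAdd t r)) (TAdd (TAdd s t) r)
| acong_addC s t : acong (TAdd s t) (TAdd t s)
| acong_add0 s : acong (TAdd TZero s) s
| acong_addN s : acong (TAdd (TOpp s) s) TZero
| acong_scaleA a b s : acong (TScale a (TScale b s)) (TScale (a * b) s)
| acong_scale1 s : acong (TScale 1 s) s
| acong_scaleDr a s t :
    acong (TScale a (TAdd s t)) (TAdd (TScale a s) (TScale a t))
| acong_scaleDl a b s :
    acong (TScale (a + b) s) (TAdd (TScale a s) (TScale b s))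
| acong_mulA s t r : acong (TMul s (TMul t r)) (TMul (TMul s t) r)
| acong_mul1 s : acong (TMul TOne s) s
| acong_mulr1 s : acong (TMul s TOne) s
| acong_mulDl s t r : acong (TMul (TAdd s t) r) (TAdd (TMul s r) (TMul t r))
| acong_mulDr s t r : acong (TMul s (TAdd t r)) (TAdd (TMul s t) (TMul s r))
| acong_scaleAl a s t : acong (TScale a (TMul s t)) (TMul (TScale a s) t)
| acong_scaleAr a s t : acong (TScale a (TMul s t)) (TMul s (TScale a t))
| acong_rel s t : rel s t -> acong s t.

Definition acongb (s t : term) : bool := `[< acong s t >].

Fact acongb_equiv : equiv_class_of acongb.
Proof.
split=> [s|s t|t s r].
- by apply/asboolP; exact: acong_refl.
- by apply/asboolP/asboolP; exact: acong_sym.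
- move=> /asboolP st /asboolP tr; apply/asboolP; exact: acong_trans st tr.
Qed.
Canonical acongb_equiv_rel := EquivRelPack acongb_equiv.
Canonical acongb_encModRel := defaultEncModRel acongb.

Definition palg := {eq_quot acongb}.
HB.instance Definition _ := Choice.on palg.

Definition ppi (s : term) : palg := \pi_({eq_quot acongb}) s.
Definition prepr (x : palg) : term := repr (x : {eq_quot acongb}).

Lemma preprK x : ppi (prepr x) = x.
Proof. exact: reprK. Qed.

Lemma ppi_eq s t : (ppi s = ppi t) <-> acong s t.
Proof.
rewrite /ppi; split=> [/eqmodP/asboolP//|st].
by apply/eqmodP/asboolP.
Qed.

Lemma acong_repr s : acong (prepr (ppi s)) s.
Proof. by apply/ppi_eq; rewrite preprK. Qed.

Definition pzero : palg := ppi TZero.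
Definition pone : palg := ppi TOne.
Definition padd (x y : palg) : palg := ppi (TAdd (prepr x) (prepr y)).
Definition popp (x : palg) : palg := ppi (TOpp (prepr x)).
Definition pscale (a : K) (x : palg) : palg := ppi (TScale a (prepr x)).
Definition pmul (x y : palg) : palg := ppi (TMul (prepr x) (prepr y)).

Fact paddE s t : padd (ppi s) (ppi t) = ppi (TAdd s t).
Proof. by apply/ppi_eq/acong_Add; exact: acong_repr. Qed.
Fact poppE s : popp (ppi s) = ppi (TOpp s).
Proof. by apply/ppi_eq/acong_Opp; exact: acong_repr. Qed.
Fact pscaleE a s : pscale a (ppi s) = ppi (TScale a s).
Proof. by apply/ppi_eq/acong_Scale; exact: acong_repr. Qed.
Fact pmulE s t : pmul (ppi s) (ppi t) = ppi (TMul s t).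
Proof. by apply/ppi_eq/acong_Mul; exact: acong_repr. Qed.
Let pE := (paddE, poppE, pscaleE, pmulE).

Fact paddA : associative padd.
Proof.
move=> x y z; rewrite -(preprK x) -(preprK y) -(preprK z) !pE.
exact/ppi_eq/acong_addA.
Qed.
Fact paddC : commutative padd.
Proof.
move=> x y; rewrite -(preprK x) -(preprK y) !pE.
exact/ppi_eq/acong_addC.
Qed.
Fact padd0 : left_id pzero padd.
Proof. by move=> x; rewrite -(preprK x) pE; exact/ppi_eq/acong_add0. Qed.
Fact paddN : left_inverse pzero popp padd.
Proof. by move=> x; rewrite -(preprK x) !pE; exact/ppi_eq/acong_addN. Qed.
HB.instance Definition _ := GRing.isZmodule.Build palg paddA paddC padd0 paddN.

Fact pmulA : associative pmul.
Proof.
move=> x y z; rewrite -(preprK x) -(preprK y) -(preprK z) !pE.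
exact/ppi_eq/acong_mulA.
Qed.
Fact pmul1 : left_id pone pmul.
Proof. by move=> x; rewrite -(preprK x) pE; exact/ppi_eq/acong_mul1. Qed.
Fact pmulr1 : right_id pone pmul.
Proof. by move=> x; rewrite -(preprK x) pE; exact/ppi_eq/acong_mulr1. Qed.
Fact pmulDl : left_distributive pmul padd.
Proof.
move=> x y z; rewrite -(preprK x) -(preprK y) -(preprK z) !pE.
exact/ppi_eq/acong_mulDl.
Qed.
Fact pmulDr : right_distributive pmul padd.
Proof.
move=> x y z; rewrite -(preprK x) -(preprK y) -(preprK z) !pE.
exact/ppi_eq/acong_mulDr.
Qed.
HB.instance Definition _ := GRing.Zmodule_isPzRing.Build palg
  pmulA pmul1 pmulr1 pmulDl pmulDr.

Fact pscaleA a b x : pscale a (pscale b x) = pscale (a * b) x.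
Proof. by rewrite -(preprK x) !pE; exact/ppi_eq/acong_scaleA. Qed.
Fact pscale1 : left_id 1 pscale.
Proof. by move=> x; rewrite -(preprK x) pE; exact/ppi_eq/acong_scale1. Qed.
Fact pscaleDr : right_distributive pscale padd.
Proof.
move=> a x y; rewrite -(preprK x) -(preprK y) !pE.
exact/ppi_eq/acong_scaleDr.
Qed.
Fact pscaleDl x a b : pscale (a + b) x = padd (pscale a x) (pscale b x).
Proof. by rewrite -(preprK x) !pE; exact/ppi_eq/acong_scaleDl. Qed.
HB.instance Definition _ := GRing.Zmodule_isLmodule.Build K palg
  pscaleA pscale1 pscaleDr pscaleDl.

Lemma palg_scalerAl (a : K) (x y : palg) : a *: (x * y) = (a *: x) * y.
Proof.
suff: pscale a (pmul x y) = pmul (pscale a x) y by [].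
by rewrite -(preprK x) -(preprK y) !pE; exact/ppi_eq/acong_scaleAl.
Qed.

Lemma palg_scalerAr (a : K) (x y : palg) : a *: (x * y) = x * (a *: y).
Proof.
suff: pscale a (pmul x y) = pmul x (pscale a y) by [].
by rewrite -(preprK x) -(preprK y) !pE; exact/ppi_eq/acong_scaleAr.
Qed.

Lemma ppi0 : ppi TZero = 0. Proof. by []. Qed.
Lemma ppi1 : ppi TOne = 1. Proof. by []. Qed.
Lemma ppiD s t : ppi (TAdd s t) = ppi s + ppi t.
Proof. by symmetry; exact: paddE. Qed.
Lemma ppiN s : ppi (TOpp s) = - ppi s.
Proof. by symmetry; exact: poppE. Qed.
Lemma ppiZ a s : ppi (TScale a s) = a *: ppi s.
Proof. by symmetry; exact: pscaleE. Qed.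
Lemma ppiM s t : ppi (TMul s t) = ppi s * ppi t.
Proof. by symmetry; exact: pmulE. Qed.

Lemma ppi_sum (J : Type) (r : seq J) (P : pred J) (F : J -> term) :
  ppi (\big[@TAdd K X/TZero]_(j <- r | P j) F j) = \sum_(j <- r | P j) ppi (F j).
Proof. by apply: (big_morph ppi) => // s t; rewrite ppiD. Qed.

Definition pgen (x : X) : palg := ppi (TGen x).

End PresentedAlgebra.

Section PresentedAlgebraMap.
Variables (K : fieldType) (X X' : Type) (f : X -> X').

Fixpoint amap (s : aterm K X) : aterm K X' :=
  match s with
  | TGen x => TGen (f x)
  | TZero => TZero
  | TAdd s t => TAdd (amap s) (amap t)
  | TOpp s => TOpp (amap s)
  | TScale a s => TScale a (amap s)
  | TOne => TOne
  | TMul s t => TMul (amap s) (amap t)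
  end.

Variables (rel : aterm K X -> aterm K X -> Prop).
Variables (rel' : aterm K X' -> aterm K X' -> Prop).

(* Meaningful when f maps rel into rel': see palg_mapE. *)
Definition palg_map : palg rel -> palg rel' :=
  fun b => ppi rel' (amap (prepr b)).

Hypothesis f_rel : forall s t, rel s t -> rel' (amap s) (amap t).

Lemma acong_amap s t : acong rel s t -> acong rel' (amap s) (amap t).
Proof.
elim=> {s t} /=;
  try by move=> *; do ?[exact: acong_refl | exact: acong_Add
    | exact: acong_Opp | exact: acong_Scale | exact: acong_Mul
    | exact: acong_addA | exact: acong_addC | exact: acong_add0
    | exact: acong_addN | exact: acong_scaleA | exact: acong_scale1
    | exact: acong_scaleDr | exact: acong_scaleDl | exact: acong_mulA
    | exact: acong_mul1 | exact: acong_mulr1 | exact: acong_mulDl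
    | exact: acong_mulDr | exact: acong_scaleAl | exact: acong_scaleAr
    | exact: acong_sym].
- by move=> ? ? ? _ h1 _ h2; exact: acong_trans h1 h2.
- by move=> ? ? /f_rel; exact: acong_rel.
Qed.

Lemma palg_mapE s : palg_map (ppi rel s) = ppi rel' (amap s).
Proof. by apply/ppi_eq/acong_amap; exact: acong_repr. Qed.

Lemma palg_map_gen x : palg_map (pgen rel x) = pgen rel' (f x).
Proof. by rewrite palg_mapE. Qed.

Lemma palg_map1 : palg_map 1 = 1.
Proof. by rewrite -ppi1 palg_mapE. Qed.

Lemma palg_mapM x y : palg_map (x * y) = palg_map x * palg_map y.
Proof. by rewrite -(preprK x) -(preprK y) -ppiM !palg_mapE ppiM. Qed.

Lemma palg_map_linear : linear palg_map.
Proof.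
move=> a x y; rewrite -(preprK x) -(preprK y) -ppiZ -ppiD !palg_mapE.
by rewrite ppiD ppiZ.
Qed.

End PresentedAlgebraMap.

(* The smallest unital subalgebra containing S. *)
Inductive alg_gen (K : fieldType) (X : Type)
    (rel : aterm K X -> aterm K X -> Prop) (S : set (palg rel)) :
    palg rel -> Prop :=
| alg_gen_in x : S x -> alg_gen S x
| alg_gen1 : alg_gen S 1
| alg_genD x y : alg_gen S x -> alg_gen S y -> alg_gen S (x + y)
| alg_genZ a x : alg_gen S x -> alg_gen S (a *: x)
| alg_genM x y : alg_gen S x -> alg_gen S y -> alg_gen S (x * y).

(* A formal series in r variables with coefficients in W is its coefficient
   function int^r -> W; nothing is assumed about its support.  The product of
   a scalar series with a W-valued one is the convolution.  The sum is the
   library's finitely supported sum, whose value is 0 when the support is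
   infinite; in all the uses below the support is finite. *)
Section FormalCalculus.
Variable K : fieldType.

Definition smul (W : lmodType K) (G : zmodType) (f : G -> K) (g : G -> W)
    (d : G) : W :=
  \sum_(e \in [set: G]) f e *: g (d - e).

Definition sone (n : int) : K := (n == 0)%:R.
Definition spow (f : int -> K) (k : nat) : int -> K :=
  iter k (@smul K^o int f) sone.

Definition sexp (n : int) : K := if n is Posz m then m`!%:R^-1 else 0.
Definition sexpm1 (n : int) : K := sexp n - sone n.

(* (e^x - 1)/x = 1 + O(x), and its inverse x/(e^x - 1), expanded as the
   geometric series \sum_k (1 - (e^x - 1)/x)^k; only k <= n contributes to the
   coefficient of x^n. *)
Definition sexpm1_x (n : int) : K := sexpm1 (n + 1).
Definition sx_expm1 (n : int) : K :=
  \sum_(k < `|n|.+1) spow (fun m => sone m - sexpm1_x m) k n.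

(* The Laurent series e^x/(e^x - 1) and e^x/(e^x - 1)^2. *)
Definition stodd1 (n : int) : K := @smul K^o int sexp sx_expm1 (n + 1).
Definition stodd2 (n : int) : K :=
  @smul K^o int sexp (@smul K^o int sx_expm1 sx_expm1) (n + 2).

Definition sres (W : lmodType K) (f : int -> W) : W := f (-1).

(* The generalized binomial coefficient n(n-1)...(n-i+1)/i!. *)
Definition zbinom (n : int) (i : nat) : K :=
  (\prod_(j < i) (n%:~R - j%:R)) / i`!%:R.

(* The coefficient of y^p.1 z^p.2 in (y - z)^n, expanded in nonnegative powers
   of z. *)
Definition sbinom (n : int) (p : int * int) : K :=
  if (0 <= p.2) && (p.1 + p.2 == n) then (-1) ^+ `|p.2| * zbinom n `|p.2| else 0.

(* In each of the following, the coefficient of x0^a0 x1^a1 x2^a2, read off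
   from delta(x) = \sum_n x^n. *)

(* x0^-1 delta((x1 - x2)/x0) = \sum_n x0^(-n-1) (x1 - x2)^n *)
Definition delta_012 : int * int * int -> K := fun '(a0, a1, a2) =>
  sbinom (- a0 - 1) (a1, a2).

(* x0^-1 delta((x2 - x1)/(-x0)) = \sum_n (-1)^n x0^(-n-1) (x2 - x1)^n *)
Definition delta_021 : int * int * int -> K := fun '(a0, a1, a2) =>
  (-1) ^ (- a0 - 1) * sbinom (- a0 - 1) (a2, a1).

(* x2^-1 delta((x1 - x0)/x2) = \sum_n x2^(-n-1) (x1 - x0)^n *)
Definition delta_210 : int * int * int -> K := fun '(a0, a1, a2) =>
  sbinom (- a2 - 1) (a1, a0).

(* F(x1, x2) |-> F(x2 e^x0, x2), as a series in (x0, x2): x1^a x2^b is sent to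
   \sum_(p >= 0) a^p/p! x0^p x2^(a+b). *)
Definition subst_exp (W : lmodType K) (F : int * int -> W) :
    int * int -> W := fun '(p, q) =>
  if p is Posz m then
    \sum_(a \in [set: int]) (a%:~R ^+ m / m`!%:R) *: F (a, q - a)
  else 0.

End FormalCalculus.

Section WeakQVA.
Variables (K : fieldType) (V : lmodType K).

(* vm v n is v_n, i.e. the coefficient of x^(-n-1) in Y(v,x), and s lists the
   pairs (v^(i), u^(i)).  The identity, applied to w:
   x0^-1 delta((x1-x2)/x0) Y(u,x1)Y(v,x2)
   - x0^-1 delta((x2-x1)/(-x0)) \sum_i Y(v^(i),x2)Y(u^(i),x1)
   = x2^-1 delta((x1-x0)/x2) Y(Y(u,x0)v,x2). *)
Definition jacobi (vm : V -> int -> V -> V) (u v : V) (s : seq (V * V)) :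
    Prop :=
  forall (w : V) (d : int * int * int),
    smul (@delta_012 K) (fun '(a0, a1, a2) =>
        if a0 == 0 then vm u (- a1 - 1) (vm v (- a2 - 1) w) else 0) d
    - smul (@delta_021 K) (fun '(a0, a1, a2) =>
        if a0 == 0 then
          \sum_(p <- s) vm p.1 (- a2 - 1) (vm p.2 (- a1 - 1) w) else 0) d
    = smul (@delta_210 K) (fun '(a0, a1, a2) =>
        if a1 == 0 then vm (vm u (- a0 - 1) v) (- a2 - 1) w else 0) d.

Record weakQVA := WeakQVA {
  vmode : V -> int -> V -> V;
  vac : V;
  vmode_linearl : forall n w, linear (fun v => vmode v n w);
  vmode_linearr : forall v n, linear (vmode v n);
  vmode_trunc : forall u v, exists N : int, forall n, N <= n ->
    vmode u n v = 0;
  vac_mode : forall n v, vmode vac n v = if n == -1 then v else 0;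
  vmode_vac0 : forall v n, 0 <= n -> vmode v n vac = 0;
  vmode_vac : forall v, vmode v (-1) vac = v;
  vmode_jacobi : forall u v, exists s : seq (V * V), jacobi vmode u v s
}.

Variable Q : weakQVA.

Definition constant_Smap (S : {linear tens V V -> tens V V}) : Prop :=
  forall u v (s : seq (V * V)),
    S (tmk v u) = \sum_(p <- s) tmk p.1 p.2 -> jacobi (vmode Q) u v s.

Definition Dop (v : V) : V := vmode Q v (-2) (vac Q).

Definition Yser (u v : V) (n : int) : V := vmode Q u (- n - 1) v.

Definition star (u v : V) : V := sres (smul (@stodd1 K) (Yser u v)).

Definition Otilde : set V :=
  [set x | exists u v, x = sres (smul (@stodd2 K) (Yser u v))].

Definition Atilde := vquot Otilde.
HB.instance Definition _ := GRing.Lmodule.on Atilde.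
Definition Acls (u : V) : Atilde := vpi Otilde u.

(* A module for the associative algebra Atilde, whose product is the one induced
   by star and whose identity is the class of the vacuum. *)
Record is_Atilde_module (U : lmodType K) (act : Atilde -> U -> U) : Prop := {
  Aact_linearl : forall w, linear (act^~ w);
  Aact_linearr : forall a, linear (act a);
  Aact1 : forall w, act (Acls (vac Q)) w = w;
  AactM : forall u v w, act (Acls (star u v)) w = act (Acls u) (act (Acls v) w)
}.

Definition Atilde_irreducible (U : lmodType K) (act : Atilde -> U -> U) : Prop :=
  (exists u : U, u != 0) /\
  forall N : set U, is_subspace N -> (forall a u, N u -> N (act a u)) ->
    N = [set 0] \/ N = setT.

Section PhiModule.
Variable W : lmodType K.

(* YW v n is v_[n], i.e. the coefficient of x^(-n) in Y_W(v,x). *)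
Variable YW : V -> int -> W -> W.

(* Y_W(u,x1)Y_W(v,x2)w as a series in (x1, x2). *)
Definition YYser (u v : V) (w : W) : int * int -> W := fun '(a, b) =>
  YW u (- a) (YW v (- b) w).

(* The series lies in W((x1,x2)) = W[[x1,x2]][x1^-1,x2^-1]. *)
Definition in_laurent2 (F : int * int -> W) : Prop :=
  exists N : int, forall a b, a < N \/ b < N -> F (a, b) = 0.

Record is_phi_module : Prop := {
  phi_linearl : forall n w, linear (fun v => YW v n w);
  phi_linearr : forall v n, linear (YW v n);
  phi_trunc : forall v w, exists N : int, forall n, N <= n -> YW v n w = 0;
  phi_vac : forall n w, YW (vac Q) n w = if n == 0 then w else 0;
  phi_assoc : forall u v, exists k : nat,
    (forall w, in_laurent2 (smul (@sbinom K k) (YYser u v w))) /\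
    (forall w (d : int * int),
      (* (e^x0 - 1)^k Y_W(Y(u,x0)v,x2)w as a series in (x0, x2) *)
      smul (fun '(p, q) => if q == 0 then spow (@sexpm1 K) k p else 0)
           (fun '(p, q) => YW (Yser u v p) (- q) w) d
      (* (x1/x2 - 1)^k = x2^-k (x1 - x2)^k *)
      = subst_exp (smul (fun '(a, b) => @sbinom K k (a, b + k%:Z))
                        (YYser u v w)) d)
}.

(* W is the direct sum of the subspaces Wn n, and v_[m] W[n] is contained in
   W[n-m], which is 0 when n < m. *)
Record is_N_grading (Wn : nat -> set W) : Prop := {
  grad_subspace : forall n, is_subspace (Wn n);
  grad_total : forall w, exists N (f : nat -> W),
    (forall n, Wn n (f n)) /\ w = \sum_(n < N) f n;
  grad_direct : forall N (f : nat -> W), (forall n, Wn n (f n)) ->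
    \sum_(n < N) f n = 0 -> forall n, (n < N)%N -> f n = 0;
  grad_mode : forall v m n w, Wn n w ->
    if n%:Z - m is Posz k then Wn k (YW v m w) else YW v m w = 0
}.

Definition is_graded_submodule (Wn : nat -> set W) (N : set W) : Prop :=
  [/\ is_subspace N,
      forall v m w, N w -> N (YW v m w) &
      forall w, N w -> exists k (f : nat -> W),
        (forall n, Wn n (f n) /\ N (f n)) /\ w = \sum_(n < k) f n].

Definition phi_irreducible (Wn : nat -> set W) : Prop :=
  (exists w : W, w != 0) /\
  forall N, is_graded_submodule Wn N -> N = [set 0] \/ N = setT.

End PhiModule.

Variable S : {linear tens V V -> tens V V}.

Section ModeAlgebra.
Variables (I : nmodType) (iota : I -> K).

Local Notation X := (V * I)%type.
Local Notation u_ v n := (@TGen K X (v, n)).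

(* The relations between the generators v[n], n : I.  The sum over j >= 0 is cut
   at any N beyond which u_j v vanishes. *)
Inductive mode_rel : aterm K X -> aterm K X -> Prop :=
| mode_rel_linear a u v n :
    mode_rel (u_ (a *: u + v) n) (TAdd (TScale a (u_ u n)) (u_ v n))
| mode_rel_vac n :
    mode_rel (u_ (vac Q) n) (if n == 0 then TOne else TZero)
| mode_rel_D u n : mode_rel (u_ (Dop u) n) (TScale (- iota n) (u_ u n))
| mode_rel_comm u v m n (s : seq (V * V)) N :
    S (tmk v u) = \sum_(p <- s) tmk p.1 p.2 ->
    (forall j : nat, (N <= j)%N -> vmode Q u j v = 0) ->
    mode_rel
      (TAdd (TMul (u_ u m) (u_ v n))
            (TOpp (\big[@TAdd K X/TZero]_(p <- s) TMul (u_ p.1 n) (u_ p.2 m))))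
      (\big[@TAdd K X/TZero]_(j < N)
         TScale (iota m ^+ j / j`!%:R) (u_ (vmode Q u j v) (m + n))).

End ModeAlgebra.

Definition Utilde := palg (mode_rel (fun n : int => n%:~R)).
HB.instance Definition _ := GRing.Lmodule.on Utilde.
HB.instance Definition _ := GRing.PzRing.on Utilde.
Definition Umode (v : V) (n : int) : Utilde := pgen _ (v, n).

Definition Balg := palg (mode_rel (fun n : nat => n%:R)).
HB.instance Definition _ := GRing.Lmodule.on Balg.
HB.instance Definition _ := GRing.PzRing.on Balg.
Definition Bmode (v : V) (n : nat) : Balg := pgen _ (v, n).

Lemma Bmode_rel s t : mode_rel (fun n : nat => n%:R) s t ->
  mode_rel (fun n : int => n%:~R) (amap (fun x : V * nat => (x.1, x.2%:Z)) s)
    (amap (fun x : V * nat => (x.1, x.2%:Z)) t).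
Proof.
have asum (J : Type) (r : seq J) (P : pred J) (F : J -> aterm K (V * nat)) :
    amap (fun x : V * nat => (x.1, x.2%:Z))
      (\big[@TAdd K (V * nat)/TZero]_(j <- r | P j) F j)
    = \big[@TAdd K (V * int)/TZero]_(j <- r | P j)
        amap (fun x : V * nat => (x.1, x.2%:Z)) (F j).
  exact: (big_morph (amap _)).
case=> [a u v n|n|u n|u v m n r N Sr uN] /=.
- exact: mode_rel_linear.
- have -> : amap (fun x : V * nat => (x.1, x.2%:Z))
      (if n == 0 then TOne else TZero : aterm K (V * nat))
      = if n%:Z == 0 then TOne else TZero by case: n.
  exact: mode_rel_vac.
- exact: mode_rel_D.
- rewrite !asum /=; exact: (mode_rel_comm _ _ _ Sr uN).
Qed.

Definition Bpi : Balg -> Utilde :=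
  palg_map (fun x : V * nat => (x.1, x.2%:Z)) _.

Lemma Bpi_mode v n : Bpi (Bmode v n) = Umode v n.
Proof. exact/palg_map_gen/Bmode_rel. Qed.

Lemma Bpi1 : Bpi 1 = 1.
Proof. exact/palg_map1/Bmode_rel. Qed.

Lemma BpiM a b : Bpi (a * b) = Bpi a * Bpi b.
Proof. exact/palg_mapM/Bmode_rel. Qed.

Lemma Bpi_linear : linear Bpi.
Proof. exact/palg_map_linear/Bmode_rel. Qed.

(* The algebra homomorphism psi : B(V) -> Atilde(V); it is determined by its
   values on the generators. *)
Record is_psi (psi : Balg -> Atilde) : Prop := {
  psi_linear : linear psi;
  psi1 : psi 1 = Acls (vac Q);
  psiM : forall a b u v, psi a = Acls u -> psi b = Acls v ->
    psi (a * b) = Acls (star u v);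
  psi_mode : forall v m, psi (Bmode v m) = if m == 0%N then Acls v else 0
}.

Definition Uzero : set Utilde :=
  alg_gen [set x : Utilde | exists v, x = Umode v 0].
Definition Uplus : set Utilde :=
  alg_gen [set x : Utilde | exists v (n : nat), (0 < n)%N /\ x = Umode v (- n%:Z)].
Definition Uminus : set Utilde :=
  alg_gen [set x : Utilde | exists v (n : nat), (0 < n)%N /\ x = Umode v n].
Definition UzeroUminus : set Utilde :=
  [set x | exists a b, [/\ Uzero a, Uminus b & x = a * b]].

Definition assumptionA : Prop :=
  exists f : {linear tens (subsp Uplus) (subsp UzeroUminus) -> Utilde},
    (forall a b, f (tmk a b) = subsp_val a * subsp_val b) /\ bijective f.

Section Induced.
Variables (U : lmodType K) (act : Atilde -> U -> U) (psi : Balg -> Atilde).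

(* Utilde(V) (x)_B(V) U *)
Definition balanced : set (tens Utilde U) :=
  [set t | exists a b w, t = tmk (a * Bpi b) w - tmk a (act (psi b) w)].
Definition Mtilde := vquot balanced.
HB.instance Definition _ := GRing.Lmodule.on Mtilde.

Definition Mten (a : Utilde) (w : U) : Mtilde := vpi balanced (tmk a w).

Definition Mact (a : Utilde) : Mtilde -> Mtilde :=
  vqlift (tlift (fun b w => Mten (a * b) w)).

Lemma Mten_balanced a b w : Mten (a * Bpi b) w = Mten a (act (psi b) w).
Proof. by apply/vpi_eq/lspan_gen; exists a, b, w. Qed.

Lemma Mten_linearl w : linear (Mten^~ w).
Proof. by move=> c a b; rewrite /Mten tmk_linearl linearP. Qed.

Lemma Mten_linearr a : linear (Mten a).
Proof. by move=> c w w'; rewrite /Mten tmk_linearr linearP. Qed.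

Lemma Mtilde_ind (P : Mtilde -> Prop) :
  P 0 -> (forall x y, P x -> P y -> P (x + y)) ->
  (forall a w, P (Mten a w)) -> forall m, P m.
Proof.
move=> P0 PD Pt m; rewrite -(vreprK m); elim/tens_ind: (vrepr m) => //.
  by rewrite linear0.
by move=> x y Px Py; rewrite linearD; exact: PD.
Qed.

Section MactTheory.
Variable a : Utilde.

Let hl w : linear (fun b => Mten (a * b) w).
Proof.
by move=> c b b'; rewrite mulrDr -palg_scalerAr Mten_linearl.
Qed.
Let hr b : linear (fun w => Mten (a * b) w).
Proof. exact: Mten_linearr. Qed.
Let h_kill t : balanced t -> tlift (fun b w => Mten (a * b) w) t = 0.
Proof.
case=> b [c [w ->]]; rewrite -scaleN1r addrC (tlift_linear hl hr) !(tliftE hl hr).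
by rewrite mulrA Mten_balanced scaleN1r addNr.
Qed.

Lemma Mact_ten b w : Mact a (Mten b w) = Mten (a * b) w.
Proof. by rewrite /Mact vqliftE ?tliftE //; exact: tlift_linear. Qed.

Lemma Mact_linear : linear (Mact a).
Proof. by apply: vqlift_linear => //; exact: tlift_linear. Qed.

End MactTheory.

Lemma MactD a x y : Mact a (x + y) = Mact a x + Mact a y.
Proof. by have := Mact_linear a 1 x y; rewrite !scale1r. Qed.

Lemma Mact0 a : Mact a 0 = 0.
Proof.
by have := MactD a 0 0; rewrite addr0 => /eqP; rewrite -subr_eq subrr => /eqP.
Qed.

Lemma MactM a b m : Mact (a * b) m = Mact a (Mact b m).
Proof.
elim/Mtilde_ind: m => [|x y IHx IHy|c w]; last by rewrite !Mact_ten mulrA.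
  by rewrite !Mact0.
by rewrite !MactD IHx IHy.
Qed.

(* The component of degree d: deg v[n] = -n and deg (1 (x) U) = 0. *)
Definition Mgr (d : int) : set Mtilde :=
  in_span [set m | exists (s : seq (V * int)) w,
    \sum_(x <- s) x.2 = - d /\ m = Mten (\prod_(x <- s) Umode x.1 x.2) w].

Definition theta (w : U) : Mtilde := Mten 1 w.

Lemma theta_Bact b w : theta (act (psi b) w) = Mact (Bpi b) (theta w).
Proof. by rewrite /theta Mact_ten mulr1 -Mten_balanced mul1r. Qed.

(* Compatibility with the actions of B(V) is theta_Bact. *)
Definition theta_iso : Prop :=
  injective theta /\ forall m, Mgr 0 m -> exists w, m = theta w.

(* The projection of Mtilde onto Mgr 0, identified with U through theta, along
   the sum of the other graded components.  The default 0 is irrelevant when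
   theta_iso holds. *)
Definition P0 (m : Mtilde) : U :=
  xget 0 [set w | in_span (\bigcup_(d in [set d | d != 0]) Mgr d) (m - theta w)].

Definition Jsub : set Mtilde :=
  [set m | forall (ustar : {scalar U}) (a : Utilde), ustar (P0 (Mact a m)) = 0].

Definition Lmod := vquot Jsub.
HB.instance Definition _ := GRing.Lmodule.on Lmod.

Definition Lact (a : Utilde) : Lmod -> Lmod :=
  vqlift (fun m => vpi Jsub (Mact a m)).

Lemma Lact_pi a m : Lact a (vpi Jsub m) = vpi Jsub (Mact a m).
Proof.
rewrite /Lact vqliftE // => [c x y|x Jx]; first by rewrite Mact_linear linearP.
rewrite -(linear0 (vpi Jsub)); apply/vpi_eq; rewrite subr0; apply: lspan_gen.
by move=> ustar b; rewrite -MactM; exact: Jx.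
Qed.

Definition Lmode (v : V) (n : int) : Lmod -> Lmod := Lact (Umode v n).

Definition Lgr (n : nat) : set Lmod := vpi Jsub @` Mgr n.

Definition Ltop (w : U) : Lmod := vpi Jsub (theta w).

End Induced.

End WeakQVA.

Arguments Mten {K V Q S U} act psi a w.
Arguments Mact {K V Q S U} act psi a m.
Arguments Mgr {K V Q S U} act psi d _.
Arguments theta {K V Q S U} act psi w.
Arguments P0 {K V Q S U} act psi m.
Arguments Jsub {K V Q S U} act psi _.
Arguments Lact {K V Q S U} act psi a _.
Arguments Lmode {K V Q S U} act psi v n _.
Arguments Lgr {K V Q S U} act psi n _.
Arguments Ltop {K V Q S U} act psi w.

(* Main.v *)
Require Import Defs.
From HB Require Import structures.
From mathcomp Require Import all_boot all_order all_algebra.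
From mathcomp Require Import boolp classical_sets fsbigop reals complex.
From mathcomp Require Import zify ring.

(** A space graded in degrees n >= 0, with operators v[n] that satisfy the relations
of the universal algebra and lower the degree by n, is a phi-coordinated module as
soon as associativity holds.  Associativity can be tested: with t = x1/x2 = e^x0, pair
both of its sides with the functions t^l (t - 1)^n.  The side of Y(Y(u,x0)v,x2)
becomes a mode of the vector [vtest l n u v] = Res_y e^((l+1)y) (e^y - 1)^n
Y(u,y)v of V, the side of the product becomes the element [mtest l n q u v w],
obtained by expanding t^l (t - 1)^n at infinity against the products
u[a] v[q-a] w.  Their difference is [defect l n q u v w].  If at a vector w all
defects with large l vanish, then associativity holds at w ([phi_assoc_at]).  All
families indexed by l and n satisfy the recursion f(l+1,n) = f(l,n) + f(l,n+1) of
t^l (t - 1)^n, and for n >= 0 the defects vanish by the commutation relations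
([defect_nonneg]); what is at stake are the poles at t = 1.

In degree zero, J(U) is what makes the defects vanish.  A positive mode maps
defects at a vector of U to combinations of such defects ([mode_defect]), by the
action of the commutator formula on V.  The degree zero component of a defect
vanishes because U is a module over Atilde ([defect_degree0]): the function with
n = -1 gives the star product, those with n <= -2 give elements of Otilde.  By
Assumption A every element of the universal algebra is a combination of products
a+ a0 a-.  The factor a- keeps the span of the defects, a0 and a+ do not create
components in degree zero, so no element of the algebra takes a defect to a vector
with nonzero degree zero component: the defects at U lie in J(U) ([defect_J]).

Since U generates L(U), it remains to pass from w to c[m]w ([defect_mode]).  Test
the triple product of u, v, c at w against (t1 - t2)^n t1^l1 (t1 - 1)^n1 t2^l2
(t2 - 1)^n2.  By associativity at w, grouping v with c first and then u
([mtest3_modesA]) produces a mode of a vector of V that comes from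
Y(u,x1)Y(v,x2)c, while the vector that comes from Y(Y(u,x0)v,x2)c differs from the
same triple product by the defects of u and v at the vectors c[k]w
([mtest3_defect]).  The two vectors agree by the Jacobi identity of V, for large
powers of x1 ([modesA_B]); the resulting linear relations between defects are
triangular, so the defects vanish.

The grading uses the automorphism v[n] -> 2^(-n) v[n] of the universal algebra,
which acts on the graded components of the induced module by distinct scalars
([Mgr_direct]); Assumption A leaves only nonnegative degrees ([Mtotal]).  So P0 is
a linear projection, and J(U), the set of m with P0(a m) = 0 for all a
([Jsub_P0]), is homogeneous and meets U in 0: this gives the grading of L(U) and
its degree zero subspace.  Finally, a graded submodule with an element outside J(U)
reaches degree zero by the action of the algebra, its degree zero part is a
submodule of U over Atilde, and U generates L(U) ([Lmod_irreducible]). *)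

Set Implicit Arguments.
Unset Strict Implicit.
Unset Printing Implicit Defensive.

Import Order.TTheory GRing.Theory.

Local Open Scope classical_set_scope.
Local Open Scope ring_scope.

(** * Eventually zero sums *)

Definition evz (W : nmodType) (F : nat -> W) :=
  exists N, forall i, (N <= i)%N -> F i = 0.

(** The library sum over finite supports needs no explicit bound; [nsumE] evaluates
it at any bound. *)
Definition nsum (W : nmodType) (F : nat -> W) : W :=
  \sum_(i \in [set: nat]) F i.

Section EventuallyZeroSums.
Variables (K : fieldType) (W : lmodType K).
Implicit Types F G : nat -> W.

Lemma fsum_enum (T : choiceType) (N : nat) (phi : nat -> T) (F : T -> W) :
  injective phi ->
  (forall e, (forall i, (i < N)%N -> e <> phi i) -> F e = 0) ->
  \sum_(e \in [set: T]) F e = \sum_(i < N) F (phi i).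
Proof.
move=> phi_inj F0.
rewrite (fsbigE [seq phi i | i <- iota 0 N]).
- rewrite big_map -{1}[N]subn0 -/(index_iota 0 N) big_mkord.
  by apply: eq_bigl => i; rewrite in_setT.
- by rewrite map_inj_uniq ?iota_uniq.
- by [].
- move=> e _ /mapP ne; apply: F0 => i iN ei; apply: ne.
  by exists i; rewrite // mem_iota.
Qed.

Lemma nsumE N F : (forall i, (N <= i)%N -> F i = 0) ->
  nsum F = \sum_(i < N) F i.
Proof.
move=> F0; rewrite /nsum (@fsum_enum _ N id) //.
by move=> e ne; apply: F0; rewrite leqNgt; apply/negP => eN; exact: (ne e).
Qed.

Lemma eq_nsum F G : F =1 G -> nsum F = nsum G.
Proof. by move=> FG; apply: eq_fsbigr => i _. Qed.

Lemma nsum0 F : (forall i, F i = 0) -> nsum F = 0.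
Proof. by move=> F0; rewrite (@nsumE 0%N) ?big_ord0. Qed.

Lemma evzZ (c : nat -> K) F : evz F -> evz (fun i => c i *: F i).
Proof. by case=> N F0; exists N => i /F0 ->; rewrite scaler0. Qed.

Lemma nsumD F G : evz F -> evz G ->
  nsum (fun i => F i + G i) = nsum F + nsum G.
Proof.
move=> [M F0] [N G0].
have F0' i : (M + N <= i)%N -> F i = 0 by move=> le; apply: F0; lia.
have G0' i : (M + N <= i)%N -> G i = 0 by move=> le; apply: G0; lia.
rewrite (nsumE F0') (nsumE G0') (@nsumE (M + N)) ?big_split //= => i le.
by rewrite F0' ?G0' ?addr0.
Qed.

Lemma nsumZ (a : K) F : evz F -> nsum (fun i => a *: F i) = a *: nsum F.
Proof.
move=> [N F0]; rewrite (nsumE F0) scaler_sumr.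
by apply: nsumE => i /F0 ->; rewrite scaler0.
Qed.

Lemma nsum_sum (T : Type) (r : seq T) (G : T -> nat -> W) :
  (forall t, evz (G t)) ->
  nsum (fun i => \sum_(t <- r) G t i) = \sum_(t <- r) nsum (G t).
Proof.
move=> G0; elim: r => [|t r IH].
  by rewrite big_nil nsum0 // => i; rewrite big_nil.
rewrite big_cons -IH -nsumD //.
  by apply: eq_nsum => i; rewrite big_cons.
elim: r {IH} => [|t' r' [N IH]]; first by exists 0%N => i _; rewrite big_nil.
have [M HM] := G0 t'; exists (M + N)%N => i le.
by rewrite big_cons HM ?IH ?addr0 //; lia.
Qed.

Lemma evzS F : evz F -> evz (fun i => F i.+1).
Proof. by case=> N F0; exists N => i le; apply: F0; lia. Qed.

Lemma nsumS F : evz F -> nsum F = F 0%N + nsum (fun i => F i.+1).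
Proof.
move=> [N F0]; rewrite (@nsumE N.+1) ?(@nsumE N) ?big_ord_recl //.
  by move=> i le; rewrite F0 //; lia.
by move=> i le; rewrite F0 //; lia.
Qed.

Lemma nsum_exch N (F : nat -> nat -> W) :
  (forall i j, (N <= i)%N || (N <= j)%N -> F i j = 0) ->
  nsum (fun i => nsum (F i)) = nsum (fun j => nsum (F^~ j)).
Proof.
move=> F0.
have e1 i : nsum (F i) = \sum_(j < N) F i j.
  by apply: nsumE => j le; apply: F0; rewrite le orbT.
have e2 j : nsum (F^~ j) = \sum_(i < N) F i j.
  by apply: nsumE => i le; apply: F0; rewrite le.
rewrite (eq_nsum e1) (eq_nsum e2).
transitivity (\sum_(i < N) \sum_(j < N) F i j).
  by apply: nsumE => i le; rewrite big1 // => j _; apply: F0; rewrite le.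
rewrite exchange_big; symmetry.
by apply: nsumE => j le; rewrite big1 // => i _; apply: F0; rewrite le orbT.
Qed.

Lemma nsum_cauchy N (F : nat -> nat -> W) :
  (forall i j, (N <= i)%N || (N <= j)%N -> F i j = 0) ->
  nsum (fun k => \sum_(i < k.+1) F i (k - i)%N)
  = nsum (fun i => nsum (F i)).
Proof.
move=> F0.
have e1 i : nsum (F i) = \sum_(j < N) F i j.
  by apply: nsumE => j le; apply: F0; rewrite le orbT.
rewrite (eq_nsum e1).
have e2 : nsum (fun i => \sum_(j < N) F i j) = \sum_(i < N) \sum_(j < N) F i j.
  by apply: nsumE => i le; rewrite big1 // => j _; apply: F0; rewrite le.
rewrite e2.
have e3 : nsum (fun k => \sum_(i < k.+1) F i (k - i)%N)
    = \sum_(k < N + N) \sum_(i < k.+1) F i (k - i)%N.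
  apply: nsumE => k le; rewrite big1 // => i _; apply: F0.
  by have := ltn_ord i; lia.
rewrite e3.
pose G (k i : nat) := if (i <= k)%N then F i (k - i)%N else 0.
transitivity (\sum_(k < N + N) \sum_(i < N) G k i).
  apply: eq_bigr => k _.
  transitivity (\sum_(i < N + N) G k i).
    rewrite (big_ord_widen_cond (N + N)%N xpredT (fun i => F i (k - i)%N)) //=.
    rewrite big_mkcond /=; apply: eq_bigr => i _.
    by rewrite ltnS /G.
  rewrite big_split_ord /= [X in _ + X]big1 ?addr0 // => i _.
  by rewrite /G; case: ifP => // _; apply: F0; rewrite leq_addr.
rewrite exchange_big; apply: eq_bigr => i _ /=.
transitivity (\sum_(k < N) G (i + k)%N i).
  rewrite -(big_mkord xpredT (fun k => G k i)).
  have iN : (i <= N + N)%N by have := ltn_ord i; lia.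
  rewrite (@big_cat_nat _ _ _ i) //= big_nat_cond big1 ?add0r; last first.
    by move=> k /andP[/andP[_ ki] _]; rewrite /G leqNgt ki.
  rewrite -{1}[nat_of_ord i]add0n big_addn.
  rewrite (@big_cat_nat _ _ _ N) //=; last by have := ltn_ord i; lia.
  rewrite big_mkord [X in _ + X]big_nat_cond [X in _ + X]big1 ?addr0.
    by apply: eq_bigr => k _; rewrite addnC.
  move=> k /andP[/andP[Nk _] _]; rewrite /G; case: ifP => // _.
  by apply: F0; rewrite addnK Nk orbT.
by apply: eq_bigr => k _; rewrite /G leq_addr addKn.
Qed.

End EventuallyZeroSums.

Section SumMap.
Variables (K : fieldType) (W W' : lmodType K).
Implicit Types F : nat -> W.

Lemma nsum_map (f : {linear W -> W'}) F : evz F ->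
  nsum (fun i => f (F i)) = f (nsum F).
Proof.
move=> [N F0]; rewrite (nsumE F0) linear_sum.
by apply: nsumE => i /F0 ->; rewrite linear0.
Qed.

End SumMap.

(** * Power series and their action on sequences of modes *)

(** A separate name for coefficient sequences, so that they can carry the Cauchy
product as their multiplication. *)
Definition pseries (K : fieldType) := nat -> K.

Section PowerSeries.
Variable K : fieldType.
Local Notation pseries := (pseries K).
Implicit Types f g h : pseries.

HB.instance Definition _ := gen_eqMixin pseries.
HB.instance Definition _ := gen_choiceMixin pseries.

Definition ps_add f g : pseries := fun i => f i + g i.
Definition ps_opp f : pseries := fun i => - f i.
Definition ps_zero : pseries := fun=> 0.
Definition ps_one : pseries := fun i => (i == 0%N)%:R.
Definition ps_mul f g : pseries := fun n => \sum_(i < n.+1) f i * g (n - i)%N.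
Definition ps_X : pseries := fun i => (i == 1%N)%:R.

Let ps_addA : associative ps_add.
Proof. by move=> f g h; apply/funext => i; rewrite /ps_add addrA. Qed.
Let ps_addC : commutative ps_add.
Proof. by move=> f g; apply/funext => i; rewrite /ps_add addrC. Qed.
Let ps_add0 : left_id ps_zero ps_add.
Proof. by move=> f; apply/funext => i; rewrite /ps_add add0r. Qed.
Let ps_addN : left_inverse ps_zero ps_opp ps_add.
Proof. by move=> f; apply/funext => i; rewrite /ps_add addNr. Qed.
HB.instance Definition _ :=
  GRing.isZmodule.Build pseries ps_addA ps_addC ps_add0 ps_addN.

Definition ps_trunc N f : {poly K} := \poly_(i < N) f i.

(** Associativity and commutativity of the Cauchy product are inherited from
polynomials, since each coefficient involves finitely many others. *)
Lemma ps_mul_trunc N f g n : (n < N)%N ->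
  ps_mul f g n = (ps_trunc N f * ps_trunc N g)`_n.
Proof.
move=> nN; rewrite coefM; apply: eq_bigr => i _.
by rewrite !coef_poly; do 2?case: ifP => //; have := ltn_ord i; lia.
Qed.

Let ps_mulA : associative ps_mul.
Proof.
move=> f g h; apply/funext => n.
transitivity ((ps_trunc n.+1 f * (ps_trunc n.+1 g * ps_trunc n.+1 h))`_n).
  rewrite coefM; apply: eq_bigr => i _.
  rewrite -ps_mul_trunc; last by rewrite ltnS leq_subr.
  by rewrite coef_poly ltn_ord.
rewrite mulrA coefM; apply: eq_bigr => i _.
rewrite -ps_mul_trunc // coef_poly ifT //.
by rewrite ltnS leq_subr.
Qed.
Let ps_mulC : commutative ps_mul.
Proof.
move=> f g; apply/funext => n.
by rewrite !(@ps_mul_trunc n.+1) // mulrC.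
Qed.
Let ps_mul1 : left_id ps_one ps_mul.
Proof.
move=> f; apply/funext => n; rewrite /ps_mul big_ord_recl /ps_one eqxx mul1r.
by rewrite subn0 big1 ?addr0 // => i _; rewrite mul0r.
Qed.
Let ps_mulDl : left_distributive ps_mul ps_add.
Proof.
move=> f g h; apply/funext => n; rewrite /ps_mul /ps_add -big_split /=.
by apply: eq_bigr => i _; rewrite mulrDl.
Qed.
HB.instance Definition _ := GRing.Zmodule_isComPzRing.Build pseries
  ps_mulA ps_mulC ps_mul1 ps_mulDl.

Lemma psE :
  ((forall f g i, (f + g) i = f i + g i) * (forall f i, (- f) i = - f i))
  * ((forall i, (0 : pseries) i = 0) * (forall i, (1 : pseries) i = (i == 0%N)%:R)).
Proof. by []. Qed.

Lemma psMn f k i : (f *+ k) i = f i *+ k.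
Proof. by elim: k => [|k IH]; rewrite ?mulr0n // !mulrS psE IH. Qed.

Lemma psM f g n : (f * g) n = \sum_(i < n.+1) f i * g (n - i)%N.
Proof. by []. Qed.

Lemma psM0 f g : (f * g) 0%N = f 0%N * g 0%N.
Proof. by rewrite psM big_ord1 subn0. Qed.

Lemma psX0 f : (ps_X * f) 0%N = 0.
Proof. by rewrite psM0 mul0r. Qed.

Lemma psXS f n : (ps_X * f) n.+1 = f n.
Proof.
rewrite psM 2!big_ord_recl /= mul0r add0r mul1r /= big1 ?addr0 ?subn1 //.
by move=> i _; rewrite mul0r.
Qed.

Lemma ps_sum (I : Type) (r : seq I) (P : pred I) (F : I -> pseries) n :
  (\sum_(i <- r | P i) F i) n = \sum_(i <- r | P i) F i n.
Proof. by apply: (big_morph (fun f : pseries => f n)). Qed.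

End PowerSeries.

Definition evzi (W : nmodType) (F : int -> W) :=
  exists N : int, forall n, N <= n -> F n = 0.

(** Res_y y^n f(y) F(y), where F(y) = \sum_k F k y^(-k-1). *)
Definition pact (K : fieldType) (W : lmodType K) (f : pseries K) (F : int -> W)
    (n : int) : W :=
  nsum (fun i => f i *: F (n + i%:Z)).

Section Action.
Variables (K : fieldType) (W : lmodType K).
Implicit Types (f g h : pseries K) (F G : int -> W).

Lemma evzi_nat (c : nat -> K) F n : evzi F -> evz (fun i => c i *: F (n + i%:Z)).
Proof.
by move=> [N F0]; exists `|N - n|%N => i le; rewrite F0 ?scaler0 //; lia.
Qed.

Lemma eq_pact f F G n : (forall m, n <= m -> F m = G m) -> pact f F n = pact f G n.
Proof. by move=> FG; apply: eq_nsum => i; rewrite FG //; lia. Qed.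

Lemma pact_vanish N f F n : (forall m, N <= m -> F m = 0) -> N <= n ->
  pact f F n = 0.
Proof.
by move=> F0 le; apply: nsum0 => i; rewrite F0 ?scaler0 //; lia.
Qed.

Lemma pact_evzi f F : evzi F -> evzi (pact f F).
Proof. by move=> [N F0]; exists N => n; exact: pact_vanish. Qed.

Lemma pactDl f g F n : evzi F -> pact (f + g) F n = pact f F n + pact g F n.
Proof.
move=> F0; rewrite -nsumD; try exact: evzi_nat.
by apply: eq_nsum => i; rewrite psE scalerDl.
Qed.

Lemma pactDr f F G n : evzi F -> evzi G ->
  pact f (fun m => F m + G m) n = pact f F n + pact f G n.
Proof.
move=> F0 G0; rewrite -nsumD; try exact: evzi_nat.
by apply: eq_nsum => i; rewrite scalerDr.
Qed.

Lemma pactZr f a F n : evzi F -> pact f (fun m => a *: F m) n = a *: pact f F n.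
Proof.
move=> F0; rewrite -nsumZ; last exact: evzi_nat.
by apply: eq_nsum => i; rewrite !scalerA mulrC.
Qed.

Lemma pact1 F n : pact 1 F n = F n.
Proof.
rewrite /pact (@nsumE _ _ 1) ?big_ord1 ?psE ?scale1r ?addr0 // => -[|i] // _.
by rewrite psE scale0r.
Qed.

Lemma pactX f F n : evzi F -> pact (ps_X K * f) F n = pact f F (n + 1).
Proof.
move=> F0; rewrite /pact nsumS; last exact: evzi_nat.
rewrite psX0 scale0r add0r; apply: eq_nsum => i; rewrite psXS.
by congr (_ *: F _); lia.
Qed.

(** The sequences that vanish far to the right form a module over power series:
by this law residues in several variables can be taken one at a time. *)
Lemma pactM f h F n : evzi F -> pact (f * h) F n = pact f (pact h F) n.
Proof.
move=> F0; have [N HN] := F0.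
rewrite [RHS](_ : _ =
    nsum (fun i => nsum (fun j => (f i * h j) *: F (n + i%:Z + j%:Z)))).
  rewrite -(@nsum_cauchy _ _ `|N - n|%N); last first.
    by move=> i j le; rewrite HN ?scaler0 //; lia.
  apply: eq_nsum => k; rewrite psM scaler_suml; apply: eq_bigr => i _.
  by congr (_ *: F _); have := ltn_ord i; lia.
apply: eq_nsum => i; rewrite -nsumZ; last exact: evzi_nat.
by apply: eq_nsum => j; rewrite scalerA.
Qed.

End Action.

Lemma pact_map (K : fieldType) (W W' : lmodType K) (f : pseries K)
    (phi : {linear W -> W'}) (F : int -> W) n : evzi F ->
  pact f (fun m => phi (F m)) n = phi (pact f F n).
Proof.
move=> F0; rewrite -nsum_map; last exact: evzi_nat.
by apply: eq_nsum => i; rewrite linearZ.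
Qed.

(** * The test series *)

Section Exponentials.
Variable K : fieldType.
Hypothesis K_char0 : forall n, n.+1%:R != 0 :> K.
Local Notation pseries := (pseries K).

Lemma fact_neq0 n : n`!%:R != 0 :> K.
Proof. by rewrite -(prednK (fact_gt0 n)). Qed.

Definition ps_exp (a : K) : pseries := fun i => a ^+ i / i`!%:R.

Lemma ps_expD a b : ps_exp (a + b) = ps_exp a * ps_exp b.
Proof.
apply/funext => n; rewrite psM /ps_exp addrC exprDn mulr_suml.
apply: eq_bigr => i _; rewrite -mulr_natl.
have ni : (i <= n)%N by rewrite -ltnS.
have -> : ('C(n, i)%:R : K) = n`!%:R / (i`!%:R * (n - i)`!%:R).
  by rewrite -natrM -(bin_fact ni) natrM mulfK // natrM mulf_neq0 ?fact_neq0.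
have := fact_neq0 i; have := fact_neq0 (n - i); have := fact_neq0 n.
move=> h1 h2 h3; field.
by rewrite h1 h2 h3.
Qed.

(** (e^y - 1)/y *)
Definition ps_eps : pseries := fun i => (i.+1)`!%:R^-1.

Lemma ps_exp1 : ps_exp 1 = 1 + ps_X K * ps_eps.
Proof.
apply/funext => -[|n]; rewrite /ps_exp psE expr1n mul1r ?psX0 ?psXS psE.
  by rewrite fact0 invr1 addr0.
by rewrite add0r.
Qed.

Definition ps_low N (f : pseries) := forall i, (i < N)%N -> f i = 0.

Lemma ps_lowM M N (f g : pseries) :
  ps_low M f -> ps_low N g -> ps_low (M + N) (f * g).
Proof.
move=> fM gN n lt; rewrite psM big1 // => i _.
have [iM|Mi] := ltnP i M; first by rewrite fM ?mul0r.
by rewrite gN ?mulr0 //; have := ltn_ord i; lia.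
Qed.

Lemma ps_low_exp N (f : pseries) : ps_low 1 f -> ps_low N (f ^+ N).
Proof.
move=> f1; elim: N => [|N IH]; first by move=> i.
by rewrite exprS -add1n; exact: ps_lowM.
Qed.

Lemma ps_eps_low : ps_low 1 (1 - ps_eps).
Proof. by case=> // _; rewrite !psE /ps_eps invr1 subrr. Qed.

(** The inverse y/(e^y - 1) of [ps_eps], as a geometric series in 1 - [ps_eps]. *)
Definition ps_eta : pseries := fun n => \sum_(k < n.+1) ((1 - ps_eps) ^+ k) n.

Lemma ps_epsK : ps_eps * ps_eta = 1.
Proof.
apply/funext => n.
have eta_n i : (i <= n)%N -> ps_eta i = (\sum_(k < n.+1) (1 - ps_eps) ^+ k) i.
  move=> le; rewrite ps_sum /ps_eta.
  rewrite -!(big_mkord xpredT (fun k => ((1 - ps_eps) ^+ k) i)).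
  rewrite [RHS](@big_cat_nat _ _ _ i.+1) //=.
  rewrite [X in _ = _ + X](_ : _ = 0) ?addr0 // big_nat_cond big1 //.
  by move=> k /andP[/andP[ik _] _]; exact: (ps_low_exp ps_eps_low).
transitivity ((ps_eps * \sum_(k < n.+1) (1 - ps_eps) ^+ k) n).
  by apply: eq_bigr => i _; rewrite eta_n ?leq_subr.
have -> : ps_eps * (\sum_(k < n.+1) (1 - ps_eps) ^+ k) = 1 - (1 - ps_eps) ^+ n.+1.
  rewrite -[1 in X in _ = X - _](expr1n _ n.+1) subrXX.
  congr (_ * _); first by rewrite opprB addrC subrK.
  by apply: eq_bigr => i _; rewrite expr1n mul1r.
by rewrite !psE (ps_low_exp ps_eps_low) // oppr0 addr0.
Qed.

Definition ps_eps_pow (n : int) : pseries :=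
  match n with Posz m => ps_eps ^+ m | Negz m => ps_eta ^+ m.+1 end.

Lemma ps_eps_powS n : ps_eps_pow (n + 1) = ps_eps * ps_eps_pow n.
Proof.
case: n => [n|[|n]]; first by rewrite /= addn1 exprS.
  by rewrite /= expr1 ps_epsK.
have -> : (Negz n.+1 + 1) = Negz n by lia.
by rewrite /= [ps_eta ^+ n.+2]exprS mulrA ps_epsK mul1r.
Qed.

Lemma ps_eps_pow0 n : ps_eps_pow n 0%N = 1.
Proof.
have eps0 : ps_eps 0%N = 1 by rewrite /ps_eps invr1.
have eta0 : ps_eta 0%N = 1 by rewrite /ps_eta big_ord1 expr0.
by case: n => m /=; elim: m => [|m IH]; rewrite ?expr1 // exprS psM0 ?eps0 ?eta0 IH mulr1.
Qed.

(** e^((l+1)y) ((e^y - 1)/y)^n.  In the variable t = e^y, for which dt = e^y dy,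
the form y^n [test_ps l n] dy is t^l (t - 1)^n dt. *)
Definition test_ps (l n : int) : pseries := ps_exp (l%:~R + 1) * ps_eps_pow n.

Lemma test_ps_expM a l n : ps_exp a%:~R * test_ps l n = test_ps (l + a) n.
Proof.
rewrite /test_ps mulrA -ps_expD; congr (ps_exp _ * _).
by rewrite intrD; ring.
Qed.

(** t^(l+1) = t^l + t^l (t - 1), with t - 1 = y [ps_eps]. *)
Lemma test_ps_rec l n : test_ps (l + 1) n = test_ps l n + ps_X K * test_ps l (n + 1).
Proof.
rewrite -test_ps_expM -[1%:~R]/(1 : K) ps_exp1 mulrDl mul1r; congr (_ + _).
by rewrite /test_ps ps_eps_powS; ring.
Qed.

Lemma test_ps0 l : test_ps l 0 = ps_exp (l%:~R + 1).
Proof. by rewrite /test_ps /= mulr1. Qed.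

Lemma test_ps_lead l n : test_ps l n 0%N = 1.
Proof. by rewrite /test_ps psM0 ps_eps_pow0 mulr1 /ps_exp expr0 fact0 divr1. Qed.

(** The Euler operator y d/dy. *)
Definition ps_theta (f : pseries) : pseries := fun i => i%:R * f i.

Lemma ps_thetaM f g : ps_theta (f * g) = ps_theta f * g + f * ps_theta g.
Proof.
apply/funext => n; rewrite /ps_theta psE !psM mulr_sumr -big_split /=.
apply: eq_bigr => i _; have le : (i <= n)%N by rewrite -ltnS.
by rewrite -{1}(subnKC le) natrD; ring.
Qed.

Lemma ps_theta_exp1 : ps_theta (ps_exp 1) = ps_X K * ps_exp 1.
Proof.
apply/funext => -[|n]; rewrite /ps_theta ?psX0 ?mul0r // psXS /ps_exp !expr1n.
rewrite factS natrM; have := fact_neq0 n; have := K_char0 n => h1 h2; field.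
by rewrite h2 nat1r.
Qed.

Lemma ps_theta_eps : ps_theta ps_eps = ps_exp 1 - ps_eps.
Proof.
apply/funext => n; rewrite !psE /ps_theta /ps_exp /ps_eps expr1n.
rewrite factS natrM -natr1; have := fact_neq0 n; have := K_char0 n.
by rewrite -natr1 => h1 h2; field; rewrite h2.
Qed.

Lemma ps_theta_eta : ps_theta ps_eta = ps_eta - ps_eta ^+ 2 * ps_exp 1.
Proof.
have theta1 : ps_theta 1 = 0.
  by apply/funext => -[|n]; rewrite /ps_theta ?mul0r // mulr0.
have := congr1 (fun f => ps_eta * f) (ps_thetaM ps_eps ps_eta).
rewrite ps_epsK theta1 mulr0 ps_theta_eps mulrDr !mulrA.
rewrite [ps_eta * ps_eps]mulrC ps_epsK mul1r => /esym/eqP.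
rewrite addrC addr_eq0 => /eqP ->.
transitivity (ps_eta * (ps_eps * ps_eta) - ps_eta ^+ 2 * ps_exp 1); first by ring.
by rewrite ps_epsK mulr1.
Qed.

Lemma ps_theta_etaX r :
  ps_theta (ps_eta ^+ r) = (ps_eta ^+ r - ps_exp 1 * ps_eta ^+ r.+1) *+ r.
Proof.
elim: r => [|r IH].
  by apply/funext => -[|n]; rewrite mulr0n /ps_theta ?mul0r // mulr0.
rewrite exprS ps_thetaM ps_theta_eta IH -mulr_natr -[RHS]mulr_natr -natr1.
rewrite !exprS expr0; move: (r%:R) (ps_eta ^+ r) (ps_exp 1) ps_eta.
by move=> c g e t; ring.
Qed.

(** The residue of e^y (e^y - 1)^(-r-1) dy; for r > 0 this form is exact. *)
Lemma test_ps0_res r : test_ps 0 (Negz r) r = (r == 0%N)%:R.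
Proof.
case: r => [|r]; first by rewrite test_ps_lead.
have := congr1 (fun f : pseries => f r.+1) (ps_theta_etaX r.+1).
rewrite /test_ps add0r /= -mulr_natl.
have -> (f : pseries) n i : (n%:R * f) i = n%:R * f i.
  elim: n => [|n IH]; first by rewrite !mul0r.
  by rewrite -!natr1 !mulrDl !psE IH !mul1r.
rewrite /ps_theta !psE => /(mulfI (K_char0 r)) /eqP.
by rewrite -{1}[X in X == _]addr0 (inj_eq (addrI _)) eq_sym oppr_eq0 => /eqP.
Qed.

(** The derivative of e^y (e^y - 1)^(-r-1), a combination of the same function and
of the one with r + 1: this is what integration by parts produces in
[vtest_Dop]. *)
Lemma test_ps0_theta r : ps_theta (test_ps 0 (Negz r)) - test_ps 0 (Negz r) *+ r.+1
  = - (test_ps 0 (Negz r.+1) *+ r.+1) - (ps_X K * test_ps 0 (Negz r)) *+ r.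
Proof.
have e2 : ps_exp 1 * ps_eta * ps_exp 1 = ps_exp 1 * ps_eta + ps_X K * ps_exp 1.
  rewrite {2}ps_exp1 mulrDr mulr1; congr (_ + _).
  by rewrite -[RHS]mulr1 -ps_epsK; ring.
rewrite /test_ps add0r /= ps_thetaM ps_theta_exp1 ps_theta_etaX.
rewrite -[(_ - _) *+ r.+1]mulr_natr -[(ps_exp 1 * ps_eta ^+ r.+1) *+ _]mulr_natr.
rewrite -[(ps_exp 1 * ps_eta ^+ r.+2) *+ _]mulr_natr -[_ *+ r]mulr_natr -natr1.
rewrite [ps_eta ^+ r.+2]exprS.
move: e2 (r%:R) (ps_eta ^+ r.+1); move: (ps_exp 1) ps_eta (ps_X K) => e t x e2 c g.
transitivity (x * e * g - (e * t * e) * g * (c + 1)); first by ring.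
by rewrite e2; ring.
Qed.

End Exponentials.

(** * Binomial sums and the Pascal recursion *)

Section Binomials.
Variable K : fieldType.
Hypothesis K_char0 : forall n, n.+1%:R != 0 :> K.
Implicit Types n : int.
Local Notation zbinom := (zbinom K).

Lemma zbinom0 n : zbinom n 0 = 1.
Proof. by rewrite /zbinom big_ord0 fact0 divr1. Qed.

Lemma zbinomS n i : zbinom (n + 1) i.+1 = zbinom n i.+1 + zbinom n i.
Proof.
rewrite /zbinom [X in X / _]big_ord_recl [X in _ = X / _ + _]big_ord_recr /=.
have -> : \prod_(j < i) ((n + 1)%:~R - (bump 0 j)%:R : K)
    = \prod_(j < i) (n%:~R - j%:R).
  apply: eq_bigr => j _; rewrite /bump leq0n add1n -natr1 intrD.
  by rewrite opprD addrACA subrr addr0.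
rewrite factS natrM intrD; have := fact_neq0 K_char0 i; have := K_char0 i.
by rewrite -natr1 => h1 h2; field; rewrite h1 h2.
Qed.

Lemma zbinom_small (n i : nat) : (n < i)%N -> zbinom n i = 0.
Proof.
move=> lt; rewrite /zbinom (bigD1 (Ordinal lt)) //= subrr mul0r mul0r.
by [].
Qed.

Lemma zbinom_bin (n i : nat) : zbinom n i = 'C(n, i)%:R.
Proof.
elim: n i => [|n IH] [|i]; rewrite ?zbinom0 ?bin0 //.
  by rewrite zbinom_small.
by rewrite -addn1 PoszD zbinomS !IH addn1 binS natrD.
Qed.

Lemma zbinom_opp n i : (-1) ^+ i * zbinom (i%:Z - n - 1) i = zbinom n i.
Proof.
rewrite /zbinom mulrA; congr (_ / _).
rewrite -[X in (-1) ^+ X]card_ord -prodr_const -big_split /= (reindex_inj rev_ord_inj) /=.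
apply: eq_bigr => j _; rewrite mulN1r opprB.
have le : (j < i)%N by [].
rewrite natrB // !intrD -natr1 !mulrNz /=.
by rewrite -[_%:~R]/(i%:R : K) -[1%:~R]/(1 : K); ring.
Qed.

(** The coefficient of x^(n-i) z^i in (x - z)^n. *)
Definition bcoef n i : K := (-1) ^+ i * zbinom n i.

Lemma bcoef0 n : bcoef n 0 = 1.
Proof. by rewrite /bcoef zbinom0 mulr1. Qed.

Lemma bcoefS n i : bcoef (n + 1) i.+1 = bcoef n i.+1 - bcoef n i.
Proof. by rewrite /bcoef zbinomS exprS; ring. Qed.

Lemma bcoef_zero i : bcoef 0 i.+1 = 0.
Proof. by rewrite /bcoef zbinom_small // mulr0. Qed.

End Binomials.

(** (x - z)^n paired with F, when F i is the pairing with x^(n-i) z^i. *)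
Definition bsum (K : fieldType) (W : lmodType K) (n : int) (F : nat -> W) : W :=
  nsum (fun i => bcoef K n i *: F i).

Section BinomialSums.
Variable K : fieldType.
Hypothesis K_char0 : forall n, n.+1%:R != 0 :> K.
Variable W : lmodType K.
Implicit Types (n : int) (F G : nat -> W).

Lemma bsum0 F : bsum 0 F = F 0%N.
Proof.
rewrite /bsum (@nsumE _ _ 1) ?big_ord1 ?bcoef0 ?scale1r // => -[|i] // _.
by rewrite bcoef_zero scale0r.
Qed.

Lemma bsumS n F : evz F -> bsum (n + 1) F = bsum n F - bsum n (fun i => F i.+1).
Proof.
move=> F0; have F1 := evzS F0; rewrite /bsum.
rewrite nsumS; last exact: evzZ.
rewrite [in RHS]nsumS; last exact: evzZ.
rewrite !bcoef0 -addrA; congr (_ + _); rewrite -scaleN1r -nsumZ; last exact: evzZ.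
rewrite -nsumD; try exact: evzZ.
  by apply: eq_nsum => i; rewrite bcoefS // scalerBl scaleN1r.
have [N HN] := F1; exists N => i /HN ->.
by rewrite !scaler0.
Qed.

Lemma eq_bsum n F G : F =1 G -> bsum n F = bsum n G.
Proof. by move=> FG; apply: eq_nsum => i; rewrite FG. Qed.

Lemma bsum_zero n F : (forall i, F i = 0) -> bsum n F = 0.
Proof. by move=> F0; apply: nsum0 => i; rewrite F0 scaler0. Qed.

Lemma bsumD n F G : evz F -> evz G ->
  bsum n (fun i => F i + G i) = bsum n F + bsum n G.
Proof.
move=> F0 G0; rewrite /bsum -nsumD; try exact: evzZ.
by apply: eq_nsum => i; rewrite scalerDr.
Qed.

Lemma bsumB n F G : evz F -> evz G ->
  bsum n (fun i => F i - G i) = bsum n F - bsum n G.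
Proof.
move=> F0 G0; have G1 : evz (fun i => -1 *: G i) by apply: evzZ.
rewrite -[bsum n G]scale1r -scaleNr /bsum -nsumZ; last exact: evzZ.
rewrite -nsumD; try exact: evzZ.
  by apply: eq_nsum => i; rewrite scalerBr scaleN1r.
by have [N HN] := G0; exists N => i /HN ->; rewrite !scaler0.
Qed.

Lemma bsum_sum n (T : Type) (r : seq T) (G : T -> nat -> W) :
  (forall t, evz (G t)) ->
  bsum n (fun i => \sum_(t <- r) G t i) = \sum_(t <- r) bsum n (G t).
Proof.
move=> G0; rewrite /bsum -nsum_sum; last by move=> t; apply: evzZ.
by apply: eq_nsum => i; rewrite scaler_sumr.
Qed.

Lemma bsum_exch N m n (F : nat -> nat -> W) :
  (forall i j, (N <= i)%N || (N <= j)%N -> F i j = 0) ->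
  bsum m (fun i => bsum n (F i)) = bsum n (fun j => bsum m (F^~ j)).
Proof.
move=> F0.
have e1 i : bcoef K m i *: bsum n (F i)
    = nsum (fun j => (bcoef K m i * bcoef K n j) *: F i j).
  rewrite /bsum -nsumZ; first by apply: eq_nsum => j; rewrite scalerA.
  by exists N => j le; rewrite F0 ?scaler0 // le orbT.
have e2 j : bcoef K n j *: bsum m (F^~ j)
    = nsum (fun i => (bcoef K m i * bcoef K n j) *: F i j).
  rewrite /bsum -nsumZ; first by apply: eq_nsum => i; rewrite scalerA mulrC.
  by exists N => i le; rewrite F0 ?scaler0 // le.
rewrite [LHS](eq_nsum e1) [RHS](eq_nsum e2).
by apply: (@nsum_exch _ _ N) => i j le; rewrite F0 ?scaler0.
Qed.

(** The recursion of the functions t^l (t - 1)^n, inherited by everything that is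
paired with them. *)
Definition pascal (f : int -> int -> W) :=
  forall l n, f (l + 1) n = f l n + f l (n + 1).

(** The factor (t - 1)^k of t^l (t - 1)^(n+k) is expanded by the binomial theorem.
The coefficients are those of a universal formula, hence independent of f. *)
Lemma pascal_up k : exists2 c : nat -> K, c 0%N = 1 &
  forall f l n, pascal f ->
    f l (n + k%:Z) = \sum_(s < k.+1) c s *: f (l + k%:Z - s%:Z) n.
Proof.
elim: k => [|k [c c0 IH]].
  exists (fun=> 1) => // f l n _.
  by rewrite big_ord1 scale1r addr0 addr0 subr0.
exists (fun s => (if (s <= k)%N then c s else 0)
    - (if s is s'.+1 then c s' else 0)).
  by rewrite subr0 c0.
move=> f l n fP.
have -> : n + k.+1%:Z = n + k%:Z + 1 by lia.
have -> : f l (n + k%:Z + 1) = f (l + 1) (n + k%:Z) - f l (n + k%:Z).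
  by rewrite fP [RHS]addrAC subrr add0r.
rewrite !IH //.
under [RHS]eq_bigr => s _ do rewrite scalerBl.
rewrite sumrB; congr (_ - _).
  rewrite [RHS]big_ord_recr /= ltnn scale0r addr0; apply: eq_bigr => s _.
  have -> : (s <= k)%N by rewrite -ltnS.
  by congr (_ *: f _ _); lia.
rewrite [RHS]big_ord_recl /= scale0r add0r; apply: eq_bigr => s _.
by congr (_ *: f _ _); rewrite /bump leq0n; lia.
Qed.

(** If f vanishes at n + 1, the recursion makes f(l, n) independent of l, and
therefore equal to its value 0 at low l. *)
Lemma pascal_down (f : int -> int -> W) n0 : pascal f ->
  (forall l, f l n0 = 0) ->
  (forall n, exists L : int, forall l, l <= L -> f l n = 0) ->
  forall n l, n <= n0 -> f l n = 0.
Proof.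
move=> fP f0 flow n l le.
have -> : n = n0 - (`|n0 - n|%N)%:Z by lia.
elim: `|n0 - n|%N l => [|r IH] l {le}; first by rewrite subr0.
set m := n0 - _; have [L HL] := flow m.
have shift i : f (l - i%:Z) m = f l m.
  elim: i => [|i <-]; first by rewrite subr0.
  have := fP (l - i.+1%:Z) m.
  have -> : l - i.+1%:Z + 1 = l - i%:Z by lia.
  have -> : m + 1 = n0 - r%:Z by rewrite /m; lia.
  by rewrite IH addr0.
by rewrite -(shift `|l - L|%N) HL //; lia.
Qed.

End BinomialSums.

Lemma bsum_map (K : fieldType) (W W' : lmodType K) (phi : {linear W -> W'}) n
    (F : nat -> W) : evz F -> bsum n (fun i => phi (F i)) = phi (bsum n F).
Proof.
move=> F0; rewrite /bsum -nsum_map; last exact: evzZ.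
by apply: eq_nsum => i; rewrite linearZ.
Qed.

(** * Laurent series *)

(** y^a f(y) *)
Definition laurent (K : fieldType) (a : int) (f : pseries K) : int -> K :=
  fun j => if j - a is Posz i then f i else 0.

Section FormalProducts.
Variable K : fieldType.

Lemma smul_nsum (W : lmodType K) (G : zmodType) (f : G -> K) (g : G -> W) d
    (phi : nat -> G) :
  injective phi -> (forall e, (forall i, e <> phi i) -> f e *: g (d - e) = 0) ->
  evz (fun i => f (phi i) *: g (d - phi i)) ->
  smul f g d = nsum (fun i => f (phi i) *: g (d - phi i)).
Proof.
move=> phi_inj out [N HN]; rewrite (nsumE HN) /smul.
apply: fsum_enum => // e ne.
have [[i ei]|no] := pselect (exists i, e = phi i); last first.
  by apply: out => i ei; apply: no; exists i.
rewrite ei HN // leqNgt; apply/negP => iN; exact: (ne i).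
Qed.

Lemma laurentE a (f : pseries K) i : laurent a f (a + i%:Z) = f i.
Proof. by rewrite /laurent [a + _]addrC addrK. Qed.

Lemma laurent_low a (f : pseries K) j : j < a -> laurent a f j = 0.
Proof. by rewrite /laurent => lt; case E: (j - a) => //; lia. Qed.

Lemma smul_laurent (W : lmodType K) a (f : pseries K) (g : int -> W) d :
  evz (fun i => f i *: g (d - a - i%:Z)) ->
  smul (laurent a f) g d = nsum (fun i => f i *: g (d - a - i%:Z)).
Proof.
have gE i : laurent a f (a + i%:Z) *: g (d - (a + i%:Z))
    = f i *: g (d - a - i%:Z).
  by rewrite laurentE opprD addrA.
move=> [N HN]; rewrite (@smul_nsum _ _ _ _ _ (fun i => a + i%:Z)).
- by apply: eq_nsum.
- by move=> i j; lia.
- move=> e ne; rewrite laurent_low ?scale0r // ltNge; apply/negP => le.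
  by apply: (ne `|e - a|%N); lia.
- by exists N => i /HN; rewrite gE.
Qed.

Lemma laurentM a b (f g : pseries K) :
  @smul K K^o int (laurent a f) (laurent b g) = laurent (a + b) (f * g).
Proof.
apply/funext => d.
have zero i : (d - a - i%:Z < b) -> f i *: (laurent b g (d - a - i%:Z) : K^o) = 0.
  by move=> lt; rewrite laurent_low // scaler0.
rewrite smul_laurent; last first.
  by exists (absz (d - a - b + 1)) => i le; apply: zero; lia.
rewrite /laurent; case E: (d - (a + b)) => [n|n].
  rewrite (@nsumE _ _ n.+1) => [|i le]; last by apply: zero; lia.
  rewrite psM; apply: eq_bigr => i _.
  have -> : d - a - i%:Z - b = (n - i)%N by have := ltn_ord i; lia.
  by [].
by apply: nsum0 => i; apply: zero; lia.
Qed.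

Lemma soneE : sone K = laurent 0 1.
Proof. by apply/funext => -[n|n]; rewrite /laurent subr0. Qed.

Lemma sexpE : sexp K = laurent 0 (ps_exp 1).
Proof.
apply/funext => -[n|n]; rewrite /laurent subr0 //=.
by rewrite /ps_exp expr1n mul1r.
Qed.

Lemma sexpm1E : sexpm1 K = laurent 1 (ps_eps K).
Proof.
apply/funext => n; rewrite /sexpm1 /sone /laurent /sexp.
case: n => [[|n]|n]; rewrite ?subr0 ?fact0 ?invr1 ?subrr //.
by have -> : n.+1%:Z - 1 = n by lia.
Qed.

Lemma spow_laurent a (f : pseries K) k :
  spow (laurent a f) k = laurent (a *+ k) (f ^+ k).
Proof.
elim: k => [|k IH]; first by rewrite /spow /= soneE mulr0n.
rewrite mulrS exprS -laurentM -IH.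
by [].
Qed.

Lemma spow_sexpm1 k : spow (@sexpm1 K) k = laurent k%:Z (ps_eps K ^+ k).
Proof. by rewrite sexpm1E spow_laurent; congr laurent; lia. Qed.

Lemma sx_expm1E : sx_expm1 K = laurent 0 (ps_eta K).
Proof.
have step : (fun m => sone K m - sexpm1_x K m) = laurent 0 (1 - ps_eps K).
  apply/funext => m; rewrite soneE /sexpm1_x sexpm1E.
  rewrite /laurent addrK subr0; case: m => [m|m]; first by rewrite !psE.
  by rewrite subr0.
apply/funext => n; rewrite /sx_expm1 step.
under eq_bigr => k _ do rewrite spow_laurent mul0rn.
case: n => [n|n]; rewrite /laurent subr0 //.
by rewrite big1.
Qed.

Lemma laurent_shift a b (f : pseries K) n :
  laurent a f (n + b) = laurent (a - b) f n.
Proof. by rewrite /laurent opprB addrA [n + b]addrC -addrA addrC -addrA. Qed.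

Lemma stodd1E : stodd1 K = laurent (-1) (test_ps K 0 (-1)).
Proof.
apply/funext => n; rewrite /stodd1 sexpE sx_expm1E laurentM laurent_shift.
by rewrite /test_ps; congr (laurent _ (_ * _)); rewrite add0r.
Qed.

Lemma stodd2E : stodd2 K = laurent (-2) (test_ps K 0 (-2)).
Proof.
apply/funext => n; rewrite /stodd2 sexpE sx_expm1E !laurentM laurent_shift.
by rewrite /test_ps; congr (laurent _ (_ * _)); rewrite add0r.
Qed.

End FormalProducts.

(** * Linear maps and formal sums *)

Section LinearMaps.
Variables (K : fieldType) (W W' : lmodType K) (f : W -> W').
Hypothesis fl : linear f.

Definition mklin : {linear W -> W'} :=
  HB.pack f (GRing.isLinear.Build K W W' *:%R f fl).

Lemma lin0 : f 0 = 0. Proof. exact: (linear0 mklin). Qed.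
Lemma linD u v : f (u + v) = f u + f v. Proof. exact: (linearD mklin). Qed.
Lemma linB u v : f (u - v) = f u - f v. Proof. exact: (linearB mklin). Qed.
Lemma linZ a u : f (a *: u) = a *: f u. Proof. exact: (linearZ_LR mklin). Qed.
Lemma lin_sum I (r : seq I) (P : pred I) (F : I -> W) :
  f (\sum_(i <- r | P i) F i) = \sum_(i <- r | P i) f (F i).
Proof. exact: (linear_sum mklin). Qed.
Lemma lin_nsum F : evz F -> f (nsum F) = nsum (fun i => f (F i)).
Proof. by move=> F0; apply: esym; exact: (nsum_map mklin). Qed.
Lemma lin_bsum n F : evz F -> f (bsum n F) = bsum n (fun i => f (F i)).
Proof. by move=> F0; apply: esym; exact: (bsum_map mklin). Qed.
Lemma lin_pact g F n : evzi F -> f (pact g F n) = pact g (fun k => f (F k)) n.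
Proof. by move=> F0; apply: esym; exact: (pact_map g mklin). Qed.
End LinearMaps.

Lemma unif_bound (P : nat -> int -> Prop) :
  (forall i, exists N : int, forall n, N <= n -> P i n) ->
  forall I, exists N : int, forall i n, (i < I)%N -> N <= n -> P i n.
Proof.
move=> HP; elim=> [|I [N HN]]; first by exists 0.
have [M HM] := HP I; exists (M + (absz M)%:Z + N + (absz N)%:Z) => i n.
rewrite ltnS leq_eqVlt => /orP[/eqP ->|iI] le; first by apply: HM; lia.
by apply: HN => //; lia.
Qed.

Lemma pact_sum (K : fieldType) (W : lmodType K) (T : Type) (r : seq T)
    (f : pseries K) (G : T -> int -> W) n : (forall t, evzi (G t)) ->
  pact f (fun m => \sum_(t <- r) G t m) n = \sum_(t <- r) pact f (G t) n.
Proof.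
move=> G0; rewrite /pact -nsum_sum; last by move=> t; apply: evzi_nat.
by apply: eq_nsum => i; rewrite scaler_sumr.
Qed.

(** * The Jacobi identity in terms of modes *)

Section VertexModes.
Variable K : fieldType.
Hypothesis K_char0 : forall n, n.+1%:R != 0 :> K.
Variables (V : lmodType K) (Q : weakQVA V).
Implicit Types (u v w c y : V) (l m n : int).
Local Notation vm := (vmode Q).

Let vml n w := vmode_linearl Q n w.
Let vmr v n := vmode_linearr Q v n.

Lemma vm_evzi u v : evzi (fun n => vm u n v).
Proof. exact: vmode_trunc. Qed.

(** (x1 - x2)^j x1^k x2^m, expanded for |x1| > |x2|, paired with
Y(u,x1) Y(v,x2) c. *)
Definition modesA u v c (j k m : int) : V :=
  bsum j (fun i => vm u (k + j - i%:Z) (vm v (m + i%:Z) c)).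

(** x0^j (x2 + x0)^k x2^m, expanded for |x2| > |x0|, paired with
Y(Y(u,x0) v, x2) c. *)
Definition modesB u v c (j k m : int) : V :=
  nsum (fun i => zbinom K k i *: vm (vm u (j + i%:Z) v) (k + m - i%:Z) c).

Lemma modesA_evz u v c (k m : int) (j : int) :
  evz (fun i => vm u (k + j - i%:Z) (vm v (m + i%:Z) c)).
Proof.
have [N HN] := vmode_trunc Q v c; exists (absz (N - m)) => i le.
by rewrite HN ?(lin0 (vmr _ _)) //; lia.
Qed.

Lemma modesB_evz u v c (k m : int) (j : int) :
  evz (fun i => vm (vm u (j + i%:Z) v) (k + m - i%:Z) c).
Proof.
have [N HN] := vmode_trunc Q u v; exists (absz (N - j)) => i le.
by rewrite HN ?(lin0 (vml _ _)) //; lia.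
Qed.

(** The Jacobi identity paired with x0^j x1^k x2^m: each delta function
substitutes for one of the variables. *)
Lemma jacobi_modes s u v c j k m : jacobi vm u v s ->
  modesA u v c j k m
  - (-1) ^ j *: bsum j (fun i =>
      \sum_(p <- s) vm p.1 (m + j - i%:Z) (vm p.2 (k + i%:Z) c))
  = modesB u v c j k m.
Proof.
move=> /(_ c (- j - 1, - k - 1, - m - 1)); set d := (_, _, _).
pose phi1 (i : nat) : int * int * int := (- j - 1, j - i%:Z, i%:Z).
pose phi2 (i : nat) : int * int * int := (- j - 1, i%:Z, j - i%:Z).
pose phi3 (i : nat) : int * int * int := (i%:Z, - k - 1, k - i%:Z).
have sbinomE (a : int) (i : nat) :
    sbinom K a (a - i%:Z, i%:Z) = (-1) ^+ i * zbinom K a i.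
  by rewrite /sbinom /= subrK eqxx.
have inj1 : injective phi1 by move=> i i' [].
have inj2 : injective phi2 by move=> i i' [].
have inj3 : injective phi3 by move=> i i' [].
rewrite (@smul_nsum K V _ _ _ _ phi1) //; last 2 first.
- case=> [[e0 e1] e2] ne; rewrite /d /=.
  case: ifP => [/eqP e0E|_]; last by rewrite scaler0.
  rewrite /sbinom /=; case: ifP => [/andP[e2ge /eqP e12]|_]; last by rewrite scale0r.
  by exfalso; apply: (ne (absz e2)); rewrite /phi1; congr (_, _, _); lia.
- have [N HN] := vmode_trunc Q v c; exists (absz (N - m)) => i le /=.
  rewrite subrr eqxx HN ?(lin0 (vmr _ _)) ?scaler0 //; lia.
rewrite (@smul_nsum K V _ _ _ _ phi2) //; last 2 first.
- case=> [[e0 e1] e2] ne; rewrite /d /=.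
  case: ifP => [/eqP e0E|_]; last by rewrite scaler0.
  rewrite /sbinom /=; case: ifP => [/andP[e2ge /eqP e12]|_]; last first.
    by rewrite mulr0 scale0r.
  by exfalso; apply: (ne (absz e1)); rewrite /phi2; congr (_, _, _); lia.
- have : evz (fun i => \sum_(p <- s) vm p.1 (m + j - i%:Z) (vm p.2 (k + i%:Z) c)).
    elim: s => [|p s [N HN]]; first by exists 0%N => i _; rewrite big_nil.
    have [M HM] := modesA_evz p.1 p.2 c m k j.
    by exists (M + N)%N => i le; rewrite big_cons HM ?HN ?addr0 //; lia.
  move=> [N HN]; exists N => i le /=; rewrite subrr eqxx.
  rewrite [X in _ *: X](_ : _ = 0) ?scaler0 // -[RHS](HN i le).
  by apply: eq_bigr => p _; congr (vm _ _ (vm _ _ _)); lia.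
rewrite (@smul_nsum K V _ _ _ _ phi3) //; last 2 first.
- case=> [[e0 e1] e2] ne; rewrite /d /=.
  case: ifP => [/eqP e0E|_]; last by rewrite scaler0.
  rewrite /sbinom /=; case: ifP => [/andP[e2ge /eqP e12]|_]; last by rewrite scale0r.
  by exfalso; apply: (ne (absz e0)); rewrite /phi3; congr (_, _, _); lia.
- have [N HN] := modesB_evz u v c k m j; exists N => i le /=.
  rewrite subrr eqxx [X in _ *: X](_ : _ = 0) ?scaler0 // -[RHS](HN i le).
  by congr (vm (vm _ _ _) _ _); lia.
move=> jac; rewrite /modesB /modesA /bsum -nsumZ; last first.
  apply: evzZ.
  elim: s {jac} => [|p s [N HN]]; first by exists 0%N => i _; rewrite big_nil.
  have [M HM] := modesA_evz p.1 p.2 c m k j.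
  by exists (M + N)%N => i le; rewrite big_cons HM ?HN ?addr0 //; lia.
transitivity (nsum (fun i => delta_012 K (phi1 i) *:
     (let '(a0, a1, a2) := d - phi1 i in
      if a0 == 0 then vm u (- a1 - 1) (vm v (- a2 - 1) c) else 0))
  - nsum (fun i => delta_021 K (phi2 i) *:
     (let '(a0, a1, a2) := d - phi2 i in
      if a0 == 0 then
        \sum_(p <- s) vm p.1 (- a2 - 1) (vm p.2 (- a1 - 1) c) else 0))); last first.
  rewrite jac; apply: eq_nsum => i; rewrite /= subrr eqxx.
  have -> : - (k - i%:Z) - 1 = i%:Z - k - 1 by lia.
  have := sbinomE (i%:Z - k - 1) i.
  have -> : i%:Z - k - 1 - i%:Z = - k - 1 by lia.
  move=> ->; rewrite zbinom_opp //.
  by congr (_ *: vm (vm _ _ _) _ _); lia.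
congr (_ - _); apply: eq_nsum => i; rewrite /= subrr eqxx.
  have -> : - (- j - 1) - 1 = j by lia.
  by rewrite sbinomE; congr (_ *: vm _ _ (vm _ _ _)); lia.
have -> : - (- j - 1) - 1 = j by lia.
have -> : sbinom K j (j - i%:Z, i%:Z) = bcoef K j i by rewrite sbinomE.
rewrite scalerA; congr (_ *: _); apply: eq_bigr => p _.
by congr (vm _ _ (vm _ _ _)); lia.
Qed.

(** For large k every term of the product in the opposite order contains a mode
that annihilates c: the weak associativity of V. *)
Lemma modesA_B u v c : exists K0 : int, forall j k m, K0 <= k ->
  modesA u v c j k m = modesB u v c j k m.
Proof.
have [s jac] := vmode_jacobi Q u v.
have [K0 HK0] : exists K0 : int, forall k, K0 <= k ->
    forall p, p \in s -> vm p.2 k c = 0.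
  elim: s {jac} => [|p s [N HN]]; first by exists 0.
  have [M HM] := vmode_trunc Q p.2 c.
  exists (M + (absz M)%:Z + N + (absz N)%:Z) => k le q.
  by rewrite inE => /orP[/eqP ->|qs]; [apply: HM; lia | apply: HN => //; lia].
exists K0 => j k m le; rewrite -(jacobi_modes c j k m jac).
rewrite bsum_zero ?scaler0 ?subr0 // => i; rewrite big_seq big1 // => p ps.
by rewrite (HK0 (k + i%:Z)) ?(lin0 (vmr _ _)) //; lia.
Qed.

(** The commutator formula, which is the Jacobi identity at x0^0. *)
Lemma modes_comm s u v c k m : jacobi vm u v s ->
  vm u k (vm v m c) - \sum_(p <- s) vm p.1 m (vm p.2 k c)
  = nsum (fun i => zbinom K k i *: vm (vm u i%:Z v) (k + m - i%:Z) c).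
Proof.
move=> jac; have := jacobi_modes c 0 k m jac.
rewrite /modesA !bsum0 expr0z scale1r => jac0.
transitivity (modesB u v c 0 k m); last first.
  by apply: eq_nsum => i; rewrite add0r.
rewrite -jac0; congr (_ - _); last apply: eq_bigr => p _.
  by congr (vm _ _ (vm _ _ _)); lia.
by congr (vm _ _ (vm _ _ _)); lia.
Qed.

Lemma bcoefN1 i : bcoef K (-1) i = 1.
Proof.
elim: i => [|i IH]; first by rewrite bcoef0.
have := bcoefS K_char0 (-1) i; rewrite addNr bcoef_zero // IH => /esym/eqP.
by rewrite subr_eq0 => /eqP.
Qed.

Lemma bcoefN2 i : bcoef K (-2) i = i.+1%:R.
Proof.
elim: i => [|i IH]; first by rewrite bcoef0.
have := bcoefS K_char0 (-2) i; rewrite bcoefN1 // IH => /eqP.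
by rewrite eq_sym subr_eq nat1r => /eqP.
Qed.

(** Weak associativity of u and the vacuum at x0^(-2): from Y(u,x0) 1 only
u_(-2) 1 = D u and u_(-1) 1 = u contribute. *)
Lemma Dop_mode u n w : vm (Dop Q u) n w = - n%:~R *: vm u (n - 1) w.
Proof.
have [K0 HK0] := modesA_B u (vac Q) w.
pose k : int := n + 1 + (absz (n + 1))%:Z + K0 + (absz K0)%:Z.
pose t : nat := absz ((k - 1 - n) : int)%R.
have kE : k = n + 1 + t%:Z by rewrite /t /k; lia.
(* k is large enough for associativity, and t is such that the only nonzero mode
   of the vacuum, of index -1, occurs at i = t with u_(n-1) in front of it. *)
have := HK0 (-2) k (-1 - t%:Z); rewrite {1}/k => /(_ ltac:(lia)).
rewrite /modesA /bsum (@nsumE _ _ t.+1); last first.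
  move=> i le; rewrite vac_mode ifF ?(lin0 (vmr _ _)) ?scaler0 //.
  by apply/eqP; lia.
rewrite big_ord_recr /= big1 ?add0r; last first.
  move=> i _; rewrite vac_mode ifF ?(lin0 (vmr _ _)) ?scaler0 //.
  by apply/eqP; have := ltn_ord i; lia.
rewrite vac_mode ifT; last by apply/eqP; lia.
rewrite /modesB (@nsumE _ _ 2); last first.
  by move=> i le; rewrite vmode_vac0 ?(lin0 (vml _ _)) ?scaler0 //; lia.
rewrite !big_ord_recl big_ord0 /= zbinom0 scale1r addr0 bcoefN2.
have -> : -2 + (bump 0 0)%:Z = -1 by [].
rewrite vmode_vac => /eqP; rewrite -subr_eq => /eqP.
have -> : zbinom K k (bump 0 0) = k%:~R.
  by rewrite /zbinom big_ord1 /= subr0 factS fact0 divr1.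
have -> : k + (-1 - t%:Z) - 0%:Z = n by rewrite kE; lia.
have -> : k + -2 - t%:Z = n - 1 by rewrite kE; lia.
have -> : k + (-1 - t%:Z) - (bump 0 0)%:Z = n - 1 by rewrite kE /bump /=; lia.
rewrite addr0 -scalerBl /Dop => <-; congr (_ *: _); rewrite kE !intrD -natr1.
by rewrite -[t%:~R]/(t%:R : K) -[1%:~R]/(1 : K); ring.
Qed.

End VertexModes.

(** * Tested products in V *)

Section TestedProducts.
Variable K : fieldType.
Hypothesis K_char0 : forall n, n.+1%:R != 0 :> K.
Variables (V : lmodType K) (Q : weakQVA V).
Implicit Types (u v w c y : V) (l m n : int).
Local Notation vm := (vmode Q).

Let vml n w := vmode_linearl Q n w.
Let vmr v n := vmode_linearr Q v n.

(** Res_y e^((l+1)y) (e^y - 1)^n Y(u,y) v: the function t^l (t - 1)^n, t = e^y,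
is the test function of [mtest] below. *)
Definition vtest l n u v : V := pact (test_ps K l n) (fun k => vm u k v) n.

Lemma vtest_rec l n u v : vtest (l + 1) n u v = vtest l n u v + vtest l (n + 1) u v.
Proof.
have uv := vm_evzi Q u v.
by rewrite /vtest test_ps_rec // pactDl // pactX.
Qed.

Lemma vtest_vanish N l n u v : (forall k, N <= k -> vm u k v = 0) -> N <= n ->
  vtest l n u v = 0.
Proof. by move=> uv0 le; apply: (pact_vanish _ uv0). Qed.

Lemma vtest_linearr l n u : linear (vtest l n u).
Proof.
move=> a v v'; rewrite /vtest.
rewrite (_ : (fun k => vm u k (a *: v + v'))
    = (fun k => a *: vm u k v + vm u k v')); last first.
  by apply/funext => k; exact: vmr.
rewrite pactDr ?pactZr //; try exact: vm_evzi.
have [N HN] := vm_evzi Q u v; exists N => k /HN ->; exact: scaler0.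
Qed.

(** Integration by parts, as Y(D u, y) is the derivative of Y(u,y). *)
Lemma vtest_Dop r u v : vtest 0 (Negz r) (Dop Q u) v
  = r.+1%:R *: vtest 0 (Negz r.+1) u v + r%:R *: vtest 0 (Negz r) u v.
Proof.
pose F k := vm u k v; have F0 : evzi F := vm_evzi Q u v.
have pactN f n : pact (- f) F n = - pact f F n.
  apply/eqP; rewrite -addr_eq0 -pactDl // addNr.
  by apply/eqP/nsum0 => i; rewrite psE scale0r.
have pactMn f k n : pact (f *+ k) F n = k%:R *: pact f F n.
  elim: k => [|k IH]; last by rewrite mulrS pactDl // IH -nat1r scalerDl scale1r.
  by rewrite scale0r; apply: nsum0 => i; rewrite psMn mulr0n scale0r.
have -> : vtest 0 (Negz r) (Dop Q u) v =
    pact (test_ps K 0 (Negz r) *+ r.+1 - ps_theta (test_ps K 0 (Negz r))) F (Negz r.+1).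
  apply: eq_nsum => i; rewrite Dop_mode // scalerA /F.
  have -> : Negz r.+1 + i%:Z = Negz r + i%:Z - 1 by lia.
  congr (_ *: _); rewrite !psE psMn /ps_theta.
  have -> : Negz r + i%:Z = i%:Z - (r.+1)%:Z by lia.
  rewrite intrD mulrNz -[i%:~R]/(i%:R : K) -[r.+1%:~R]/(r.+1%:R : K).
  by rewrite -[_ *+ r.+1]mulr_natr; ring.
rewrite -opprB test_ps0_theta // opprD !opprK pactDl // !pactMn pactX //.
by congr (_ + _ *: pact _ _ _); lia.
Qed.

Lemma star_vtest u v : star Q u v = vtest 0 (-1) u v.
Proof.
rewrite /star /sres stodd1E smul_laurent.
  by apply: eq_nsum => i; rewrite /Yser; congr (_ *: vm _ _ _); lia.
have [N HN] := vm_evzi Q u v; exists (absz (N + 1)) => i le.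
by rewrite /Yser HN ?scaler0 //; lia.
Qed.

Lemma stodd2_vtest u v :
  sres (smul (@stodd2 K) (Yser Q u v)) = vtest 0 (-2) u v.
Proof.
rewrite /sres stodd2E smul_laurent.
  by apply: eq_nsum => i; rewrite /Yser; congr (_ *: vm _ _ _); lia.
have [N HN] := vm_evzi Q u v; exists (absz (N + 2)) => i le.
by rewrite /Yser HN ?scaler0 //; lia.
Qed.

(** Poles of higher order at t = 1 are reduced by [vtest_Dop] to the double pole
that defines the span of Otilde. *)
Lemma vtest_Otilde r u v : vtest 0 (Negz r.+1) u v \in lspan (Otilde Q).
Proof.
elim: r u => [|r IH] u; first by apply: lspan_gen; exists u, v; rewrite stodd2_vtest.
have := vtest_Dop r.+1 u v => /eqP; rewrite -subr_eq => /eqP h.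
have : r.+2%:R *: vtest 0 (Negz r.+2) u v \in lspan (Otilde Q).
  by rewrite -h rpredB ?rpredZ.
move/(rpredZ (r.+2%:R)^-1); rewrite scalerA mulVf ?scale1r //.
Qed.

(** \sum_j m^j/j! c_j y, the vector on the right side of the relation between c[m]
and a mode of y. *)
Definition cact m c y : V := vtest (m - 1) 0 c y.

Lemma cact_linear m c : linear (cact m c).
Proof. exact: vtest_linearr. Qed.

Lemma cactE m c y : cact m c y = pact (ps_exp m%:~R) (fun k => vm c k y) 0.
Proof. by rewrite /cact /vtest test_ps0 intrB subrK. Qed.

(** The commutator formula for c_j and u_k, summed against m^j/j!.  The binomial
sum on its right side splits e^(m x1) into e^(m x0) e^(m x2). *)
Lemma cact_mode s c u v k m : jacobi vm c u s ->
  cact m c (vm u k v) = \sum_(p <- s) vm p.1 k (cact m p.2 v)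
    + pact (ps_exp m%:~R) (fun j => vm (cact m c u) j v) k.
Proof.
move=> jac; rewrite !cactE.
pose e := ps_exp (m%:~R : K).
have ev1 p : evz (fun j => e j *: vm p.1 k (vm p.2 (0 + j%:Z) v)).
  apply: evzZ; have [N HN] := vm_evzi Q p.2 v.
  by exists (absz N) => j le; rewrite HN ?(lin0 (vmr _ _)) //; lia.
have [N [HN1 HN2]] : exists N, (forall j : nat, (N <= j)%N -> vm c j u = 0)
    /\ forall i s : nat, (N <= s)%N -> vm (vm c i u) (k + s%:Z) v = 0.
  have [M HM] := vm_evzi Q c u.
  have [M' HM'] := unif_bound (fun i : nat => vm_evzi Q (vm c i u) v) (absz M).
  exists (absz M + absz (M' - k))%N; split=> [j le|i t le]; first by rewrite HM //; lia.
  have [iM|Mi] := ltnP i (absz M); first by rewrite (HM' i) //; lia.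
  by rewrite HM ?(lin0 (vml _ _)) //; lia.
pose F i t := (e i * e t) *: vm (vm c i%:Z u) (k + t%:Z) v.
have F0 i t : (N <= i)%N || (N <= t)%N -> F i t = 0.
  rewrite /F => /orP[le|le]; first by rewrite HN1 // (lin0 (vml _ _)) scaler0.
  by rewrite HN2 // scaler0.
transitivity (nsum (fun j => \sum_(p <- s) e j *: vm p.1 k (vm p.2 (0 + j%:Z) v)
    + \sum_(i < j.+1) F i (j - i)%N)).
  apply: eq_nsum => j; rewrite add0r; have := modes_comm v j k jac.
  move=> /eqP; rewrite subr_eq addrC => /eqP ->; rewrite scalerDr scaler_sumr.
  congr (_ + _); rewrite (@nsumE _ _ j.+1); last first.
    by move=> i le; rewrite zbinom_small // scale0r.
  rewrite scaler_sumr; apply: eq_bigr => i _; rewrite scalerA.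
  have le : (i <= j)%N by rewrite -ltnS.
  congr (_ *: vm _ _ _); last by lia.
  rewrite zbinom_bin // /e /ps_exp -{1}(subnKC le) exprD.
  have -> : ('C(j, i)%:R : K) = j`!%:R / (i`!%:R * (j - i)`!%:R).
    by rewrite -natrM -(bin_fact le) natrM mulfK // natrM mulf_neq0 ?fact_neq0.
  have h1 := fact_neq0 K_char0 i; have h2 := fact_neq0 K_char0 (j - i).
  have h3 := fact_neq0 K_char0 j; field.
  by rewrite h1 h2 h3.
rewrite nsumD; last 2 first.
- elim: (s) => [|p s' [M IH]]; first by exists 0%N => i _; rewrite big_nil.
  have [M' HM'] := ev1 p; exists (M + M')%N => i le.
  by rewrite big_cons HM' ?IH ?addr0 //; lia.
- exists (N + N)%N => j le; rewrite big1 // => i _; apply: F0.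
  by have := ltn_ord i; lia.
rewrite nsum_sum //; congr (_ + _).
  apply: eq_bigr => p _; rewrite cactE (lin_pact (vmr _ _)); last exact: vm_evzi.
  by apply: eq_nsum.
rewrite (nsum_cauchy F0) (nsum_exch F0) /pact; apply: eq_nsum => t.
rewrite (lin_nsum (vml _ _)); last first.
  exact: (@evzi_nat _ _ _ (fun k => vm c k u) 0 (vm_evzi Q c u)).
rewrite -nsumZ; last first.
  exists N => i le; rewrite add0r HN1 ?scaler0 ?(lin0 (vml _ _)) //.
apply: eq_nsum => i; rewrite /F add0r (linZ (vml _ _)) scalerA mulrC.
by [].
Qed.

(** The factor e^(m x2) of [cact_mode] turns the test function t^l (t - 1)^n into
t^(l+m) (t - 1)^n. *)
Lemma cact_vtest s c u v l n m : jacobi vm c u s ->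
  cact m c (vtest l n u v) = \sum_(p <- s) vtest l n p.1 (cact m p.2 v)
    + vtest (l + m) n (cact m c u) v.
Proof.
move=> jac; rewrite {1}/vtest (lin_pact (cact_linear m c)); last exact: vm_evzi.
rewrite (eq_pact _ (fun k _ => cact_mode v k m jac)).
have ev : evzi (fun k => pact (ps_exp m%:~R) (fun j => vm (cact m c u) j v) k).
  by apply: pact_evzi; exact: vm_evzi.
rewrite pactDr //; last first.
  elim: (s) => [|p s' [M IH]]; first by exists 0 => i _; rewrite big_nil.
  have [M' HM'] := vm_evzi Q p.1 (cact m p.2 v).
  exists (M + (absz M)%:Z + M' + (absz M')%:Z) => i le.
  by rewrite big_cons HM' ?IH ?addr0 //; lia.
rewrite pact_sum; last by move=> p; exact: vm_evzi.
congr (_ + _); rewrite -pactM; last exact: vm_evzi.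
by rewrite mulrC test_ps_expM.
Qed.

End TestedProducts.

(** * Tested triple products in V *)

Section TripleSeries.
Variable K : fieldType.
Hypothesis K_char0 : forall n, n.+1%:R != 0 :> K.
Variable W : lmodType K.
Implicit Types (f g h : pseries K).

Lemma pact_exch f g (H : int -> int -> W) a b :
  (exists N, forall i j : nat, (N <= i)%N || (N <= j)%N ->
     H (a + i%:Z) (b + j%:Z) = 0) ->
  pact f (fun i => pact g (H i) b) a = pact g (fun j => pact f (H^~ j) a) b.
Proof.
move=> [N HN]; rewrite /pact.
transitivity (nsum (fun i => nsum (fun j =>
    (f i * g j) *: H (a + i%:Z) (b + j%:Z)))).
  apply: eq_nsum => i; rewrite -nsumZ; first by apply: eq_nsum => j; rewrite scalerA.
  by exists N => j le; rewrite HN ?scaler0 // le orbT.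
rewrite (@nsum_exch _ _ N); last by move=> i j le; rewrite HN ?scaler0.
apply: eq_nsum => j; rewrite -nsumZ.
  by apply: eq_nsum => i; rewrite scalerA mulrC.
by exists N => i le; rewrite HN ?scaler0 // le.
Qed.

Variable T : int -> int -> int -> W.
(* T j k m stands for the pairing with y0^j y1^k y2^m of a series on which y1 acts
   as y0 + y2. *)
Hypothesis T_pascal : forall j k m, T j (k + 1) m = T (j + 1) k m + T j k (m + 1).
Hypothesis T_box : forall a b c, exists N, forall i j k : nat,
  [|| N <= i, N <= j | N <= k]%N -> T (a + i%:Z) (b + j%:Z) (c + k%:Z) = 0.

Let T_zero a b c : exists N : nat, forall i j k : int, a <= i -> b <= j -> c <= k ->
  [|| a + N%:Z <= i, b + N%:Z <= j | c + N%:Z <= k] -> T i j k = 0.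
Proof.
have [N HN] := T_box a b c; exists N => i j k ai bj ck le.
have -> : i = a + (absz (i - a))%:Z by lia.
have -> : j = b + (absz (j - b))%:Z by lia.
have -> : k = c + (absz (k - c))%:Z by lia.
by apply: HN; lia.
Qed.

Let ev3 a b : evzi (T a b).
Proof.
have [N HN] := T_zero a b 0; exists (0 + N%:Z) => k le; apply: HN; lia.
Qed.

Lemma T_pascalX j k r m : T j (k + r%:Z) m
  = \sum_(i < r.+1) 'C(r, i)%:R *: T (j + i%:Z) k (m + r%:Z - i%:Z).
Proof.
elim: r j k m => [|r IH] j k m.
  by rewrite big_ord1 bin0 scale1r !addr0.
have -> : k + r.+1%:Z = (k + r%:Z) + 1 by lia.
rewrite T_pascal !IH [RHS]big_ord_recl bin0 scale1r.
under [X in _ = _ + X]eq_bigr => i _ do rewrite lift0 binS natrD scalerDl.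
rewrite big_split [RHS]addrA [LHS]addrC; congr (_ + _); last first.
  by apply: eq_bigr => i _; congr (_ *: T _ _ _); lia.
rewrite big_ord_recl bin0 scale1r; congr (_ + _); first by congr T => /=; lia.
rewrite [RHS]big_ord_recr /= bin_small // scale0r addr0.
by apply: eq_bigr => i _; rewrite /bump leq0n add1n; congr (_ *: T _ _ _); lia.
Qed.

(** e^(z y1) = e^(z y0) e^(z y2) *)
Lemma T_exp z j k m :
  pact (ps_exp z) (fun k' => T j k' m) k
  = pact (ps_exp z) (fun j' => pact (ps_exp z) (T j' k) m) j.
Proof.
pose e := ps_exp z; have [N HN] := T_box j k m.
pose F i s := (e i * e s) *: T (j + i%:Z) k (m + s%:Z).
have F0 i s : (N <= i)%N || (N <= s)%N -> F i s = 0.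
  move=> le; rewrite /F -[k]addr0 HN ?scaler0 //.
  by case/orP: le => ->; rewrite ?orbT.
transitivity (nsum (fun i => nsum (F i))); last first.
  apply: eq_nsum => i; rewrite -nsumZ; first by apply: eq_nsum => s; rewrite scalerA.
  by apply: evzi_nat; exact: ev3.
rewrite -(nsum_cauchy F0); apply: eq_nsum => r.
rewrite T_pascalX scaler_sumr; apply: eq_bigr => i _; rewrite scalerA.
have le : (i <= r)%N by rewrite -ltnS.
congr (_ *: T _ _ _); last by lia.
rewrite /e /ps_exp -{1}(subnKC le) exprD.
have -> : ('C(r, i)%:R : K) = r`!%:R / (i`!%:R * (r - i)`!%:R).
  by rewrite -natrM -(bin_fact le) natrM mulfK // natrM mulf_neq0 ?fact_neq0.
have h1 := fact_neq0 K_char0 i; have h2 := fact_neq0 K_char0 (r - i).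
have h3 := fact_neq0 K_char0 r; field.
by rewrite h1 h2 h3.
Qed.

(** T paired with y0^a f(y0) y1^b g(y1) y2^c h(y2). *)
Definition pair3 a f b g c h : W :=
  pact f (fun j => pact g (fun k => pact h (T j k) c) b) a.

Let ev2 h c j : evzi (fun k => pact h (T j k) c).
Proof.
have [N HN] := T_zero j 0 c; exists (0 + N%:Z) => k le.
by apply: (pact_vanish (N := c)) => // m cm; apply: HN; lia.
Qed.

Let ev1 g h b c : evzi (fun j => pact g (fun k => pact h (T j k) c) b).
Proof.
have [N HN] := T_zero 0 b c; exists (0 + N%:Z) => j le.
apply: (pact_vanish (N := b)) => // k bk.
by apply: (pact_vanish (N := c)) => // m cm; apply: HN; lia.
Qed.

Lemma pair3D1 a f f' b g c h :
  pair3 a (f + f') b g c h = pair3 a f b g c h + pair3 a f' b g c h.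
Proof. by rewrite /pair3 pactDl //; exact: ev1. Qed.

Lemma pair3X1 a f b g c h : pair3 a (ps_X K * f) b g c h = pair3 (a + 1) f b g c h.
Proof. by rewrite /pair3 pactX //; exact: ev1. Qed.

Lemma pair3_rec2 a f b l c h : 
  pair3 a f b (test_ps K (l + 1) b) c h
  = pair3 a f b (test_ps K l b) c h + pair3 a f (b + 1) (test_ps K l (b + 1)) c h.
Proof.
rewrite /pair3 -pactDr; try exact: ev1.
apply: eq_pact => j _; rewrite test_ps_rec // pactDl ?pactX //; exact: ev2.
Qed.

Lemma pair3_rec3 a f b g c l :
  pair3 a f b g c (test_ps K (l + 1) c)
  = pair3 a f b g c (test_ps K l c) + pair3 a f b g (c + 1) (test_ps K l (c + 1)).
Proof.
rewrite /pair3 -pactDr; try exact: ev1.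
apply: eq_pact => j _; rewrite -pactDr; try exact: ev2.
apply: eq_pact => k _; rewrite test_ps_rec // pactDl ?pactX //; exact: ev3.
Qed.

Lemma pair3_exp z a f b g c h :
  pair3 a f b (ps_exp z * g) c h = pair3 a (ps_exp z * f) b g c (ps_exp z * h).
Proof.
pose e := ps_exp z; rewrite /pair3 [e * f]mulrC pactM; last exact: ev1.
apply: eq_pact => j ja; rewrite [e * g]mulrC pactM; last exact: ev2.
have [N HN] := T_zero j b c.
transitivity (pact g (fun k => pact e (fun j' => pact (e * h) (T j' k) c) j) b).
  apply: eq_pact => k bk; rewrite -(@pact_exch h e (fun m k' => T j k' m)).
  rewrite (eq_pact _ (fun m _ => T_exp z j k m)).
  rewrite (@pact_exch h e (fun m j' => pact e (T j' k) m)); last first.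
    have [N' HN'] := T_zero j k c; exists N' => i i' le.
    apply: (pact_vanish (N := c + i%:Z)) => //m cm; apply: HN'; lia.
  apply: eq_pact => j' jj'; rewrite mulrC pactM //; exact: ev3.
  by exists N => i i' le; apply: HN; lia.
rewrite (@pact_exch g e (fun k j' => pact (e * h) (T j' k) c)) //.
exists N => i i' le.
by apply: (pact_vanish (N := c)) => // m cm; apply: HN; lia.
Qed.

(** T paired with (e^y1 - e^y2)^n e^((l1+1)y1) (e^y1 - 1)^n1 e^((l2+1)y2)
(e^y2 - 1)^n2, where e^y1 - e^y2 = e^y2 (e^y0 - 1); this accounts for the
exponent l2 + n. *)
Definition vtest3 n l1 n1 l2 n2 : W :=
  pair3 n (ps_eps_pow K n) n1 (test_ps K l1 n1) n2 (test_ps K (l2 + n) n2).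

Lemma vtest3_rec1 n l1 n1 l2 n2 :
  vtest3 n (l1 + 1) n1 l2 n2 = vtest3 n l1 n1 l2 n2 + vtest3 n l1 (n1 + 1) l2 n2.
Proof. exact: pair3_rec2. Qed.

Lemma vtest3_rec2 n l1 n1 l2 n2 :
  vtest3 n l1 n1 (l2 + 1) n2 = vtest3 n l1 n1 l2 n2 + vtest3 n l1 n1 l2 (n2 + 1).
Proof. by rewrite /vtest3 addrAC; exact: pair3_rec3. Qed.

(** e^y1 = e^y2 + (e^y1 - e^y2) *)
Lemma vtest3_rec0 n l1 n1 l2 n2 :
  vtest3 n (l1 + 1) n1 l2 n2 = vtest3 n l1 n1 (l2 + 1) n2 + vtest3 (n + 1) l1 n1 l2 n2.
Proof.
rewrite /vtest3 -(test_ps_expM K_char0 1 l1 n1) pair3_exp (test_ps_expM K_char0 1).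
rewrite ps_exp1 mulrDl mul1r -mulrA -ps_eps_powS // pair3D1 pair3X1.
have -> : l2 + n + 1 = l2 + (n + 1) by lia.
by have -> : l2 + 1 + n = l2 + (n + 1) by lia.
Qed.

(** Without a factor e^y1 - 1, the variable y1 occurs in an exponential only and
can be eliminated. *)
Lemma vtest3_eval n l l2 n2 :
  vtest3 n l 0 l2 n2
  = pact (test_ps K l n) (fun j => pact (test_ps K (l + l2 + n + 1) n2) (T j 0) n2) n.
Proof.
rewrite /vtest3 test_ps0 -[ps_exp _]mulr1 pair3_exp /pair3 -/(test_ps K l n).
apply: eq_pact => j _; rewrite pact1.
have -> : (l%:~R + 1 : K) = (l + 1)%:~R by rewrite intrD.
have -> : l + l2 + n + 1 = l2 + n + (l + 1) by lia.
by rewrite (test_ps_expM K_char0 (l + 1)).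
Qed.

Lemma vtest3_zero J n l1 n1 l2 n2 : (forall j k m, J <= m -> T j k m = 0) ->
  J <= n2 -> vtest3 n l1 n1 l2 n2 = 0.
Proof.
move=> T0 le; apply: (pact_vanish (N := n)) => // j _.
apply: (pact_vanish (N := n1)) => // k _.
by apply: (pact_vanish (N := J)) => // m; exact: T0.
Qed.

End TripleSeries.

Section VertexTriples.
Variable K : fieldType.
Hypothesis K_char0 : forall n, n.+1%:R != 0 :> K.
Variables (V : lmodType K) (Q : weakQVA V) (u v c : V).
Local Notation vm := (vmode Q).

Let vml n w := vmode_linearl Q n w.
Let vmr v n := vmode_linearr Q v n.

Lemma modesA_pascal j k m :
  modesA Q u v c j (k + 1) m = modesA Q u v c (j + 1) k m + modesA Q u v c j k (m + 1).
Proof.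
rewrite /modesA bsumS //; last exact: modesA_evz.
rewrite [X in _ = X + _](_ : _ = 
  bsum j (fun i => vm u (k + 1 + j - i%:Z) (vm v (m + i%:Z) c))
  - bsum j (fun i => vm u (k + j - i%:Z) (vm v (m + 1 + i%:Z) c))).
  by rewrite subrK.
by congr (_ - _); apply: eq_bsum => i; congr (vm _ _ (vm _ _ _)); lia.
Qed.

Lemma modesB_pascal j k m :
  modesB Q u v c j (k + 1) m = modesB Q u v c (j + 1) k m + modesB Q u v c j k (m + 1).
Proof.
rewrite /modesB nsumS; last by apply: evzZ; exact: modesB_evz.
rewrite [X in _ = _ + X]nsumS; last by apply: evzZ; exact: modesB_evz.
rewrite !zbinom0 addrCA; congr (_ + _).
  by congr (_ *: vm (vm _ _ _) _ _); lia.
rewrite -nsumD; last 2 first.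
- by apply: evzZ; exact: modesB_evz.
- have := evzS (modesB_evz Q u v c k (m + 1) j).
  by apply: (@evzZ _ _ (fun i => zbinom K k i.+1)).
apply: eq_nsum => i; rewrite zbinomS // scalerDl addrC.
by congr (_ *: vm (vm _ _ _) _ _ + _ *: vm (vm _ _ _) _ _); lia.
Qed.

Lemma modesA_zero J : (forall k, J <= k -> vm v k c = 0) ->
  forall j k m, J <= m -> modesA Q u v c j k m = 0.
Proof.
move=> v0 j k m le; apply: bsum_zero => i.
by rewrite v0 ?(lin0 (vmr _ _)) //; lia.
Qed.

Lemma modesA_box a b d : exists N, forall i j k : nat,
  [|| N <= i, N <= j | N <= k]%N -> modesA Q u v c (a + i%:Z) (b + j%:Z) (d + k%:Z) = 0.
Proof.
have [M HM] := vm_evzi Q v c.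
have [L HL] := unif_bound (fun t : nat => vm_evzi Q u (vm v (d + t%:Z) c)) (absz (M - d)).
exists (absz (M - d) + absz L + absz a + absz b)%N => i j k le.
apply: bsum_zero => t.
have [|lt] := leP M (d + k%:Z + t%:Z); first by move=> /HM ->; exact: lin0.
have -> : d + k%:Z + t%:Z = d + (k + t)%N%:Z by lia.
by rewrite (HL (k + t)%N) //; lia.
Qed.

Lemma modesB_box a b d : exists N, forall i j k : nat,
  [|| N <= i, N <= j | N <= k]%N -> modesB Q u v c (a + i%:Z) (b + j%:Z) (d + k%:Z) = 0.
Proof.
have [M HM] := vm_evzi Q u v.
have [L HL] := unif_bound (fun t : nat => vm_evzi Q (vm u (a + t%:Z) v) c) (absz (M - a)).
exists (absz (M - a) + absz L + absz d + absz b)%N => i j k le.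
apply: nsum0 => t.
have [|lt] := leP M (a + i%:Z + t%:Z).
  by move=> /HM ->; rewrite (lin0 (vml _ _)) scaler0.
have -> : a + i%:Z + t%:Z = a + (i + t)%N%:Z by lia.
by rewrite (HL (i + t)%N) ?scaler0 //; lia.
Qed.

Lemma modesB0 j m : modesB Q u v c j 0 m = vm (vm u j v) m c.
Proof.
rewrite /modesB (@nsumE _ _ 1) ?big_ord1 ?zbinom0 ?scale1r; last first.
  by case=> [|i] // _; rewrite zbinom_small // scale0r.
by congr (vm (vm _ _ _) _ _) => /=; lia.
Qed.

Lemma modesA0 k m : modesA Q u v c 0 k m = vm u k (vm v m c).
Proof. by rewrite /modesA bsum0; congr (vm _ _ (vm _ _ _)); lia. Qed.

(** For Y(Y(u,x0) v, x2) c the residue in y0 is taken inside, then the one in y2. *)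
Lemma vtest3_modesB n l l2 n2 : vtest3 (modesB Q u v c) n l 0 l2 n2
  = vtest Q (l + l2 + n + 1) n2 (vtest Q l n u v) c.
Proof.
rewrite vtest3_eval //; [|exact: modesB_pascal|exact: modesB_box].
transitivity (pact (test_ps K l n) (fun j =>
    pact (test_ps K (l + l2 + n + 1) n2) (fun m => vm (vm u j v) m c) n2) n).
  by apply: eq_pact => j _; apply: eq_pact => m _; rewrite modesB0.
have [M HM] := vm_evzi Q u v.
have [L HL] := unif_bound (fun t : nat => vm_evzi Q (vm u (n + t%:Z) v) c) (absz (M - n)).
rewrite pact_exch; last first.
  exists (absz (M - n) + absz L + absz n2)%N => i j le.
  have [|lt] := leP M (n + i%:Z); first by move=> /HM ->; exact: (lin0 (vml _ _)).
  by rewrite (HL i) //; lia.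
apply: eq_pact => m _; rewrite -(lin_pact (vml _ _)) //; exact: vm_evzi.
Qed.

(** Without a power of x1 - x2, the series Y(u,x1) Y(v,x2) c is tested in each
variable separately. *)
Lemma vtest3_modesA0 l1 n1 l2 n2 : vtest3 (modesA Q u v c) 0 l1 n1 l2 n2
  = vtest Q l1 n1 u (vtest Q l2 n2 v c).
Proof.
rewrite /vtest3 /pair3 pact1 addr0.
apply: eq_pact => k _.
transitivity (pact (test_ps K l2 n2) (fun m => vm u k (vm v m c)) n2).
  by apply: eq_pact => m _; rewrite modesA0.
by rewrite -(lin_pact (vmr _ _)) //; exact: vm_evzi.
Qed.

End VertexTriples.

(** * Defects of associativity *)

Section GradedModes.
Variable K : fieldType.
Hypothesis K_char0 : forall n, n.+1%:R != 0 :> K.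
Variables (V : lmodType K) (Q : weakQVA V).
Variable S : {linear tens V V -> tens V V}.
Hypothesis S_jacobi : constant_Smap Q S.
Variables (W : lmodType K) (YW : V -> int -> W -> W) (hom : int -> set W).

(** The relations between the generators of the universal algebra, imposed on
operators; the sum over j is one mode of a vector [cact]. *)
Definition mode_comm := forall u v m n w (s : seq (V * V)),
  S (tmk v u) = \sum_(p <- s) tmk p.1 p.2 ->
  YW u m (YW v n w)
  = \sum_(p <- s) YW p.1 n (YW p.2 m w) + YW (cact Q m u v) (m + n) w.

Hypothesis YWl : forall n w, linear (fun v => YW v n w).
Hypothesis YWr : forall v n, linear (YW v n).
Hypothesis YWcomm : mode_comm.
Hypothesis hom_mode : forall d v m w, hom d w -> hom (d - m) (YW v m w).
Hypothesis hom_neg : forall d w, hom d w -> d < 0 -> w = 0.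

Implicit Types (u v c : V) (w x : W) (l m n q d : int).

Lemma Smap_seq u v : exists s : seq (V * V),
  S (tmk v u) = \sum_(p <- s) tmk p.1 p.2.
Proof.
elim/tens_ind: (S _) => [|x y [s ->] [t ->]|a b].
- by exists [::]; rewrite big_nil.
- by exists (s ++ t); rewrite big_cat.
- by exists [:: (a, b)]; rewrite big_seq1.
Qed.

Definition killed_above d w := forall v m, d < m -> YW v m w = 0.

Lemma hom_killed d w : hom d w -> killed_above d w.
Proof. by move=> hw v m lt; apply: (hom_neg (hom_mode v m hw)); lia. Qed.

(** t^l (t - 1)^n, expanded at infinity, paired with the products of weight q, that
is, with \sum_a u[a] v[q-a] w t^(-a); the pairing is the residue of a form in
dt, which accounts for the shifts by 1. *)
Definition mtest l n q u v w : W :=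
  bsum n (fun i => YW u (l + n + 1 - i%:Z) (YW v (q - l - n - 1 + i%:Z) w)).

Lemma mtest_evz d w u v (a b : int) : killed_above d w ->
  evz (fun i => YW u (a - i%:Z) (YW v (b + i%:Z) w)).
Proof.
move=> kw; exists (absz (d + 1 - b)%R) => i le.
by rewrite kw ?(lin0 (YWr _ _)) //; lia.
Qed.

Lemma mtest_rec d w l n q u v : killed_above d w ->
  mtest (l + 1) n q u v w = mtest l n q u v w + mtest l (n + 1) q u v w.
Proof.
move=> kw; rewrite [X in _ = _ + X]/mtest bsumS //; last exact: (mtest_evz _ _ _ _ kw).
rewrite [X in _ = _ + (X - _)](_ : _ = mtest (l + 1) n q u v w); last first.
  by apply: eq_bsum => i; congr (YW _ _ (YW _ _ _)); lia.
rewrite [X in _ = _ + (_ - X)](_ : _ = mtest l n q u v w); last first.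
  by apply: eq_bsum => i; congr (YW _ _ (YW _ _ _)); lia.
by rewrite [RHS]addrC subrK.
Qed.

Lemma mtest_low d w l n q u v : killed_above d w -> d < q - l - n - 1 ->
  mtest l n q u v w = 0.
Proof.
by move=> kw lt; apply: bsum_zero => i; rewrite kw ?(lin0 (YWr _ _)) //; lia.
Qed.

Lemma mtest0 l q u v w : mtest l 0 q u v w = YW u (l + 1) (YW v (q - l - 1) w).
Proof. by rewrite /mtest bsum0; congr (YW _ _ (YW _ _ _)); lia. Qed.

Lemma mtestDv d w l n q u v v' : killed_above d w ->
  mtest l n q u (v + v') w = mtest l n q u v w + mtest l n q u v' w.
Proof.
move=> kw; rewrite -bsumD; try exact: (mtest_evz _ _ _ _ kw).
by apply: eq_bsum => i; rewrite (linD (YWl _ _)) (linD (YWr _ _)).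
Qed.

Lemma mtest0v w l n q u : mtest l n q u 0 w = 0.
Proof. by apply: bsum_zero => i; rewrite (lin0 (YWl _ _)) (lin0 (YWr _ _)). Qed.

Lemma mtestDw d d' w w' l n q u v : killed_above d w -> killed_above d' w' ->
  mtest l n q u v (w + w') = mtest l n q u v w + mtest l n q u v w'.
Proof.
move=> kw kw'; rewrite -bsumD; [|exact: (mtest_evz _ _ _ _ kw)|exact: (mtest_evz _ _ _ _ kw')].
by apply: eq_bsum => i; rewrite !(linD (YWr _ _)).
Qed.

(** The failure of associativity at w against the test function t^l (t - 1)^n. *)
Definition defect l n q u v w : W := YW (vtest Q l n u v) q w - mtest l n q u v w.

Lemma defect_rec d w l n q u v : killed_above d w ->
  defect (l + 1) n q u v w = defect l n q u v w + defect l (n + 1) q u v w.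
Proof.
move=> kw; rewrite /defect (mtest_rec _ _ _ _ _ kw) vtest_rec // (linD (YWl _ _)).
by rewrite opprD addrACA.
Qed.

Lemma defect0w l n q u v : defect l n q u v 0 = 0.
Proof.
rewrite /defect (lin0 (YWr _ _)) sub0r (_ : mtest _ _ _ _ _ _ = 0) ?oppr0 //.
by apply: bsum_zero => i; rewrite !(lin0 (YWr _ _)).
Qed.

Lemma defectDw d d' w w' l n q u v : killed_above d w -> killed_above d' w' ->
  defect l n q u v (w + w') = defect l n q u v w + defect l n q u v w'.
Proof.
move=> kw kw'; rewrite /defect (mtestDw _ _ _ _ _ kw kw') (linD (YWr _ _)).
by rewrite opprD addrACA.
Qed.

(** For n = 0 and l >= d this is the commutation relation, in which the products
in the opposite order annihilate w.  Larger n follow from the Pascal recursion. *)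
Lemma defect_nonneg d w l (n : nat) q u v : killed_above d w -> d <= l ->
  defect l n q u v w = 0.
Proof.
move=> kw; elim: n l => [|n IH] l dl; last first.
  have := defect_rec l n q u v kw; rewrite !IH; try lia.
  by rewrite add0r -PoszD addn1.
have [s Ss] := Smap_seq u v.
rewrite /defect mtest0 (YWcomm _ _ _ Ss) big1 ?add0r; last first.
  by move=> p _; rewrite kw ?(lin0 (YWr _ _)) //; lia.
rewrite /cact addrK; apply/eqP; rewrite subr_eq0; apply/eqP.
by congr (YW _ _ _); lia.
Qed.

Lemma mode_at_top c v m q w : killed_above 0 w -> 0 < m ->
  YW c m (YW v q w) = YW (cact Q m c v) (m + q) w.
Proof.
move=> kw m0; have [s Ss] := Smap_seq c v.
rewrite (YWcomm _ _ _ Ss) big1 ?add0r // => p _.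
by rewrite kw // (lin0 (YWr _ _)).
Qed.

(** A positive mode c[m] annihilates w, so moving it to the right through the
products only modifies u and v; by [cact_vtest] the tested vector of V is
modified in the same way. *)
Lemma mode_defect c m l n q u v w (s : seq (V * V)) : killed_above 0 w -> 0 < m ->
  S (tmk u c) = \sum_(p <- s) tmk p.1 p.2 ->
  YW c m (defect l n q u v w)
  = \sum_(p <- s) defect l n (q + m) p.1 (cact Q m p.2 v) w
    + defect (l + m) n (q + m) (cact Q m c u) v w.
Proof.
move=> kw m0 Ss; rewrite /defect (linB (YWr _ _)) mode_at_top //.
rewrite (cact_vtest K_char0 v l n m (S_jacobi Ss)) (linD (YWl _ _)) (lin_sum (YWl _ _)).
have -> : YW c m (mtest l n q u v w)
    = \sum_(p <- s) mtest l n (q + m) p.1 (cact Q m p.2 v) w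
      + mtest (l + m) n (q + m) (cact Q m c u) v w.
  rewrite /mtest (lin_bsum (YWr _ _)); last exact: (mtest_evz _ _ _ _ kw).
  rewrite -bsum_sum; last by move=> p; exact: (mtest_evz _ _ _ _ kw).
  rewrite -bsumD; last 2 first.
  - elim: (s) => [|p s' [M IH]]; first by exists 0%N => i _; rewrite big_nil.
    have [M' HM'] := mtest_evz p.1 (cact Q m p.2 v) (l + n + 1) (q + m - l - n - 1) kw.
    by exists (M + M')%N => i le; rewrite big_cons HM' ?IH ?addr0 //; lia.
  - exact: (mtest_evz _ _ _ _ kw).
  apply: eq_bsum => i; rewrite (YWcomm _ _ _ Ss); congr (_ + _).
    apply: eq_bigr => p _; rewrite (mode_at_top p.2 v _ kw m0).
    by congr (YW _ _ (YW _ _ _)); lia.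
  by congr (YW _ _ (YW _ _ _)); lia.
rewrite sumrB opprD addrACA [m + q]addrC.
by [].
Qed.

Section Propagation.
Variables (u v c : V) (w : W) (d l0 : int).
Hypotheses (hw : hom d w) (d_l0 : d <= l0).
Hypothesis w_assoc : forall l n q u v, l0 <= l -> defect l n q u v w = 0.

Let kw := hom_killed hw.

Let w_assocE l n q u' v' : l0 <= l ->
  YW (vtest Q l n u' v') q w = mtest l n q u' v' w.
Proof. by move=> /(w_assoc n q u' v') /eqP; rewrite subr_eq0 => /eqP. Qed.

(** (t1 - t2)^n t1^l1 (t1 - 1)^n1 t2^l2 (t2 - 1)^n2, expanded for |t1| > |t2| > 1,
paired with the products u[a] v[b] c[N-a-b] w.  Associativity at w is built in
for v and c, whose product is replaced by a vector of V. *)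
Definition mtest3 N n l1 n1 l2 n2 : W :=
  bsum n (fun i => mtest (l1 + n - i%:Z) n1 N u (vtest Q (l2 + i%:Z) n2 v c) w).

Let eq_term N n1 n2 a a' b b' : a = a' -> b = b' ->
  mtest a n1 N u (vtest Q b n2 v c) w = mtest a' n1 N u (vtest Q b' n2 v c) w.
Proof. by move=> -> ->. Qed.

Lemma mtest3_evz N n l1 n1 l2 n2 :
  evz (fun i => mtest (l1 + n - i%:Z) n1 N u (vtest Q (l2 + i%:Z) n2 v c) w).
Proof.
exists (absz (d - N + l1 + n + n1 + 2)%R) => i le.
by apply: (mtest_low _ _ kw); lia.
Qed.

Lemma mtest3_rec0 N n l1 n1 l2 n2 :
  mtest3 N n (l1 + 1) n1 l2 n2
  = mtest3 N n l1 n1 (l2 + 1) n2 + mtest3 N (n + 1) l1 n1 l2 n2.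
Proof.
rewrite [X in _ = _ + X]/mtest3 bsumS //; last exact: mtest3_evz.
rewrite [X in _ = _ + (X - _)](_ : _ = mtest3 N n (l1 + 1) n1 l2 n2); last first.
  by apply: eq_bsum => i; apply: eq_term; lia.
rewrite [X in _ = _ + (_ - X)](_ : _ = mtest3 N n l1 n1 (l2 + 1) n2); last first.
  by apply: eq_bsum => i; apply: eq_term; lia.
by rewrite [RHS]addrC subrK.
Qed.

Lemma mtest3_rec1 N n l1 n1 l2 n2 :
  mtest3 N n (l1 + 1) n1 l2 n2
  = mtest3 N n l1 n1 l2 n2 + mtest3 N n l1 (n1 + 1) l2 n2.
Proof.
rewrite /mtest3 -bsumD; try exact: mtest3_evz.
apply: eq_bsum => i; rewrite -(mtest_rec _ _ _ _ _ kw).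
by apply: eq_term; lia.
Qed.

Lemma mtest3_rec2 N n l1 n1 l2 n2 :
  mtest3 N n l1 n1 (l2 + 1) n2
  = mtest3 N n l1 n1 l2 n2 + mtest3 N n l1 n1 l2 (n2 + 1).
Proof.
rewrite /mtest3 -bsumD; try exact: mtest3_evz.
apply: eq_bsum => i; rewrite -(mtestDv _ _ _ _ _ _ kw) -vtest_rec //.
by apply: eq_term; lia.
Qed.

Lemma mtest3_zero J N n l1 n1 l2 n2 : (forall k, J <= k -> vmode Q v k c = 0) ->
  J <= n2 -> mtest3 N n l1 n1 l2 n2 = 0.
Proof.
move=> v0 le; apply: bsum_zero => i.
by rewrite (vtest_vanish _ v0 le) mtest0v.
Qed.

(** Associativity at w, applied a second time, makes the triple product a mode of a
vector of V.  Negative powers of t1 - t2 are reached by induction: the three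
recursions show that at the next power the difference of the two sides depends
on n1 and n2 through n1 + n2, and it vanishes for large n2. *)
Lemma mtest3_modesA N (r : nat) l1 n1 l2 n2 : l0 <= l1 -> l0 <= l2 ->
  mtest3 N (- r%:Z) l1 n1 l2 n2
  = YW (vtest3 (modesA Q u v c) (- r%:Z) l1 n1 l2 n2) N w.
Proof.
elim: r l1 n1 l2 n2 => [|r IH] l1 n1 l2 n2 le1 le2.
  rewrite oppr0 vtest3_modesA0 w_assocE // /mtest3 bsum0.
  by apply: eq_term; lia.
set n := - r.+1%:Z; have nr : n + 1 = - r%:Z by rewrite /n; lia.
have Ap := modesA_pascal K_char0 Q u v c; have Ab := modesA_box Q u v c.
pose Z l1 n1 l2 n2 := mtest3 N n l1 n1 l2 n2
  - YW (vtest3 (modesA Q u v c) n l1 n1 l2 n2) N w.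
suff: Z l1 n1 l2 n2 = 0 by move/eqP; rewrite subr_eq0 => /eqP.
have Z1 a b a' b' : Z (a + 1) b a' b' = Z a b a' b' + Z a (b + 1) a' b'.
  by rewrite /Z mtest3_rec1 (vtest3_rec1 K_char0) // (linD (YWl _ _)) opprD addrACA.
have Z2 a b a' b' : Z a b (a' + 1) b' = Z a b a' b' + Z a b a' (b' + 1).
  by rewrite /Z mtest3_rec2 (vtest3_rec2 K_char0) // (linD (YWl _ _)) opprD addrACA.
have Z0 a b a' b' : l0 <= a -> l0 <= a' -> Z (a + 1) b a' b' = Z a b (a' + 1) b'.
  move=> ha ha'; rewrite /Z mtest3_rec0 (vtest3_rec0 K_char0) // (linD (YWl _ _)).
  by rewrite nr IH // opprD addrACA subrr addr0.
have shift b b' : Z l1 (b + 1) l2 b' = Z l1 b l2 (b' + 1).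
  by have := Z0 l1 b l2 b' le1 le2; rewrite Z1 Z2 => /addrI.
have shiftX i : Z l1 n1 l2 n2 = Z l1 (n1 - i%:Z) l2 (n2 + i%:Z).
  elim: i => [|i ->]; first by rewrite subr0 addr0.
  have -> : n1 - i%:Z = n1 - i.+1%:Z + 1 by lia.
  by rewrite shift; congr Z; lia.
have [J HJ] := vm_evzi Q v c.
rewrite (shiftX (absz (J - n2)%R)) /Z (mtest3_zero _ _ _ _ _ HJ); last by lia.
rewrite (vtest3_zero (J := J)) ?(lin0 (YWl _ _)) ?subr0 //; last by lia.
exact: modesA_zero.
Qed.

(** On the side of the product of u and v, associativity at w is known for c and
the vectors made of u and v.  What remains is the defect of u and v at the
vectors c[k] w. *)
Lemma mtest3_defect N n l1 l2 n2 : l0 <= l2 -> l0 <= l1 + l2 + n + 1 ->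
  YW (vtest3 (modesB Q u v c) n l1 0 l2 n2) N w - mtest3 N n l1 0 l2 n2
  = bsum n2 (fun i => defect l1 n (l1 + n + l2 + n2 + 2 - i%:Z) u v
                        (YW c (N - (l1 + n + l2 + n2 + 2 - i%:Z)) w)).
Proof.
move=> le2 le12; pose q (i : nat) := l1 + n + l2 + n2 + 2 - i%:Z.
rewrite vtest3_modesB // w_assocE //.
have kq i : killed_above (d - (N - q i)) (YW c (N - q i) w).
  exact: (hom_killed (hom_mode c (N - q i) hw)).
pose i0 := absz (d - N + q 0%N + 1)%R.
have c0 i : (i0 <= i)%N -> YW c (N - q i) w = 0.
  by move=> le; rewrite kw // /q; rewrite /i0 /q in le; lia.
have -> : mtest3 N n l1 0 l2 n2
    = bsum n2 (fun i => mtest l1 n (q i) u v (YW c (N - q i) w)).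
  transitivity (bsum n (fun i => bsum n2 (fun j =>
      YW u (l1 + n + 1 - i%:Z) (YW v (q j - l1 - n - 1 + i%:Z)
        (YW c (N - q j) w))))).
    apply: eq_bsum => i; rewrite mtest0 w_assocE; last by lia.
    rewrite /mtest (lin_bsum (YWr _ _)); last exact: (mtest_evz _ _ _ _ kw).
    by apply: eq_bsum => j; congr (YW _ _ (YW _ _ (YW _ _ _))); rewrite /q; lia.
  rewrite (@bsum_exch _ _ (i0 + absz (d - N + l1 + n + 2)%R)%N) //.
  move=> i j le; have [lt|] := ltnP j i0; last by move=> /c0 ->; rewrite !(lin0 (YWr _ _)).
  rewrite (kq j) ?(lin0 (YWr _ _)) //; rewrite /q /i0 in le lt *; lia.
rewrite -bsumB; last 2 first.
- exact: (mtest_evz _ _ _ _ kw).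
- by exists i0 => i /c0 ->; apply: bsum_zero => j; rewrite !(lin0 (YWr _ _)).
apply: eq_bsum => i; rewrite /defect; congr (YW _ _ (YW _ _ _) - _); rewrite /q; lia.
Qed.

(** Associativity passes from w to c[m] w.  For n >= 0 it holds by
[defect_nonneg], and knowing it at n + 1 makes the defect at n independent of l.
At fixed N = m + q the defect vanishes for low q, because c[N-q] w does; this
starts an induction on q.  The difference of the two triple products vanishes at
n1 = k for large k, by [mtest3_modesA] and the Jacobi identity in the form
[modesA_B].  Expanded by [pascal_up] into differences at n1 = 0, that is, into
defects by [mtest3_defect], it is the defect at q up to defects at lower q. *)
Lemma defect_mode m n q l : l0 <= l -> d - m <= l ->
  defect l n q u v (YW c m w) = 0.
Proof.
have km m' : killed_above (d - m') (YW c m' w) := hom_killed (hom_mode c m' hw).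
case: n => [n _|r]; first exact: defect_nonneg.
rewrite NegzE; move: (r.+1) => {}r.
elim: r m q l => [|r IH] m q l le1 le2.
  by rewrite oppr0; exact: (defect_nonneg 0 _ _ _ (km m)).
set n := - r.+1%:Z; have nr : n + 1 = - r%:Z by rewrite /n; lia.
have shift i m' q' l' : l0 <= l' -> d - m' <= l' ->
    defect (l' + i%:Z) n q' u v (YW c m' w) = defect l' n q' u v (YW c m' w).
  move=> h1 h2; elim: i => [|i <-]; first by rewrite addr0.
  have -> : l' + i.+1%:Z = l' + i%:Z + 1 by lia.
  rewrite (defect_rec _ _ _ _ _ (km m')) nr IH ?addr0 //; lia.
have [N mE] : exists N, m = N - q by exists (q + m); lia.
subst m.
have [t lt] : exists t : nat, q < N - d + t%:Z by exists (absz (q - N + d + 1)%R); lia.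
elim: t q l le1 le2 lt => [|t IHt] q l le1 le2 lt.
  by rewrite (kw c) ?defect0w //; lia.
have [K0 HK0] := @modesA_B K V Q u v c; pose k := absz K0.
(* l2 is large enough for associativity at w; n2 puts the leading term at q. *)
pose l2 : int := (absz l0 + absz l0 + absz n + absz l)%N%:Z.
pose n2 : int := q - l - k%:Z - n - l2 - 2.
pose X l1 n1 := YW (vtest3 (modesB Q u v c) n l1 n1 l2 n2) N w - mtest3 N n l1 n1 l2 n2.
have XP : pascal X.
  move=> a b; rewrite /X mtest3_rec1 (vtest3_rec1 K_char0); last exact: modesB_box.
  by rewrite (linD (YWl _ _)) opprD addrACA.
have [coef coef0 /(_ X l 0 XP)] := pascal_up W k.
rewrite add0r {1}/X mtest3_modesA //; last by rewrite /l2; lia.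
rewrite (_ : vtest3 (modesA Q u v c) _ _ _ _ _ = vtest3 (modesB Q u v c) n l k l2 n2).
  rewrite subrr => /esym; rewrite big_ord_recl big1 ?addr0; last first.
    move=> s _; have sk : (s < k)%N by [].
    rewrite /X mtest3_defect; try by rewrite ?lift0 /l2; lia.
    rewrite bsum_zero ?scaler0 // => i; apply: IHt; rewrite ?lift0 /n2; lia.
  rewrite coef0 scale1r /X mtest3_defect; try by rewrite /l2 /=; lia.
  rewrite /bsum (@nsumE _ _ 1) ?big_ord1; last first.
    move=> i i1; rewrite IHt ?scaler0 //=; rewrite ?/n2; lia.
  rewrite bcoef0 scale1r => D0; rewrite -(shift k) // -[RHS]D0.
  by congr (defect _ _ _ _ _ (YW _ _ _)); rewrite /n2 /=; lia.
apply: eq_pact => j _; apply: eq_pact => k' kk'; apply: eq_pact => m' _.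
by apply: HK0; lia.
Qed.

End Propagation.
End GradedModes.

(** * From vanishing defects to associativity *)

Section Residues.
Variable K : fieldType.
Hypothesis K_char0 : forall n, n.+1%:R != 0 :> K.

(** The residue of t^l (t - 1)^n dt, expanded at infinity. *)
Definition test_res (l n : int) : K := if l + n + 1 is Posz i then bcoef K n i else 0.

Lemma test_res_rec l n : test_res (l + 1) n = test_res l n + test_res l (n + 1).
Proof.
rewrite /test_res; have -> : l + 1 + n + 1 = l + n + 1 + 1 by lia.
have -> : l + (n + 1) + 1 = l + n + 1 + 1 by lia.
case: (l + n + 1) => [i|[|i]].
- have -> : Posz i + 1 = Posz i.+1 by lia.
  by rewrite bcoefS // addrC subrK.
- by have -> : Negz 0 + 1 = Posz 0 by []; rewrite !bcoef0 add0r.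
- have -> : Negz i.+1 + 1 = Negz i by lia.
  by rewrite add0r.
Qed.

Lemma test_res0 l : test_res l 0 = (l == -1)%:R.
Proof.
rewrite /test_res addr0; case: l => [l|[|l]].
- have -> : Posz l + 1 = Posz l.+1 by lia.
  by rewrite bcoef_zero.
- by rewrite (_ : Negz 0 + 1 = Posz 0) ?bcoef0.
- have -> : Negz l.+1 + 1 = Negz l by lia.
  by rewrite (_ : _ == _ = false) //; apply/eqP; lia.
Qed.

Lemma test_res_low l n : l + n + 1 < 0 -> test_res l n = 0.
Proof. by rewrite /test_res; case: (l + n + 1). Qed.

(** For l >= 0 the form t^l (t - 1)^n dt has no pole at 0, so that its residue at
t = 1, on the left, is the one at infinity. *)
Lemma test_ps_res (l r : nat) : test_ps K l (Negz r) r = test_res l (Negz r).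
Proof.
elim: l r => [|l IH] r.
  rewrite test_ps0_res //; case: r => [|r]; first by rewrite /test_res /= bcoef0.
  by rewrite test_res_low //; lia.
have -> : Posz l.+1 = Posz l + 1 by lia.
rewrite test_ps_rec // psE test_res_rec IH; congr (_ + _); case: r => [|r].
  by rewrite psX0 test_res0.
rewrite psXS; have -> : Negz r.+1 + 1 = Negz r by lia.
exact: IH.
Qed.

Lemma ps_eps_powD n (k : nat) : ps_eps_pow K (n + k%:Z) = ps_eps K ^+ k * ps_eps_pow K n.
Proof.
elim: k => [|k IH]; first by rewrite addr0 mul1r.
have -> : n + k.+1%:Z = n + k%:Z + 1 by lia.
by rewrite ps_eps_powS // IH exprS mulrA.
Qed.

End Residues.

Section FromDefects.
Variable K : fieldType.
Hypothesis K_char0 : forall n, n.+1%:R != 0 :> K.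
Variables (V : lmodType K) (Q : weakQVA V).
Variable S : {linear tens V V -> tens V V}.
Variables (W : lmodType K) (YW : V -> int -> W -> W).
Hypothesis YWl : forall n w, linear (fun v => YW v n w).
Hypothesis YWr : forall v n, linear (YW v n).
Hypothesis YWcomm : mode_comm Q S YW.
Variables (u v : V) (k : nat) (w : W) (d : int).
Hypothesis uv_k : forall j, k%:Z <= j -> vmode Q u j v = 0.
Hypothesis kw : killed_above YW d w.

Local Notation mtest := (mtest YW).

Lemma smul_binom a b :
  smul (@sbinom K k) (YYser YW u v w) (a, b)
  = mtest (- a - 1) k (k%:Z - a - b) u v w.
Proof.
rewrite (@smul_nsum _ _ _ _ _ _ (fun i : nat => (k%:Z - i%:Z, i%:Z))).
- apply: eq_nsum => i; rewrite /= {1}/sbinom /= subrK eqxx.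
  by congr (_ *: YW _ _ (YW _ _ _)); lia.
- by move=> i j [].
- case=> e1 e2 ne; rewrite /sbinom /=; case: ifP => [/andP[e2ge /eqP e12]|_].
    by exfalso; apply: (ne (absz e2)); congr (_, _); lia.
  by rewrite scale0r.
- exists (absz (d + 1 + b)%R) => i le.
  by rewrite /= [YW v _ w]kw ?(lin0 (YWr _ _)) ?scaler0 //; lia.
Qed.

Lemma smul_binom_shift a b :
  smul (fun '(a, b) => @sbinom K k (a, b + k%:Z)) (YYser YW u v w) (a, b)
  = mtest (- a - 1) k (- a - b) u v w.
Proof.
rewrite (@smul_nsum _ _ _ _ _ _ (fun i : nat => (k%:Z - i%:Z, i%:Z - k%:Z))).
- apply: eq_nsum => i; rewrite /= !subrK {1}/sbinom /= subrK eqxx.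
  by congr (_ *: YW _ _ (YW _ _ _)); lia.
- by move=> i j []; lia.
- case=> e1 e2 ne; rewrite /sbinom /=; case: ifP => [/andP[e2ge /eqP e12]|_].
    by exfalso; apply: (ne (absz (e2 + k%:Z)%R)); congr (_, _); lia.
  by rewrite scale0r.
- exists (absz (d + 1 + b + k%:Z)%R) => i le.
  by rewrite /= [YW v _ w]kw ?(lin0 (YWr _ _)) ?scaler0 //; lia.
Qed.

Lemma smul_expm1 p q :
  smul (fun '(p, q) => if q == 0 then spow (@sexpm1 K) k p else 0)
       (fun '(p, q) => YW (Yser Q u v p) (- q) w) (p, q)
  = pact (ps_eps K ^+ k) (fun j => YW (vmode Q u j v) (- q) w) (k%:Z - p - 1).
Proof.
rewrite (@smul_nsum _ _ _ _ _ _ (fun i : nat => (k%:Z + i%:Z, 0))).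
- apply: eq_nsum => i; rewrite /= spow_sexpm1 laurentE /Yser.
  by congr (_ *: YW (vmode _ _ _ _) _ _); lia.
- by move=> i j []; lia.
- case=> e1 e2 ne /=; case: ifP => [/eqP e2E|_]; last by rewrite scale0r.
  rewrite spow_sexpm1 laurent_low ?scale0r // ltNge; apply/negP => le.
  by apply: (ne (absz (e1 - k%:Z)%R)); rewrite e2E; congr (_, _); lia.
- exists (absz (p + 1)%R) => i le.
  by rewrite /= /Yser uv_k ?(lin0 (YWl _ _)) ?scaler0 //; lia.
Qed.

(** Here u and v have no pole of order more than k, so that [vtest] is zero at n = k
and the defect, which vanishes, is [mtest]. *)
Lemma mtest_top l q : d <= l -> mtest l k q u v w = 0.
Proof.
move=> dl; have := defect_nonneg K_char0 YWl YWr YWcomm k q u v kw dl.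
rewrite /defect (vtest_vanish _ uv_k) // (lin0 (YWl _ _)) sub0r.
by move=> /eqP; rewrite oppr_eq0 => /eqP.
Qed.

Lemma laurent2_binom : in_laurent2 (smul (@sbinom K k) (YYser YW u v w)).
Proof.
exists (- (absz d)%:Z) => a b lt; rewrite smul_binom.
case: lt => lt; first by apply: mtest_top; lia.
by apply: (mtest_low YWr _ _ kw); lia.
Qed.

Variable l0 : int.
Hypothesis no_defect : forall l n q, l0 <= l -> defect Q YW l n q u v w = 0.

(** At fixed q the two sides are sequences P and E in the exponent of x0.  The
product multiplied by (t - 1)^k is a Laurent polynomial in t, with coefficients
phi, and t^l (t - 1)^n with n <= k is tested on it by residues at infinity.  For
l large enough, these are residues at t = 1 by [test_ps_res], hence combinations
of the coefficients E of the substitution t = e^x0.  So each vanishing defect is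
a linear relation between the P and the E; the relations are triangular with
leading coefficient 1, hence P = E. *)
Lemma phi_assoc_at dd :
  smul (fun '(p, q) => if q == 0 then spow (@sexpm1 K) k p else 0)
       (fun '(p, q) => YW (Yser Q u v p) (- q) w) dd
  = subst_exp (smul (fun '(a, b) => @sbinom K k (a, b + k%:Z)) (YYser YW u v w)) dd.
Proof.
case: dd => p q; rewrite smul_expm1.
pose G j := YW (vmode Q u j v) (- q) w.
have G0 j : k%:Z <= j -> G j = 0.
  by move=> /uv_k; rewrite /G => ->; exact: (lin0 (YWl _ _)).
have Gev : evzi G by exists k%:Z.
pose P j := pact (ps_eps K ^+ k) G j; rewrite -/(P _).
have P0 j : k%:Z <= j -> P j = 0 by apply: pact_vanish.
case: p => [p|p]; last by rewrite P0 //; lia.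
pose phi a := mtest (- a - 1) k (- q) u v w.
pose aa (i : nat) := - d + i%:Z; pose A := absz (d + d + q + k%:Z + 1)%R.
have phi0 a : (forall i, (i < A)%N -> a <> aa i) -> phi a = 0.
  move=> ne; have [lt|ge] := ltP a (- d); first by apply: mtest_top; lia.
  apply: (mtest_low YWr _ _ kw); rewrite ltNge; apply/negP => le.
  by apply: (ne (absz (a + d)%R)); rewrite /aa /A; lia.
pose E m := \sum_(i < A) ((aa i)%:~R ^+ m / m`!%:R) *: phi (aa i).
have -> : subst_exp (smul (fun '(a, b) => @sbinom K k (a, b + k%:Z))
    (YYser YW u v w)) (Posz p, q) = E p.
  rewrite /subst_exp (@fsum_enum _ _ _ A aa); last 2 first.
  - by move=> i j; rewrite /aa; lia.
  - move=> e ne; rewrite smul_binom_shift.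
    have -> : - e - (q - e) = - q by lia.
    by rewrite -/(phi e) phi0 ?scaler0.
  apply: eq_bigr => i _; rewrite smul_binom_shift.
  by have -> : - aa i - (q - aa i) = - q by lia.
(* Both sides satisfy the Pascal recursion, agree at n = k and vanish for low l. *)
have X0 n l : n <= k%:Z ->
    mtest l n (- q) u v w = \sum_(i < A) test_res K (l + aa i) (n - k%:Z) *: phi (aa i).
  pose X l n := mtest l n (- q) u v w
    - \sum_(i < A) test_res K (l + aa i) (n - k%:Z) *: phi (aa i).
  move=> nk; apply/eqP; rewrite -subr_eq0 -/(X l n); apply/eqP.
  apply: (pascal_down (n0 := k%:Z)) => // {nk n l}.
  - move=> l n; rewrite /X (mtest_rec K_char0 YWr _ _ _ _ _ kw).
    have -> : \sum_(i < A) test_res K (l + 1 + aa i) (n - k%:Z) *: phi (aa i)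
      = \sum_(i < A) test_res K (l + aa i) (n - k%:Z) *: phi (aa i)
      + \sum_(i < A) test_res K (l + aa i) (n + 1 - k%:Z) *: phi (aa i).
      rewrite -big_split; apply: eq_bigr => i _ /=.
      have -> : l + 1 + aa i = l + aa i + 1 by lia.
      have -> : n + 1 - k%:Z = n - k%:Z + 1 by lia.
      by rewrite test_res_rec // scalerDl.
    by rewrite opprD addrACA.
  - move=> l; rewrite /X subrr; apply/eqP; rewrite subr_eq0; apply/eqP.
    under eq_bigr => i _ do rewrite test_res0.
    have -> : mtest l k (- q) u v w = phi (- l - 1).
      by rewrite /phi; have -> : - (- l - 1) - 1 = l by lia.
    have [[i ei]|no] := pselect (exists i : 'I_A, - l - 1 = aa i).
      rewrite (bigD1 i) //= big1 ?addr0; last first.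
        move=> j ji; rewrite (_ : (l + aa j == -1) = false) ?scale0r //.
        apply/negbTE; apply: contra ji => /eqP E'; apply/eqP/val_inj.
        by move: ei; rewrite /aa /= in E' *; lia.
      by rewrite ei (_ : _ == _) ?scale1r //; apply/eqP; lia.
    rewrite phi0 => [|i iA E']; last by apply: no; exists (Ordinal iA).
    rewrite big1 // => i _; rewrite (_ : _ == _ = false) ?scale0r //.
    by apply/eqP => E'; apply: no; exists i; lia.
  - move=> n; exists (- (absz d + absz q + absz n + absz d + k + A + 2)%N%:Z) => l le.
    rewrite /X (mtest_low YWr _ _ kw); last by lia.
    rewrite big1 ?subr0 // => i _; rewrite test_res_low ?scale0r //.
    by have := ltn_ord i; rewrite /aa; lia.
pose l := (absz l0 + absz d)%N; pose t r := test_ps K l (Negz r).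
(* The relation from the defect at n = k - r - 1. *)
have sumE r : \sum_(m < r.+1) t r (r - m)%N *: (P (k%:Z - m%:Z - 1) - E m) = 0.
  under eq_bigr => m _ do rewrite scalerBr.
  rewrite sumrB; apply/eqP; rewrite subr_eq0; apply/eqP.
  pose n := k%:Z - r%:Z - 1.
  transitivity (mtest l n (- q) u v w).
    have := no_defect n (- q) (l := l); rewrite /defect => /(_ ltac:(lia)) /eqP.
    rewrite subr_eq0 => /eqP <-.
    rewrite /vtest (lin_pact (YWl _ _)); last exact: vm_evzi.
    rewrite (_ : test_ps K l n = t r * ps_eps K ^+ k); last first.
      rewrite /t /test_ps; have -> : n = Negz r + k%:Z by rewrite /n; lia.
      by rewrite ps_eps_powD // mulrAC mulrA.
    rewrite pactM // /pact (@nsumE _ _ r.+1); last first.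
      by move=> i le; rewrite [nsum _](P0 (n + i%:Z)) ?scaler0 // /n; lia.
    rewrite (reindex_inj rev_ord_inj) /=; apply: eq_bigr => i _.
    have ir : (i <= r)%N by rewrite -ltnS.
    rewrite subSS subKn //; congr (_ *: P _).
    by rewrite /n; lia.
  rewrite X0; last by rewrite /n; lia.
  transitivity (\sum_(i < A) test_ps K (l%:Z + aa i) (Negz r) r *: phi (aa i)).
    apply: eq_bigr => i _; congr (_ *: _).
    have -> : l%:Z + aa i = (absz (l%:Z + aa i)%R)%:Z.
      by rewrite /l /aa; lia.
    rewrite test_ps_res //; congr (test_res _ _ _); rewrite /n; lia.
  rewrite /E; under [RHS]eq_bigr => m _ do rewrite scaler_sumr.
  rewrite exchange_big; apply: eq_bigr => i _ /=.
  rewrite -test_ps_expM // psM scaler_suml; apply: eq_bigr => m _.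
  by rewrite scalerA mulrC.
elim/ltn_ind: p => p IH.
have := sumE p; rewrite big_ord_recr /= subnn [t _ _]test_ps_lead // scale1r big1 ?add0r.
  by move=> /eqP; rewrite subr_eq0 => /eqP.
by move=> i _; rewrite IH ?subrr ?scaler0.
Qed.

End FromDefects.

(** * Linear functionals and spans of graded pieces *)

Section Separation.
Variables (K : fieldType) (U : lmodType K).

(** A maximal subspace that avoids w is a hyperplane, whose quotient map is then a
functional with value 1 at w. *)
Lemma scalar_separates (w : U) : (forall f : {scalar U}, f w = 0) -> w = 0.
Proof.
move=> fw; apply/eqP/negPn/negP => w0.
pose sub := {N : set U | is_subspace N /\ ~ N w}.
have sub_eq (M N : sub) : (forall x, sval M x <-> sval N x) -> M = N.
  case: M N => [M HM] [N HN] /= MN; have E : M = N.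
    by apply/funext => x; apply/propext.
  by subst N; congr exist; exact: Prop_irrelevance.
pose R (M N : sub) := `[< forall x, sval M x -> sval N x >].
have [M Mmax] : exists M : sub, forall N : sub, R M N -> N = M.
  apply: (@Zorn sub R) => [M|M N P|M N|A Atot].
  - by apply/asboolP.
  - by move=> /asboolP MN /asboolP NP; apply/asboolP => x /MN /NP.
  - move=> /asboolP MN /asboolP NM; apply: sub_eq => x; split=> [/MN|/NM] //.
  (* The union of the chain; adding 0 covers the empty chain. *)
  pose N x := x = 0 \/ exists2 M : sub, A M & sval M x.
  have HN : is_subspace N /\ ~ N w.
    split; last first.
      by case=> [wE|[[M [MM nM]] _ /nM]] //; rewrite wE eqxx in w0.
    split=> [|a x y]; first by left.
    move=> [->|[M AM Mx]] [->|[M' AM' My]].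
    - by left; rewrite scaler0 addr0.
    - right; exists M' => //; rewrite scaler0 add0r //.
    - right; exists M => //; case: (svalP M) => -[M0 Mlin] _.
      by apply: Mlin.
    - have [/asboolP le|/asboolP le] := Atot _ _ AM AM'; right.
        by exists M' => //; case: (svalP M') => -[_ Mlin] _; apply: Mlin => //; exact: le.
      by exists M => //; case: (svalP M) => -[_ Mlin] _; apply: Mlin => //; exact: le.
  exists (exist _ N HN) => M AM; apply/asboolP => x Mx; right; by exists M.
have [N [[N0 Nlin] Nw Nmax]] : exists N : set U, [/\ is_subspace N, ~ N w &
    forall N' : set U, is_subspace N' -> ~ N' w -> N `<=` N' -> N' `<=` N].
  exists (sval M); case: (svalP M) => Ms Mw; split=> // N' N's N'w le.
  have <- : exist _ N' (conj N's N'w) = M by apply: Mmax; apply/asboolP.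
  by [].
have NZ a x : N x -> N (a *: x) by move=> Nx; rewrite -[_ *: _]addr0; exact: Nlin.
have ND x y : N x -> N y -> N (x + y) by move=> Nx Ny; rewrite -[x]scale1r; exact: Nlin.
(* If x is not in N, the span of N and x is larger than N and so contains w. *)
have coset x : exists a, N (x - a *: w).
  have [Nx|Nx] := pselect (N x); first by exists 0; rewrite scale0r subr0.
  pose N' y := exists b, N (y - b *: x).
  have [[b Nb]|N'w] := pselect (N' w).
    have b0 : b != 0 by apply/eqP => b0; apply: Nw; rewrite -[w]subr0 -(scale0r x) -b0.
    exists b^-1; rewrite -[x]scale1r -(mulVf b0) -scalerA -scalerBr -opprB scalerN -scaleNr.
    exact: NZ.
  have N'sub : is_subspace N'.
    split=> [|a y z [b Hb] [b' Hb']].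
      by exists 0; rewrite scale0r subr0.
    exists (a * b + b'); rewrite scalerDl opprD addrACA -scalerA -scalerBr.
    exact: Nlin.
  exfalso; apply: Nx; apply: (Nmax _ N'sub N'w).
    by move=> y Ny; exists 0; rewrite scale0r subr0.
  by exists 1; rewrite scale1r subrr.
have coset_uniq x a b : N (x - a *: w) -> N (x - b *: w) -> a = b.
  move=> Na Nb; apply/eqP/negPn/negP => ab; apply: Nw.
  have ab' : b - a != 0 by rewrite subr_eq0 eq_sym.
  rewrite -[w]scale1r -(mulVf ab') -scalerA; apply: NZ.
  have -> : (b - a) *: w = (-1) *: (x - b *: w) + (x - a *: w).
    by rewrite scaleN1r opprB addrA subrK scalerBl.
  exact: Nlin.
pose f x := sval (cid (coset x)).
have fP x : N (x - f x *: w) := svalP (cid (coset x)).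
have fl : linear_for *%R f.
  move=> a x y; apply: (coset_uniq (a *: x + y)) => //.
  rewrite scalerDl opprD addrACA -scalerA -scalerBr.
  exact: Nlin.
pose F : {scalar U} := HB.pack f (GRing.isLinear.Build K U K *%R f fl).
have fw1 : f w = 1 by apply: (coset_uniq w) => //; rewrite scale1r subrr.
have := fw F; rewrite -[F w]/(f w) fw1 => /eqP.
by rewrite oner_eq0.
Qed.

End Separation.

Section EigenDirect.
Variables (K : fieldType) (M : lmodType K).

(** Applying T - mu j to a relation removes the term of x j, which gives a shorter
relation between multiples of the other terms. *)
Lemma eigen_direct (I : eqType) (mu : I -> K) (r : seq I) (T : M -> M) (x : I -> M) :
  linear T -> injective mu -> uniq r -> (forall i, T (x i) = mu i *: x i) ->
  \sum_(i <- r) x i = 0 -> forall i, i \in r -> x i = 0.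
Proof.
move=> Tl mu_inj; elim: r x => [|j r IH] x //= /andP[jr ur] Tx.
rewrite big_cons => sum0.
have x0 i : i \in r -> x i = 0.
  move=> ir; pose y k := (mu k - mu j) *: x k.
  have: y i = 0.
    apply: IH => //.
      by move=> k; rewrite /y (linZ Tl) Tx !scalerA mulrC.
    have := congr1 T sum0; rewrite (lin0 Tl) (linD Tl) (lin_sum Tl) Tx => TS.
    transitivity (\sum_(k <- r) T (x k) - mu j *: \sum_(k <- r) x k).
      rewrite scaler_sumr -sumrB; apply: eq_bigr => k _.
      by rewrite /y Tx scalerBl.
    move/eqP: sum0; rewrite addrC addr_eq0 => /eqP ->.
    by rewrite scalerN opprK addrC.
  move/eqP; rewrite /y scaler_eq0 subr_eq0 => /orP[/eqP /mu_inj ij|/eqP //].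
  by rewrite ij (negbTE jr) in ir.
move: sum0; rewrite big_seq big1 ?addr0 // => xj i.
by rewrite inE => /orP[/eqP ->|/x0].
Qed.

Lemma in_span_sum (S : set M) (I : Type) (r : seq I) (P : pred I) (F : I -> M) :
  (forall i, P i -> in_span S (F i)) -> in_span S (\sum_(i <- r | P i) F i).
Proof.
move=> SF; elim/big_rec: _ => [|i x Pi Sx]; first exact: in_span0.
by apply: in_spanD => //; exact: SF.
Qed.

Lemma in_span_comb (S : set M) a x y :
  in_span S x -> in_span S y -> in_span S (a *: x + y).
Proof. by move=> Sx Sy; apply: in_spanD => //; exact: in_spanZ. Qed.

Lemma in_span_subspace (S : set M) : is_subspace S -> forall x, in_span S x -> S x.
Proof.
move=> [S0 Slin] x; elim=> // [u v _ Su _ Sv|a v _ Sv].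
  by rewrite -[u]scale1r; exact: Slin.
by rewrite -[_ *: _]addr0; exact: Slin.
Qed.

Lemma span_components (G : int -> set M) (A : set int) :
  (forall d, is_subspace (G d)) -> forall x, in_span (\bigcup_(d in A) G d) x ->
  exists (s : seq int) (f : int -> M), [/\ uniq s, forall d, d \in s -> A d,
    forall d, G d (f d) & x = \sum_(d <- s) f d].
Proof.
move=> Gsub x; elim=> [|v [d Ad Gv]|u v _ [s [f [us sA Gf ->]]] _ [t [g [ut tA Gg ->]]]
    |a v _ [s [f [us sA Gf ->]]]].
- exists [::], (fun=> 0); split=> // [d|]; last by rewrite big_nil.
  by case: (Gsub d).
- exists [:: d], (fun d' => if d' == d then v else 0); split=> //.
  + by move=> d'; rewrite inE => /eqP ->.
  + by move=> d'; case: eqP => [->|_] //; case: (Gsub d').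
  + by rewrite big_seq1 eqxx.
- pose mask (r : seq int) (h : int -> M) d := if d \in r then h d else 0.
  have GD d y z : G d y -> G d z -> G d (y + z).
    by move=> Gy Gz; rewrite -[y]scale1r; case: (Gsub d) => _; apply.
  have Gm r h d : (forall d, G d (h d)) -> G d (mask r h d).
    by rewrite /mask => Gh; case: ifP => // _; case: (Gsub d).
  exists (undup (s ++ t)), (fun d => mask s f d + mask t g d); split.
  + exact: undup_uniq.
  + by move=> d; rewrite mem_undup mem_cat => /orP[/sA|/tA].
  + by move=> d; apply: GD; exact: Gm.
  have msum (r : seq int) h : uniq r -> {subset r <= s ++ t} ->
      \sum_(d <- undup (s ++ t)) mask r h d = \sum_(d <- r) h d.
    move=> ur sub; rewrite /mask -big_mkcond -big_filter.
    apply: perm_big; apply: uniq_perm => //; first by rewrite filter_uniq ?undup_uniq.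
    move=> d; rewrite mem_filter mem_undup.
    by case: (boolP (d \in r)) => // /sub ->.
  rewrite big_split /= !msum // => d; rewrite mem_cat => -> //; exact: orbT.
- exists s, (fun d => a *: f d); split=> // [d|]; last by rewrite scaler_sumr.
  by rewrite -[_ *: _]addr0; case: (Gsub d) => G0; apply.
Qed.

Lemma span_components_nat (G : int -> set M) : (forall d, is_subspace (G d)) ->
  forall x, in_span (\bigcup_(d in [set d : int | 0 <= d]) G d) x ->
  exists (N : nat) (f : nat -> M), (forall n : nat, G n (f n)) /\ x = \sum_(n < N) f n.
Proof.
move=> Gsub x /(span_components Gsub) [s [f [us sA Gf ->]]].
pose N := (\max_(d <- s) absz d).+1.
exists N, (fun n : nat => if n%:Z \in s then f n else 0); split.
  by move=> n; case: ifP => // _; case: (Gsub n).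
rewrite -(big_mkord xpredT (fun n : nat => if n%:Z \in s then f n else 0)) -big_mkcond.
rewrite -big_filter -[RHS](big_map Posz xpredT f).
apply: perm_big; apply: uniq_perm => //.
  by rewrite map_inj_uniq ?filter_uniq ?iota_uniq // => i j [].
move=> d; apply/idP/mapP => [ds|[n]]; last by rewrite mem_filter => /andP[ns _] ->.
exists (absz d); last by have := sA d ds => /=; lia.
have dE : (absz d)%:Z = d by have := sA d ds => /=; lia.
rewrite mem_filter dE ds mem_index_iota /= ltnS.
by rewrite (big_rem d) //= leq_maxl.
Qed.

End EigenDirect.

(** * The universal algebra *)

Section PresentedAlgebraTheory.
Variables (K : fieldType) (X : Type) (rel : aterm K X -> aterm K X -> Prop).

Lemma palg_ind (P : palg rel -> Prop) :
  (forall x, P (pgen rel x)) -> P 0 -> P 1 ->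
  (forall x y, P x -> P y -> P (x + y)) -> (forall a x, P x -> P (a *: x)) ->
  (forall x y, P x -> P y -> P (x * y)) -> forall x, P x.
Proof.
move=> Pg P0 P1 PD PZ PM x; rewrite -(preprK x).
elim: (prepr x) => [y||s IHs t IHt|s IHs|a s IHs||s IHs t IHt].
- exact: Pg.
- by rewrite ppi0.
- by rewrite ppiD; exact: PD.
- by rewrite ppiN -scaleN1r; exact: PZ.
- by rewrite ppiZ; exact: PZ.
- by rewrite ppi1.
- by rewrite ppiM; exact: PM.
Qed.

Lemma palg_rel s t : rel s t -> ppi rel s = ppi rel t.
Proof. by move=> st; apply/ppi_eq/acong_rel. Qed.

Variables (X' : Type) (rel' : aterm K X' -> aterm K X' -> Prop).
Variable h : X -> palg rel'.

Fixpoint aeval (s : aterm K X) : palg rel' :=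
  match s with
  | TGen x => h x
  | TZero => 0
  | TAdd s t => aeval s + aeval t
  | TOpp s => - aeval s
  | TScale a s => a *: aeval s
  | TOne => 1
  | TMul s t => aeval s * aeval t
  end.

Lemma aeval_sum (J : Type) (r : seq J) (P : pred J) (F : J -> aterm K X) :
  aeval (\big[@TAdd K X/TZero]_(j <- r | P j) F j) = \sum_(j <- r | P j) aeval (F j).
Proof. exact: (big_morph aeval). Qed.

(** Evaluation at images h of the generators, a homomorphism as soon as h satisfies
the relations. *)
Definition peval (x : palg rel) : palg rel' := aeval (prepr x).

Hypothesis h_rel : forall s t, rel s t -> aeval s = aeval t.

Lemma acong_aeval s t : acong rel s t -> aeval s = aeval t.
Proof.
elim=> {s t} //= [s t r _ -> _ -> //|s s' t t' _ -> _ -> //|s s' _ -> //|a s s' _ -> //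
  |s s' t t' _ -> _ -> //|s t r|s t|s|s|a b s|s|a s t|a b s|s t r|s|s|s t r|s t r|a s t|a s t].
- exact: addrA.
- exact: addrC.
- exact: add0r.
- exact: addNr.
- exact: scalerA.
- exact: scale1r.
- exact: scalerDr.
- exact: scalerDl.
- exact: mulrA.
- exact: mul1r.
- exact: mulr1.
- exact: mulrDl.
- exact: mulrDr.
- exact: palg_scalerAl.
- exact: palg_scalerAr.
Qed.

Lemma pevalE s : peval (ppi rel s) = aeval s.
Proof. exact/acong_aeval/acong_repr. Qed.

Lemma peval_gen x : peval (pgen rel x) = h x.
Proof. by rewrite pevalE. Qed.

Lemma peval1 : peval 1 = 1.
Proof. by rewrite -ppi1 pevalE. Qed.

Lemma pevalM x y : peval (x * y) = peval x * peval y.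
Proof. by rewrite -(preprK x) -(preprK y) -ppiM !pevalE. Qed.

Lemma peval_linear : linear peval.
Proof. by move=> a x y; rewrite -(preprK x) -(preprK y) -ppiZ -ppiD !pevalE. Qed.

End PresentedAlgebraTheory.

Section UniversalAlgebra.
Variable K : fieldType.
Hypothesis K_char0 : forall n, n.+1%:R != 0 :> K.
Variables (V : lmodType K) (Q : weakQVA V).
Variable S : {linear tens V V -> tens V V}.
Local Notation A := (Utilde Q S).
Local Notation um := (Umode Q S).

Lemma Umode_linear n : linear (um^~ n).
Proof.
move=> a u v; rewrite /Umode /pgen; have := mode_rel_linear Q S (fun n : int => n%:~R) a u v n.
by move=> /palg_rel ->; rewrite ppiD ppiZ.
Qed.

Lemma Umode_vac n : um (vac Q) n = if n == 0 then 1 else 0.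
Proof.
rewrite /Umode /pgen; have := mode_rel_vac Q S (fun n : int => n%:~R) n.
by move=> /palg_rel ->; case: ifP.
Qed.

Lemma Umode_Dop u n : um (Dop Q u) n = - n%:~R *: um u n.
Proof.
rewrite /Umode /pgen; have := mode_rel_D Q S (fun n : int => n%:~R) u n.
by move=> /palg_rel ->; rewrite ppiZ.
Qed.

Lemma cact_sum u v m N : (forall j : nat, (N <= j)%N -> vmode Q u j v = 0) ->
  cact Q m u v = \sum_(j < N) (m%:~R ^+ j / j`!%:R) *: vmode Q u j v.
Proof.
move=> u0; rewrite cactE // /pact (@nsumE _ _ N).
  by apply: eq_bigr => j _; rewrite add0r.
by move=> j le; rewrite add0r u0 ?scaler0.
Qed.

Lemma Umode_comm u v m n (s : seq (V * V)) :
  S (tmk v u) = \sum_(p <- s) tmk p.1 p.2 ->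
  um u m * um v n = \sum_(p <- s) um p.1 n * um p.2 m + um (cact Q m u v) (m + n).
Proof.
move=> Ss; have [N HN] := vm_evzi Q u v.
have u0 (j : nat) : (absz N <= j)%N -> vmode Q u j v = 0 by move=> le; apply: HN; lia.
have := mode_rel_comm (fun n : int => n%:~R) m n Ss u0.
move=> /palg_rel; rewrite ppiD ppiN ppiM !ppi_sum => /eqP.
rewrite subr_eq => /eqP E; rewrite [LHS]E [RHS]addrC; congr (_ + _); last first.
  by apply: eq_bigr => p _; rewrite ppiM.
rewrite (cact_sum _ u0) (lin_sum (Umode_linear _)); apply: eq_bigr => j _.
by rewrite ppiZ (linZ (Umode_linear _)).
Qed.

Definition word (s : seq (V * int)) : A := \prod_(x <- s) um x.1 x.2.

Lemma wordM s t : word s * word t = word (s ++ t).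
Proof. by rewrite /word big_cat. Qed.

Lemma word1 v n : word [:: (v, n)] = um v n.
Proof. by rewrite /word big_seq1. Qed.

Lemma span_words (x : A) : in_span (range word) x.
Proof.
elim/palg_ind: x => [[v n]|||x y|a x|x y].
- by apply: in_span_gen; exists [:: (v, n)] => //; exact: word1.
- exact: in_span0.
- by apply: in_span_gen; exists [::] => //; rewrite /word big_nil.
- exact: in_spanD.
- exact: in_spanZ.
move=> Sx Sy; elim: Sx => [|_ [s _ <-]|x1 x2 _ IH1 _ IH2|a x1 _ IH].
- by rewrite mul0r; exact: in_span0.
- elim: Sy => [|_ [t _ <-]|y1 y2 _ IH1 _ IH2|a y1 _ IH].
  + by rewrite mulr0; exact: in_span0.
  + by apply: in_span_gen; exists (s ++ t) => //; rewrite wordM.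
  + by rewrite mulrDr; exact: in_spanD.
  + by rewrite -palg_scalerAr; exact: in_spanZ.
- by rewrite mulrDl; exact: in_spanD.
- by rewrite -palg_scalerAl; exact: in_spanZ.
Qed.

Definition weight (n : int) : K := 2%:R ^ (- n).

Lemma weightD m n : weight (m + n) = weight m * weight n.
Proof. by rewrite /weight opprD expfzDr //; exact: (K_char0 1). Qed.

Lemma weight0 : weight 0 = 1.
Proof. by rewrite /weight oppr0 expr0z. Qed.

Lemma weight_inj : injective weight.
Proof.
have two : 2%:R != 0 :> K := K_char0 1.
have nat_inj (m n : nat) : m%:R = n%:R :> K -> (m <= n)%N.
  move=> E; rewrite leqNgt; apply/negP => lt.
  have := K_char0 (m - n).-1; rewrite prednK ?subn_gt0 //.
  by rewrite natrB ?(ltnW lt) // E subrr eqxx.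
have pos (n : nat) : 2%:R ^+ n = 1 :> K -> n = 0%N.
  move=> E; have := nat_inj (2 ^ n)%N 1%N; rewrite natrX E => /(_ erefl).
  case: n {E} => // n.
  by rewrite expnS; have := expn_gt0 2 n; lia.
move=> m n mn.
wlog le : m n mn / m <= n.
  by move=> H; have [?|?] := leP m n; [exact: H | symmetry; apply: H => //; lia].
have : weight (m - n) = 1 by rewrite weightD mn -weightD subrr weight0.
rewrite /weight opprB.
have -> : n - m = (absz (n - m)%R)%:Z by lia.
by move=> /pos; lia.
Qed.

(** The relations are homogeneous, so v[n] -> 2^(-n) v[n] is an automorphism.  Its
eigenvalues on the graded components are distinct, which makes the sum of the
components direct. *)
Definition dilate : A -> A := peval (fun x : V * int => weight x.2 *: um x.1 x.2).

Lemma dilate_rel s t : mode_rel Q S (fun n : int => n%:~R) s t ->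
  aeval (rel' := mode_rel Q S (fun n : int => n%:~R))
    (fun x : V * int => weight x.2 *: um x.1 x.2) s
  = aeval (fun x : V * int => weight x.2 *: um x.1 x.2) t.
Proof.
case=> [a u v n|n|u n|u v m n r N Sr uN] /=.
- by rewrite Umode_linear scalerDr !scalerA mulrC.
- by rewrite Umode_vac; case: eqP => [->|_]; rewrite ?weight0 ?scale1r ?scaler0.
- by rewrite Umode_Dop !scalerA mulrC.
rewrite !aeval_sum /=.
transitivity (weight (m + n) *: (um u m * um v n - \sum_(p <- r) um p.1 n * um p.2 m)).
  rewrite scalerBr; congr (_ - _).
    by rewrite weightD -palg_scalerAl -palg_scalerAr scalerA.
  rewrite scaler_sumr; apply: eq_bigr => p _.
  by rewrite -palg_scalerAl -palg_scalerAr scalerA addrC weightD.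
rewrite (Umode_comm _ _ Sr) addrAC subrr add0r (cact_sum _ uN).
rewrite (lin_sum (Umode_linear _)) scaler_sumr; apply: eq_bigr => j _.
by rewrite (linZ (Umode_linear _)) !scalerA mulrC.
Qed.

Lemma dilate_mode v n : dilate (um v n) = weight n *: um v n.
Proof. exact: (peval_gen dilate_rel). Qed.

Lemma dilate1 : dilate 1 = 1.
Proof. exact: (peval1 dilate_rel). Qed.

Lemma dilateM x y : dilate (x * y) = dilate x * dilate y.
Proof. exact: (pevalM dilate_rel). Qed.

Lemma dilate_linear : linear dilate.
Proof. exact: (peval_linear dilate_rel). Qed.

Lemma dilate_word s : dilate (word s) = weight (\sum_(x <- s) x.2) *: word s.
Proof.
rewrite /word; elim: s => [|[v n] s IH].
  by rewrite !big_nil dilate1 weight0 scale1r.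
rewrite !big_cons dilateM dilate_mode IH /= weightD.
by rewrite -palg_scalerAl -palg_scalerAr scalerA.
Qed.

Lemma alg_genP (G : set A) (P : A -> Prop) :
  (forall x, G x -> P x) -> P 1 -> (forall x y, P x -> P y -> P (x + y)) ->
  (forall a x, P x -> P (a *: x)) -> (forall x y, P x -> P y -> P (x * y)) ->
  forall x, alg_gen G x -> P x.
Proof.
move=> PG P1 PD PZ PM x.
by elim=> [y /PG|//|y z _ Py _ Pz|a y _ Py|y z _ Py _ Pz]; auto.
Qed.

Lemma UzeroUminus_Bpi x : in_span (@UzeroUminus K V Q S) x -> exists b, x = Bpi b.
Proof.
have lin := @Bpi_linear K V Q S.
elim=> [|_ [a [b [Ha Hb ->]]]|_ _ _ [b ->] _ [b' ->]|a _ _ [b ->]].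
- by exists 0; rewrite (lin0 lin).
- have [[b1 ->] [b2 ->]] : (exists b1, a = Bpi b1) /\ exists b2, b = Bpi b2.
    split; [move: a Ha|move: b Hb]; apply: alg_genP.
    + by move=> _ [v ->]; exists (Bmode Q S v 0); rewrite Bpi_mode.
    + by exists 1; rewrite Bpi1.
    + by move=> _ _ [x1 ->] [x2 ->]; exists (x1 + x2); rewrite (linD lin).
    + by move=> k _ [x1 ->]; exists (k *: x1); rewrite (linZ lin).
    + by move=> _ _ [x1 ->] [x2 ->]; exists (x1 * x2); rewrite BpiM.
    + by move=> _ [v [n [_ ->]]]; exists (Bmode Q S v n); rewrite Bpi_mode.
    + by exists 1; rewrite Bpi1.
    + by move=> _ _ [x1 ->] [x2 ->]; exists (x1 + x2); rewrite (linD lin).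
    + by move=> k _ [x1 ->]; exists (k *: x1); rewrite (linZ lin).
    + by move=> _ _ [x1 ->] [x2 ->]; exists (x1 * x2); rewrite BpiM.
  by exists (b1 * b2); rewrite BpiM.
- by exists (b + b'); rewrite (linD lin).
- by exists (a *: b); rewrite (linZ lin).
Qed.

End UniversalAlgebra.

(** * The grading of the induced module *)

Lemma scaleCA (K : fieldType) (W : lmodType K) (a b : K) (w : W) :
  a *: (b *: w) = b *: (a *: w).
Proof. by rewrite !scalerA mulrC. Qed.

Lemma scaleB_comb (K : fieldType) (W : lmodType K) (a : K) (x y z t : W) :
  a *: x + y - (a *: z + t) = a *: (x - z) + (y - t).
Proof. by rewrite opprD addrACA scalerBr. Qed.

Section InducedModule.
Variable K : fieldType.
Hypothesis K_char0 : forall n, n.+1%:R != 0 :> K.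
Variables (V : lmodType K) (Q : weakQVA V).
Variable S : {linear tens V V -> tens V V}.
Variables (U : lmodType K) (act : Atilde Q -> U -> U) (psi : Balg Q S -> Atilde Q).
Hypothesis A_basis : assumptionA Q S.
Hypotheses (U_mod : is_Atilde_module act) (psi_P : is_psi psi).
Hypothesis theta_P : theta_iso act psi.

Local Notation A := (Utilde Q S).
Local Notation um := (Umode Q S).
Local Notation M := (Mtilde act psi).
Local Notation mten := (Mten act psi).
Local Notation mact := (Mact act psi).
Local Notation mgr := (Mgr act psi).
Local Notation th := (theta act psi).
Local Notation proj0 := (P0 act psi).
Local Notation mmode := (fun v n => mact (um v n)).

Let ten_l w : linear (mten^~ w) := @Mten_linearl K V Q S U act psi w.
Let ten_r a : linear (mten a) := @Mten_linearr K V Q S U act psi a.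
Let mact_r a : linear (mact a) := @Mact_linear K V Q S U act psi a.

Lemma theta_linear : linear th.
Proof. exact: ten_r. Qed.

Let ten0l w : mten 0 w = 0. Proof. exact: (lin0 (ten_l w)). Qed.
Let tenDl a b w : mten (a + b) w = mten a w + mten b w.
Proof. exact: (linD (ten_l w)). Qed.
Let tenZl c a w : mten (c *: a) w = c *: mten a w.
Proof. exact: (linZ (ten_l w)). Qed.
Let ten0r a : mten a 0 = 0. Proof. exact: (lin0 (ten_r a)). Qed.
Let tenDr a w w' : mten a (w + w') = mten a w + mten a w'.
Proof. exact: (linD (ten_r a)). Qed.
Let tenZr c a w : mten a (c *: w) = c *: mten a w.
Proof. exact: (linZ (ten_r a)). Qed.

Lemma MactZ a c m : mact a (c *: m) = c *: mact a m.
Proof. exact: (linZ (mact_r a)). Qed.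

Lemma Mact_theta a w : mact a (th w) = mten a w.
Proof. by rewrite /theta Mact_ten mulr1. Qed.

Lemma Mact_linearl m : linear (fun a => mact a m).
Proof.
move=> c a b; elim/Mtilde_ind: m => [|x y IHx IHy|d w].
- by rewrite !Mact0 scaler0 addr0.
- by rewrite !MactD IHx IHy scalerDr addrACA.
- by rewrite !Mact_ten mulrDl -palg_scalerAl ten_l.
Qed.

Lemma MactDl a b m : mact (a + b) m = mact a m + mact b m.
Proof. exact: (linD (Mact_linearl m)). Qed.

Lemma MactZl c a m : mact (c *: a) m = c *: mact a m.
Proof. exact: (linZ (Mact_linearl m)). Qed.

Lemma Mmode_linearl n m : linear (fun v => mmode v n m).
Proof. by move=> a u v; rewrite Umode_linear Mact_linearl. Qed.

Lemma Mmode_comm : mode_comm Q S mmode.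
Proof.
move=> u v m n x s Ss; rewrite -MactM (@Umode_comm K V Q S _ _ _ _ _ Ss).
transitivity (mact (\sum_(p <- s) um p.1 n * um p.2 m) x + mmode (cact Q m u v) (m + n) x).
  exact: (linD (Mact_linearl x)).
congr (_ + _).
transitivity (\sum_(p <- s) mact (um p.1 n * um p.2 m) x).
  exact: (lin_sum (Mact_linearl x)).
by apply: eq_bigr => p _; exact: MactM.
Qed.

Lemma Mgr_subspace d : is_subspace (mgr d).
Proof. by split=> [|a u v]; [exact: in_span0 | exact: in_span_comb]. Qed.

Lemma Mgr_word d s m : mgr d m -> mgr (d - \sum_(x <- s) x.2) (mact (word Q S s) m).
Proof.
elim=> [|_ [t [w [td ->]]]|x y _ IHx _ IHy|a x _ IH].
- by rewrite Mact0; exact: in_span0.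
- apply: in_span_gen; exists (s ++ t), w; split.
    by rewrite big_cat /= td opprB.
  by rewrite Mact_ten -/(word Q S t) wordM.
- rewrite MactD; exact (in_spanD IHx IHy).
- rewrite MactZ; exact (in_spanZ _ IH).
Qed.

Lemma Mgr_mode d v n m : mgr d m -> mgr (d - n) (mmode v n m).
Proof. by move=> /(Mgr_word [:: (v, n)]); rewrite word1 big_seq1. Qed.

Lemma Mgr_theta w : mgr 0 (th w).
Proof.
by apply: in_span_gen; exists [::], w; split; rewrite ?big_nil ?oppr0 // /word big_nil.
Qed.

Lemma act0 w : act 0 w = 0. Proof. exact: (lin0 (Aact_linearl U_mod w)). Qed.

Lemma act_psiM b b' w : act (psi (b * b')) w = act (psi b) (act (psi b') w).
Proof.
have [u ub] : exists u, psi b = Acls Q u by exists (vrepr (psi b)); rewrite /Acls vreprK.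
have [u' ub'] : exists u, psi b' = Acls Q u by exists (vrepr (psi b')); rewrite /Acls vreprK.
by rewrite (psiM psi_P ub ub') (AactM U_mod) ub ub'.
Qed.

Let dilM (x y : A) : dilate (x * y) = dilate x * dilate y.
Proof. exact: (@dilateM K K_char0 V Q S). Qed.
Let dil1 : dilate (1 : A) = 1.
Proof. exact: (@dilate1 K K_char0 V Q S). Qed.

(** [psi] annihilates the modes of positive index and the modes of index 0 are
fixed by the rescaling, which therefore descends to the induced module. *)
Lemma dilate_balanced b x w : mten (x * dilate (Bpi b)) w = mten x (act (psi b) w).
Proof.
have dl := @dilate_linear K K_char0 V Q S; have bl := @Bpi_linear K V Q S.
elim/palg_ind: b x w => [[v n]|||b b' IH IH'|a b IH|b b' IH IH'] x w.
- rewrite -/(Bmode Q S v n); have psi_v := psi_mode psi_P v n.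
  rewrite Bpi_mode (dilate_mode K_char0) -palg_scalerAr tenZl -Bpi_mode Mten_balanced.
  case: n psi_v => [|n] psi_v; first by rewrite [weight K _]weight0 scale1r.
  by rewrite psi_v act0 ten0r scaler0.
- rewrite (lin0 bl) (lin0 dl) mulr0 ten0l.
  by rewrite (lin0 (psi_linear psi_P)) act0 ten0r.
- by rewrite Bpi1 dil1 mulr1 (psi1 psi_P) (Aact1 U_mod).
- rewrite (linD bl) (linD dl) mulrDr tenDl IH IH'.
  by rewrite (linD (psi_linear psi_P)) (linD (Aact_linearl U_mod w)) tenDr.
- rewrite (linZ bl) (linZ dl) -palg_scalerAr tenZl IH.
  by rewrite (linZ (psi_linear psi_P)) (linZ (Aact_linearl U_mod w)) tenZr.
- by rewrite BpiM dilM mulrA IH' IH act_psiM.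
Qed.

Definition Mdilate : M -> M := vqlift (tlift (fun a w => mten (dilate a) w)).

Let dil_l w : linear (fun a => mten (dilate a) w).
Proof. by move=> c a b; rewrite (dilate_linear K_char0) ten_l. Qed.

Let dil_r a : linear (fun w => mten (dilate a) w).
Proof. exact: ten_r. Qed.

Let dil_lift a w :
  tlift (fun (a : A) w => mten (dilate a) w) (tmk a w) = mten (dilate a) w.
Proof. exact: (tliftE (h := fun (a : A) w => mten (dilate a) w) dil_l dil_r). Qed.

Let dil_kill t : balanced act psi t -> tlift (fun a w => mten (dilate a) w) t = 0.
Proof.
case=> a [b [w ->]]; rewrite -scaleN1r addrC (tlift_linear dil_l dil_r).
have E := congr2 (fun x y => (-1) *: x + y) (dil_lift a (act (psi b) w))
  (dil_lift (a * Bpi b) w).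
by rewrite E dilM dilate_balanced scaleN1r addNr.
Qed.

Lemma Mdilate_ten a w : Mdilate (mten a w) = mten (dilate a) w.
Proof.
by rewrite /Mdilate vqliftE ?dil_lift //; exact: tlift_linear.
Qed.

Lemma Mdilate_linear : linear Mdilate.
Proof. by apply: vqlift_linear => //; exact: tlift_linear. Qed.

Let mdil0 : Mdilate 0 = 0. Proof. exact: (lin0 Mdilate_linear). Qed.
Let mdilD x y : Mdilate (x + y) = Mdilate x + Mdilate y.
Proof. exact: (linD Mdilate_linear). Qed.
Let mdilZ a x : Mdilate (a *: x) = a *: Mdilate x.
Proof. exact: (linZ Mdilate_linear). Qed.

Lemma Mdilate_eigen d m : mgr d m -> Mdilate m = weight K (- d) *: m.
Proof.
elim=> [|_ [s [w [sd ->]]]|x y _ IHx _ IHy|a x _ IH].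
- by rewrite mdil0 scaler0.
- by rewrite Mdilate_ten (dilate_word K_char0) sd tenZl.
- by rewrite mdilD IHx IHy scalerDr.
- rewrite mdilZ IH; exact: scaleCA.
Qed.

(** The components are eigenspaces of [Mdilate]. *)
Lemma Mgr_direct (s : seq int) (f : int -> M) : uniq s -> (forall d, mgr d (f d)) ->
  \sum_(d <- s) f d = 0 -> forall d, d \in s -> f d = 0.
Proof.
move=> us Gf; apply: (@eigen_direct _ _ _ (fun d => weight K (- d)) _ Mdilate) => //.
- exact: Mdilate_linear.
- by move=> d d' /(weight_inj K_char0) /oppr_inj.
- by move=> d; exact: Mdilate_eigen.
Qed.

(** By Assumption A the universal algebra is spanned by products of an element of
U+, which lowers no degree, and an image of B(V), which preserves 1 (x) U. *)
Lemma Mtotal m : in_span (\bigcup_(d in [set d : int | 0 <= d]) mgr d) m.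
Proof.
elim/Mtilde_ind: m => [|x y Hx Hy|a w]; [exact: in_span0|exact (in_spanD Hx Hy)|].
have [f [f_mul [g fK gK]]] := A_basis.
rewrite -(gK a); elim/tens_ind: (g a) => [|x y IHx IHy|[x Hx] [y Hy]].
- by rewrite linear0 ten0l; exact: in_span0.
- rewrite linearD tenDl; exact (in_spanD IHx IHy).
rewrite f_mul /=; move/lspanP: Hx => Hx; move/lspanP: Hy => Hy.
have [b ->] := UzeroUminus_Bpi Hy; rewrite Mten_balanced.
move: (act _ w) => {}w; elim: Hx w => [|{}x Ux|x1 x2 _ IH1 _ IH2|k x1 _ IH] w.
- by rewrite ten0l; exact: in_span0.
- suff: forall d m, 0 <= d -> mgr d m ->
      in_span (\bigcup_(d in [set d : int | 0 <= d]) mgr d) (mact x m).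
    by move=> /(_ 0 (th w)); rewrite Mact_theta; apply=> //; exact: Mgr_theta.
  elim: Ux => [_ [v [n [n0 ->]]]||x1 x2 _ IH1 _ IH2|k x1 _ IH|x1 x2 _ IH1 _ IH2] d m d0 dm.
  + apply: in_span_gen; exists (d - - n%:Z); first by rewrite /=; lia.
    exact: Mgr_mode.
  + apply: in_span_gen; exists d => //.
    by have := Mgr_word [::] dm; rewrite /word !big_nil subr0.
  + rewrite MactDl; exact (in_spanD (IH1 d m d0 dm) (IH2 d m d0 dm)).
  + rewrite MactZl; exact (in_spanZ _ (IH d m d0 dm)).
  + rewrite MactM; move: (IH2 d m d0 dm).
    elim=> [|z [d' d'0 Gz]|z z' _ Hz _ Hz'|k z _ Hz].
    * by rewrite Mact0; exact: in_span0.
    * exact (IH1 d' z d'0 Gz).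
    * rewrite MactD; exact (in_spanD Hz Hz').
    * rewrite MactZ; exact (in_spanZ _ Hz).
- rewrite tenDl; exact (in_spanD (IH1 w) (IH2 w)).
- rewrite tenZl; exact (in_spanZ _ (IH w)).
Qed.

Lemma Mgr_disjoint (B : set int) d m : ~ B d -> mgr d m ->
  in_span (\bigcup_(e in B) mgr e) m -> m = 0.
Proof.
move=> Bd dm /(span_components Mgr_subspace) [s [f [us sB Gf mE]]].
have ds : d \notin s by apply/negP => /sB.
pose g e := if e == d then - m else f e.
have := @Mgr_direct (d :: s) g; rewrite /= ds us => /(_ isT) Hg.
apply/eqP; rewrite -oppr_eq0; apply/eqP.
have <- : g d = - m by rewrite /g eqxx.
apply: Hg; last by rewrite inE eqxx.
- move=> e; rewrite /g; case: eqP => [->|_]; last exact: Gf.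
  by rewrite -scaleN1r; exact: in_spanZ.
- rewrite big_cons {1}/g eqxx {1}mE addrC; apply/eqP; rewrite subr_eq0; apply/eqP.
  by apply: eq_big_seq => e es; rewrite /g; case: eqP es ds => // -> ->.
Qed.

Lemma Mgr_neg d m : mgr d m -> d < 0 -> m = 0.
Proof.
move=> dm d0; apply: (Mgr_disjoint _ dm (Mtotal m)) => /=.
by apply/negP; lia.
Qed.

(** This turns the choice in the definition of the projection into its defining
property. *)
Lemma P0_unique m w :
  in_span (\bigcup_(d in [set d : int | d != 0]) mgr d) (m - th w) -> proj0 m = w.
Proof.
move=> mw; rewrite /P0; case: xgetP => [w' _ mw'|/(_ w)] //.
apply: (proj1 theta_P); apply/eqP; rewrite -subr_eq0; apply/eqP.
apply: (@Mgr_disjoint [set d : int | d != 0] 0); first by move=> /eqP.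
  by rewrite -(linB theta_linear); exact: Mgr_theta.
have -> : th w' - th w = (-1) *: (m - th w') + (m - th w).
  by rewrite scaleN1r opprB addrA subrK.
exact: in_span_comb.
Qed.

Lemma P0_exists m : exists w,
  in_span (\bigcup_(d in [set d : int | d != 0]) mgr d) (m - th w).
Proof.
elim: (Mtotal m) => [|x [d d0 dx]|x y _ [w Hw] _ [w' Hw']|a x _ [w Hw]].
- by exists 0; rewrite (lin0 theta_linear) subrr; exact: in_span0.
- have [dE|dN] := eqVneq d 0.
    move: dx; rewrite dE => /(proj2 theta_P) [w ->]; exists w.
    by rewrite subrr; exact: in_span0.
  exists 0; rewrite (lin0 theta_linear) subr0; apply: in_span_gen.
  by exists d.
- exists (w + w'); rewrite (linD theta_linear) opprD addrACA.
  exact (in_spanD Hw Hw').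
- exists (a *: w); rewrite (linZ theta_linear) -scalerBr.
  exact (in_spanZ _ Hw).
Qed.

Lemma P0_linear : linear proj0.
Proof.
move=> a x y; have [w Hw] := P0_exists x; have [w' Hw'] := P0_exists y.
rewrite (P0_unique Hw) (P0_unique Hw'); apply: P0_unique.
rewrite theta_linear scaleB_comb; exact (in_span_comb a Hw Hw').
Qed.

Lemma P0_theta w : proj0 (th w) = w.
Proof. by apply: P0_unique; rewrite subrr; exact: in_span0. Qed.

Lemma P0_Mgr d m : d != 0 -> mgr d m -> proj0 m = 0.
Proof.
move=> d0 dm; apply: P0_unique; rewrite (lin0 theta_linear) subr0.
by apply: in_span_gen; exists d.
Qed.

End InducedModule.

(** * The defects lie in J(U) *)

Section LinearKernel.
Variables (K : fieldType) (W W' : lmodType K) (f : W -> W').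
Hypothesis fl : linear f.

Lemma lin_kerD u v : f u = 0 -> f v = 0 -> f (u + v) = 0.
Proof. by move=> fu fv; rewrite (linD fl) fu fv addr0. Qed.

Lemma lin_kerZ a u : f u = 0 -> f (a *: u) = 0.
Proof. by move=> fu; rewrite (linZ fl) fu scaler0. Qed.

Lemma lin_ker_comb a u v : f u = 0 -> f v = 0 -> f (a *: u + v) = 0.
Proof. by move=> fu fv; rewrite fl fu fv scaler0 addr0. Qed.

Lemma preim_subspace (G : set W') : is_subspace G -> is_subspace [set w | G (f w)].
Proof.
move=> [G0 Glin]; split=> [|a u v Gu Gv]; first by rewrite /= (lin0 fl).
by rewrite /= fl; exact: Glin.
Qed.
End LinearKernel.

Section IrreducibleQuotient.
Variable K : fieldType.
Hypothesis K_char0 : forall n, n.+1%:R != 0 :> K.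
Variables (V : lmodType K) (Q : weakQVA V).
Variable S : {linear tens V V -> tens V V}.
Variables (U : lmodType K) (act : Atilde Q -> U -> U) (psi : Balg Q S -> Atilde Q).
Hypotheses (S_jacobi : constant_Smap Q S) (A_basis : assumptionA Q S).
Hypotheses (U_mod : is_Atilde_module act) (psi_P : is_psi psi).
Hypothesis theta_P : theta_iso act psi.

Local Notation A := (Utilde Q S).
Local Notation um := (Umode Q S).
Local Notation M := (Mtilde act psi).
Local Notation mact := (Mact act psi).
Local Notation mgr := (Mgr act psi).
Local Notation th := (theta act psi).
Local Notation proj0 := (P0 act psi).

Definition Mmode (v : V) (n : int) : M -> M := mact (um v n).

Let mact_r a : linear (mact a) := @Mact_linear K V Q S U act psi a.
Let mmode_l n m : linear (fun v => Mmode v n m) := @Mmode_linearl K V Q S U act psi n m.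
Let mmode_r v n : linear (Mmode v n). Proof. exact: mact_r. Qed.
Let mmode_comm : mode_comm Q S Mmode := @Mmode_comm K V Q S U act psi.
Let mgr_mode d v n m : mgr d m -> mgr (d - n) (Mmode v n m).
Proof. exact: Mgr_mode. Qed.
Let mgr_neg d m : mgr d m -> d < 0 -> m = 0.
Proof. exact: Mgr_neg. Qed.
Let mkilled d m : mgr d m -> killed_above Mmode d m.
Proof. exact: (hom_killed mgr_mode mgr_neg). Qed.
Let tkilled w : killed_above Mmode 0 (th w).
Proof. exact/mkilled/Mgr_theta. Qed.
Let th_l := @theta_linear K V Q S U act psi.
Let proj0_l : linear proj0. Proof. exact: P0_linear. Qed.
Let proj0_0 : proj0 0 = 0. Proof. exact: (lin0 proj0_l). Qed.

Let proj0_Mgr d m : d != 0 -> mgr d m -> proj0 m = 0.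
Proof. exact: P0_Mgr. Qed.

Local Notation mdefect := (defect Q Mmode).

Lemma mode0_theta v w : Mmode v 0 (th w) = th (act (Acls Q v) w).
Proof.
have := theta_Bact act psi (Bmode Q S v 0) w.
by rewrite Bpi_mode (psi_mode psi_P) => ->.
Qed.

Lemma bsum_subspace (W : lmodType K) (G : set W) n (F : nat -> W) : is_subspace G ->
  evz F -> (forall i, G (F i)) -> G (bsum n F).
Proof.
move=> [G0 Glin] [N HN] GF; rewrite /bsum (@nsumE _ _ N); last first.
  by move=> i /HN ->; rewrite scaler0.
by elim/big_rec: _ => // i x _ Gx; exact: Glin.
Qed.

Lemma Mgr_defect l n q u v w : mgr (- q) (mdefect l n q u v (th w)).
Proof.
have [G0 Glin] := Mgr_subspace act psi (- q).
rewrite /defect addrC -scaleN1r; apply: Glin; last first.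
  by rewrite -sub0r; apply: mgr_mode; exact: Mgr_theta.
apply: bsum_subspace => [||i]; first exact: Mgr_subspace.
  exact: (mtest_evz mmode_r _ _ _ _ (tkilled w)).
have -> : - q = 0 - (q - l - n - 1 + i%:Z) - (l + n + 1 - i%:Z) by lia.
by do 2 apply: mgr_mode; exact: Mgr_theta.
Qed.

(** This is where U has to be a module over Atilde.  For l = 0 the defect at n >= 0
vanishes by the commutation relation, the one at n = -1 because the star product
acts as a composition, and those at n <= -2 because Otilde acts as 0.  Larger l
follow from the Pascal recursion. *)
Lemma defect_degree0 (l : nat) n u v w : mdefect l n 0 u v (th w) = 0.
Proof.
elim: l n => [|l IH] n; last first.
  have -> : Posz l.+1 = Posz l + 1 by lia.
  rewrite (defect_rec K_char0 _ mmode_l mmode_r _ _ _ _ _ (tkilled w)).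
  by rewrite 2!IH; exact: addr0.
case: n => [n|[|r]].
- exact: (defect_nonneg K_char0 mmode_l mmode_r mmode_comm _ _ _ _ (tkilled w)).
- rewrite /defect -star_vtest mode0_theta (AactM U_mod) -2!mode0_theta.
  rewrite /mtest /bsum (@nsumE _ _ 1) ?big_ord1 ?bcoef0 ?scale1r; last first.
    by move=> i i0; rewrite tkilled ?(lin0 (mmode_r _ _)) ?scaler0 //; lia.
  by apply/eqP; rewrite subr_eq0; apply/eqP.
- rewrite /defect mode0_theta /mtest bsum_zero; last first.
    by move=> i; rewrite tkilled ?(lin0 (mmode_r _ _)) //; lia.
  have -> : Acls Q (vtest Q 0%N (Negz r.+1) u v) = 0.
    rewrite -[RHS](linear0 (vpi (Otilde Q))); apply/vpi_eq; rewrite subr0.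
    exact: vtest_Otilde.
  by rewrite act0 // (lin0 th_l); exact: subr0.
Qed.

Lemma P0_defect l n q u v w : 0 <= l -> proj0 (mdefect l n q u v (th w)) = 0.
Proof.
move=> l0; have [->|q0] := eqVneq q 0.
  have -> : l = (absz l)%:Z by lia.
  by rewrite defect_degree0.
by apply: (proj0_Mgr _ (Mgr_defect l n q u v w)); rewrite oppr_eq0.
Qed.

(** The bound l >= 0 makes the degree zero components of defects vanish, and it is
kept by positive modes, which can only raise l. *)
Definition defect_span : set M := in_span [set z | exists l n q u v w,
  0 <= l /\ z = mdefect l n q u v (th w)].

Lemma defect_span_P0 z : defect_span z -> proj0 z = 0.
Proof.
elim=> [|_ [l [n [q [u [v [w [l0 ->]]]]]]]|x y _ Hx _ Hy|a x _ Hx].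
- exact: proj0_0.
- exact: P0_defect.
- exact (lin_kerD proj0_l Hx Hy).
- exact (lin_kerZ proj0_l a Hx).
Qed.

Let mact0l z : mact 0 z = 0. Proof. exact: (lin0 (Mact_linearl z)). Qed.

Lemma mact1 z : mact 1 z = z.
Proof.
elim/Mtilde_ind: z => [|x y Hx Hy|a w]; first exact: Mact0.
  by rewrite MactD Hx Hy.
by rewrite Mact_ten mul1r.
Qed.

Lemma defect_span_Uminus x z : @Uminus K V Q S x -> defect_span z -> defect_span (mact x z).
Proof.
move=> Hx; move: x Hx z; apply: alg_genP.
- move=> _ [c [m [m0 ->]]] z; elim=> [|_ [l [n [q [u [v [w [l0 ->]]]]]]]|x y _ Hx _ Hy|a x _ Hx].
  + by rewrite Mact0; exact: in_span0.
  + have [s Ss] := Smap_seq S c u; rewrite -/(Mmode c m%:Z _).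
    have m0' : 0 < m%:Z by lia.
    rewrite (mode_defect K_char0 S_jacobi mmode_l mmode_r mmode_comm _ _ _ _ (tkilled w) m0' Ss).
    apply: in_spanD.
      apply: in_span_sum => p _; apply: in_span_gen.
      by exists l, n, (q + m%:Z), p.1, (cact Q m p.2 v), w.
    apply: in_span_gen; exists (l + m%:Z), n, (q + m%:Z), (cact Q m c u), v, w.
    by split=> //; lia.
  + rewrite MactD; exact (in_spanD Hx Hy).
  + rewrite MactZ; exact (in_spanZ _ Hx).
- by move=> z; rewrite mact1.
- move=> x y Hx Hy z Hz; rewrite MactDl; exact (in_spanD (Hx z Hz) (Hy z Hz)).
- move=> a x Hx z Hz; rewrite MactZl; exact (in_spanZ _ (Hx z Hz)).
- move=> x y Hx Hy z Hz; rewrite MactM; exact (Hx _ (Hy z Hz)).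
Qed.

Definition kills_P0 (x : A) := forall z, proj0 z = 0 -> proj0 (mact x z) = 0.

Lemma kills_P0_alg (G : set A) : (forall x, G x -> kills_P0 x) ->
  forall x, alg_gen G x -> kills_P0 x.
Proof.
move=> HG; apply: (@alg_genP K V Q S G kills_P0 HG) => [z z0|x y Hx Hy z z0|a x Hx z z0|x y Hx Hy z z0].
- by rewrite mact1.
- rewrite MactDl; exact (lin_kerD proj0_l (Hx z z0) (Hy z z0)).
- rewrite MactZl; exact (lin_kerZ proj0_l a (Hx z z0)).
- rewrite MactM; exact (Hx _ (Hy z z0)).
Qed.

Let span_nonzero z : in_span (\bigcup_(d in [set d : int | d != 0]) mgr d) z ->
  proj0 z = 0.
Proof.
by move=> Hz; apply: P0_unique => //; rewrite (lin0 th_l) subr0.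
Qed.

Lemma mode_span (B B' : set int) v n z : (forall d, B d -> B' (d - n)) ->
  in_span (\bigcup_(d in B) mgr d) z ->
  in_span (\bigcup_(d in B') mgr d) (Mmode v n z).
Proof.
move=> BB'; elim=> [|x [d Bd dx]|x y _ Hx _ Hy|a x _ Hx].
- by rewrite /Mmode Mact0; exact: in_span0.
- by apply: in_span_gen; exists (d - n); [exact: BB'|exact: mgr_mode].
- rewrite (linD (mmode_r v n)); exact (in_spanD Hx Hy).
- rewrite (linZ (mmode_r v n)); exact (in_spanZ _ Hx).
Qed.

Lemma Uzero_P0 x : @Uzero K V Q S x -> kills_P0 x.
Proof.
apply: kills_P0_alg => _ [v ->] z z0; apply: span_nonzero.
apply: (mode_span (B := [set d : int | d != 0])); first by move=> d /=; rewrite subr0.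
have [w Hw] : exists w, in_span (\bigcup_(d in [set d : int | d != 0]) mgr d) (z - th w).
  exact: P0_exists.
have w0 : w = 0 by rewrite -z0; apply: esym; exact: P0_unique.
by move: Hw; rewrite w0 (lin0 th_l) subr0.
Qed.

Lemma Uplus_P0 x : @Uplus K V Q S x -> kills_P0 x.
Proof.
apply: kills_P0_alg => _ [v [n [n0 ->]]] z _; apply: span_nonzero.
apply: (mode_span (B := [set d : int | 0 <= d])); last exact: Mtotal.
by move=> d /= d0; apply/eqP; lia.
Qed.

(** By Assumption A an element of the universal algebra is a combination of products
a+ a0 a-.  The factor a- maps defects to defects, without component in degree 0;
a0 preserves the sum of the nonzero degrees, and a+ has image in positive
degrees or acts as a scalar, the unit being an element of U+. *)
Lemma defect_P0 x z : defect_span z -> proj0 (mact x z) = 0.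
Proof.
move=> Hz; have [f [f_mul [g fK gK]]] := A_basis.
rewrite -(gK x); elim/tens_ind: (g x) => [|y y' Hy Hy'|[y Hy] [y' Hy']].
- rewrite linear0; exact (etrans (congr1 _ (mact0l z)) proj0_0).
- rewrite linearD MactDl; exact (lin_kerD proj0_l Hy Hy').
rewrite f_mul /=; move/lspanP: Hy => Hy; move/lspanP: Hy' => Hy'.
have y'z : proj0 (mact y' z) = 0.
  elim: Hy' => [|_ [b [c [Hb Hc ->]]]|b c _ Hb _ Hc|a b _ Hb].
  - exact (etrans (congr1 _ (mact0l z)) proj0_0).
  - rewrite MactM; apply: (Uzero_P0 Hb).
    exact (defect_span_P0 (defect_span_Uminus Hc Hz)).
  - rewrite MactDl; exact (lin_kerD proj0_l Hb Hc).
  - rewrite MactZl; exact (lin_kerZ proj0_l a Hb).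
rewrite MactM; elim: Hy => [|b Hb|b c _ Hb _ Hc|a b _ Hb].
- exact (etrans (congr1 _ (mact0l (mact y' z))) proj0_0).
- exact (Uplus_P0 Hb y'z).
- rewrite MactDl; exact (lin_kerD proj0_l Hb Hc).
- rewrite MactZl; exact (lin_kerZ proj0_l a Hb).
Qed.

(** There are enough functionals on U to detect that P0 (a m) is zero. *)
Lemma Jsub_P0 m : Jsub act psi m <-> forall a, proj0 (mact a m) = 0.
Proof.
split=> [Jm a|Jm ustar a]; last by rewrite Jm linear0.
by apply: scalar_separates => f; exact: Jm.
Qed.

Lemma Jsub_subspace : is_subspace (Jsub act psi).
Proof.
split=> [|a x y /Jsub_P0 Jx /Jsub_P0 Jy]; apply/Jsub_P0 => b.
  by rewrite Mact0 proj0_0.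
rewrite mact_r; exact (lin_ker_comb proj0_l a (Jx b) (Jy b)).
Qed.

Lemma defect_J l n q u v w : 0 <= l -> Jsub act psi (mdefect l n q u v (th w)).
Proof.
move=> l0; apply/Jsub_P0 => a; apply: defect_P0; apply: in_span_gen.
by exists l, n, q, u, v, w.
Qed.

End IrreducibleQuotient.

(** * The module L(U) *)

Section PushForward.
Variables (K : fieldType) (V : lmodType K) (Q : weakQVA V).
Variable S : {linear tens V V -> tens V V}.
Variables (M L : lmodType K) (p : M -> L).
Hypotheses (p_linear : linear p) (p_surj : forall x, exists m, x = p m).
Variables (mm : V -> int -> M -> M) (lm : V -> int -> L -> L).
Hypothesis lm_p : forall v n m, lm v n (p m) = p (mm v n m).
Hypothesis mm_linearl : forall n m, linear (fun v => mm v n m).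
Hypothesis mm_linearr : forall v n, linear (mm v n).

Lemma push_linearl n x : linear (fun v => lm v n x).
Proof. by have [m ->] := p_surj x; move=> a u v; rewrite !lm_p mm_linearl p_linear. Qed.

Lemma push_linearr v n : linear (lm v n).
Proof.
move=> a x y; have [m ->] := p_surj x; have [m' ->] := p_surj y.
by rewrite -p_linear !lm_p mm_linearr p_linear.
Qed.

Lemma push_comm : mode_comm Q S mm -> mode_comm Q S lm.
Proof.
move=> mm_comm u v m n x s Ss; have [y ->] := p_surj x.
rewrite !lm_p (mm_comm _ _ _ _ _ _ Ss) (linD p_linear) (lin_sum p_linear).
by congr (_ + _); apply: eq_bigr => q _; rewrite !lm_p.
Qed.

Lemma push_defect d m l n q u v : killed_above mm d m ->
  defect Q lm l n q u v (p m) = p (defect Q mm l n q u v m).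
Proof.
move=> km; rewrite /defect (linB p_linear) lm_p; congr (_ - _).
rewrite /mtest (lin_bsum p_linear); last exact: (mtest_evz mm_linearr _ _ _ _ km).
by apply: eq_bsum => i; rewrite !lm_p.
Qed.

Lemma push_subspace (G : set M) : is_subspace G -> is_subspace (p @` G).
Proof.
move=> [G0 Glin]; split=> [|a _ _ [x dx <-] [y dy <-]].
  by exists 0 => //; exact: (lin0 p_linear).
by exists (a *: x + y); [exact: Glin|exact: p_linear].
Qed.

End PushForward.

Section QuotientModule.
Variable K : fieldType.
Hypothesis K_char0 : forall n, n.+1%:R != 0 :> K.
Variables (V : lmodType K) (Q : weakQVA V).
Variable S : {linear tens V V -> tens V V}.
Variables (U : lmodType K) (act : Atilde Q -> U -> U) (psi : Balg Q S -> Atilde Q).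
Hypotheses (S_jacobi : constant_Smap Q S) (A_basis : assumptionA Q S).
Hypotheses (U_mod : is_Atilde_module act) (psi_P : is_psi psi).
Hypothesis theta_P : theta_iso act psi.

Local Notation A := (Utilde Q S).
Local Notation um := (Umode Q S).
Local Notation M := (Mtilde act psi).
Local Notation L := (Lmod act psi).
Local Notation mact := (Mact act psi).
Local Notation mgr := (Mgr act psi).
Local Notation th := (theta act psi).
Local Notation proj0 := (P0 act psi).
Local Notation J := (Jsub act psi).
Local Notation lmode := (Lmode act psi).
Local Notation mmode := (@Mmode K V Q S U act psi).

Let mmode_l n m : linear (fun v => mmode v n m) := @Mmode_linearl K V Q S U act psi n m.
Let mmode_r v n : linear (mmode v n). Proof. exact: Mact_linear. Qed.
Let mgr_mode d v n m : mgr d m -> mgr (d - n) (mmode v n m).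
Proof. exact: Mgr_mode. Qed.
Let mgr_neg d m : mgr d m -> d < 0 -> m = 0.
Proof. exact: Mgr_neg. Qed.
Let mkilled d m : mgr d m -> killed_above mmode d m.
Proof. exact: (hom_killed mgr_mode mgr_neg). Qed.
Let proj0_l : linear proj0. Proof. exact: P0_linear. Qed.
Let JP m : J m <-> forall a, proj0 (mact a m) = 0.
Proof. exact: Jsub_P0. Qed.
Let J_sub : is_subspace J.
Proof. exact: Jsub_subspace. Qed.
Let th_l := @theta_linear K V Q S U act psi.

Definition piJ (m : M) : L := vpi J m.

Lemma piJ_linear : linear piJ.
Proof. exact: (linearP (vpi J)). Qed.

Lemma piJ_eq0 m : piJ m = 0 <-> J m.
Proof.
have pi0 : piJ 0 = 0 := lin0 piJ_linear.
have E : piJ m = piJ 0 <-> m - 0 \in lspan J := vpi_eq J m 0.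
rewrite -pi0; split=> [/E /lspanP|Jm]; last by apply/E/lspan_gen; rewrite subr0.
by rewrite subr0; exact: in_span_subspace.
Qed.

Lemma piJ_surj (x : L) : exists m, x = piJ m.
Proof. by exists (vrepr x); rewrite /piJ vreprK. Qed.

Lemma Lmode_pi v n m : lmode v n (piJ m) = piJ (mmode v n m).
Proof. exact: Lact_pi. Qed.

Lemma Lmode_linearl n x : linear (fun v => lmode v n x).
Proof. exact: (push_linearl piJ_linear piJ_surj Lmode_pi mmode_l). Qed.

Lemma Lmode_linearr v n : linear (lmode v n).
Proof. exact: (push_linearr piJ_linear piJ_surj Lmode_pi mmode_r). Qed.

Lemma Lmode_comm : mode_comm Q S lmode.
Proof. exact: (push_comm piJ_linear piJ_surj Lmode_pi (@Mmode_comm K V Q S U act psi)). Qed.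

Lemma Lmode_vac n x : lmode (vac Q) n x = if n == 0 then x else 0.
Proof.
have [m ->] := piJ_surj x; rewrite Lmode_pi /Mmode Umode_vac.
case: ifP => _; first by rewrite mact1.
exact (etrans (congr1 piJ (lin0 (Mact_linearl m))) (lin0 piJ_linear)).
Qed.

Definition lgr (d : int) : set L := piJ @` mgr d.

Lemma lgr_subspace d : is_subspace (lgr d).
Proof. exact: (push_subspace piJ_linear (Mgr_subspace act psi d)). Qed.

Lemma lgr_mode d v n x : lgr d x -> lgr (d - n) (lmode v n x).
Proof.
by move=> [m dm <-]; exists (mmode v n m); [exact: mgr_mode|rewrite Lmode_pi].
Qed.

Lemma lgr_neg d x : lgr d x -> d < 0 -> x = 0.
Proof. by move=> [m dm <-] d0; rewrite (mgr_neg dm d0); exact: (lin0 piJ_linear). Qed.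

Lemma lkilled d x : lgr d x -> killed_above lmode d x.
Proof. exact: (hom_killed lgr_mode lgr_neg). Qed.

Lemma defect_pi d m l n q u v : killed_above mmode d m ->
  defect Q lmode l n q u v (piJ m) = piJ (defect Q mmode l n q u v m).
Proof. exact: (push_defect Q piJ_linear Lmode_pi mmode_r). Qed.

Lemma defect_top l n q u v w : 0 <= l -> defect Q lmode l n q u v (piJ (th w)) = 0.
Proof.
move=> l0; rewrite (@defect_pi 0); last exact/mkilled/Mgr_theta.
by apply/piJ_eq0; exact: defect_J.
Qed.

(** Associativity at x against t^l (t - 1)^n for all large l, uniformly in the
vectors of V: the form in which it can be propagated by [defect_mode]. *)
Definition assoc_above (x : L) := exists d l0, killed_above lmode d x
  /\ forall l n q u v, l0 <= l -> defect Q lmode l n q u v x = 0.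

(** On U this is [defect_J]; each further mode is [defect_mode]. *)
Lemma assoc_word (s : seq (V * int)) w : exists d l0, [/\ d <= l0,
  lgr d (piJ (Mten act psi (word Q S s) w)) & forall l n q u v, l0 <= l ->
    defect Q lmode l n q u v (piJ (Mten act psi (word Q S s) w)) = 0].
Proof.
elim: s => [|[c m] s [d [l0 [dl0 dx x0]]]].
  exists 0, 0; rewrite /word big_nil -/(theta act psi w); split=> //.
    by exists (th w) => //; exact: Mgr_theta.
  by move=> l n q u v; exact: defect_top.
have -> : piJ (Mten act psi (word Q S ((c, m) :: s)) w)
    = lmode c m (piJ (Mten act psi (word Q S s) w)).
  by rewrite Lmode_pi /Mmode Mact_ten /word big_cons.
exists (d - m), (l0 + (absz (d - m - l0)%R)%:Z); split; first by lia.
  exact: lgr_mode.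
move=> l n q u v le.
apply: (@defect_mode K K_char0 V Q S L lmode lgr Lmode_linearl Lmode_linearr Lmode_comm
  lgr_mode lgr_neg u v c _ d l0 dx dl0 x0); lia.
Qed.

Lemma killed_above_le d d' x : d <= d' -> killed_above lmode d x ->
  killed_above lmode d' x.
Proof. by move=> le kx v m lt; apply: kx; lia. Qed.

Lemma assoc_aboveD x y : assoc_above x -> assoc_above y -> assoc_above (x + y).
Proof.
move=> [d [l0 [kx x0]]] [d' [l0' [ky y0]]].
exists (d + (absz (d' - d)%R)%:Z), (l0 + (absz (l0' - l0)%R)%:Z); split.
  have kx' := killed_above_le (_ : d <= d + (absz (d' - d)%R)%:Z) kx.
  have ky' := killed_above_le (_ : d' <= d + (absz (d' - d)%R)%:Z) ky.
  move=> v m lt; rewrite (linD (Lmode_linearr v m)) kx' ?ky' ?addr0 //; lia.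
move=> l n q u v le.
rewrite (defectDw Q Lmode_linearr _ _ _ _ _ kx ky) x0 ?y0 ?addr0 //; lia.
Qed.

Lemma assoc_all x : assoc_above x.
Proof.
have assoc0 : assoc_above 0.
  exists 0, 0; split=> [v m _|l n q u v _]; first exact: (lin0 (Lmode_linearr v m)).
  exact: defect0w Lmode_linearr _ _ _ _ _.
have [m ->] := piJ_surj x; elim/Mtilde_ind: m => [|y z Hy Hz|a w].
- by rewrite (lin0 piJ_linear).
- by rewrite (linD piJ_linear); exact: assoc_aboveD.
elim: (span_words a) w => [|_ [s _ <-]|y z _ Hy _ Hz|c y _ Hy] w.
- rewrite (lin0 (@Mten_linearl K V Q S U act psi w)) (lin0 piJ_linear).
  exact: assoc0.
- have [d [l0 [_ dx x0]]] := assoc_word s w.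
  by exists d, l0; split=> //; exact: lkilled.
- rewrite (linD (@Mten_linearl K V Q S U act psi w)) (linD piJ_linear).
  exact: (assoc_aboveD (Hy w) (Hz w)).
- rewrite (linZ (@Mten_linearl K V Q S U act psi w)).
  rewrite -(linZ (@Mten_linearr K V Q S U act psi y)).
  exact: Hy.
Qed.

(** The exponent k can be any bound for the order of the pole of Y(u,x) v: it does not
depend on w. *)
Lemma Lmod_phi_module : is_phi_module Q lmode.
Proof.
split.
- exact: Lmode_linearl.
- exact: Lmode_linearr.
- move=> v x; have [d [l0 [kx _]]] := assoc_all x.
  by exists (d + 1) => n le; apply: kx; lia.
- exact: Lmode_vac.
move=> u v; have [N HN] := vm_evzi Q u v; exists (absz N).
have uv0 j : (absz N)%:Z <= j -> vmode Q u j v = 0 by move=> le; apply: HN; lia.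
split=> x; have [d [l0 [kx x0]]] := assoc_all x.
  exact: (laurent2_binom K_char0 Lmode_linearl Lmode_linearr Lmode_comm uv0 kx).
move=> dd; apply: (phi_assoc_at (l0 := l0) K_char0 Lmode_linearl Lmode_linearr
  Lmode_comm uv0 kx) => l n q; exact: x0.
Qed.

(** Membership in J(U) is tested with products of modes, each of which takes exactly
one degree to degree 0. *)
Lemma J_homogeneous (N : nat) (f : nat -> M) : (forall n : nat, mgr n (f n)) ->
  J (\sum_(n < N) f n) -> forall n, (n < N)%N -> J (f n).
Proof.
move=> Gf /JP Jf n nN; apply/JP => a.
elim: (span_words a) => [|_ [s _ <-]|x y _ Hx _ Hy|c x _ Hx].
- exact (etrans (congr1 proj0 (lin0 (Mact_linearl (f n)))) (lin0 proj0_l)).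
- have off k : k%:Z - \sum_(x <- s) x.2 != 0 -> proj0 (mact (word Q S s) (f k)) = 0.
    by move=> k0; apply: (P0_Mgr K_char0 U_mod psi_P theta_P k0); exact: Mgr_word.
  have [E|] := eqVneq (n%:Z - \sum_(x <- s) x.2) 0; last exact: off.
  have := Jf (word Q S s).
  rewrite (lin_sum (@Mact_linear K V Q S U act psi (word Q S s))) (lin_sum proj0_l).
  rewrite (bigD1 (Ordinal nN)) //= big1 ?addr0 // => i ni; apply: off.
  apply: contra ni => /eqP E'; apply/eqP/val_inj => /=.
  by apply/eqP; rewrite -eqz_nat -(inj_eq (addIr (- \sum_(x <- s) x.2))) E E'.
- rewrite MactDl; exact (lin_kerD proj0_l Hx Hy).
- rewrite MactZl; exact (lin_kerZ proj0_l c Hx).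
Qed.

Lemma Lmod_grading : is_N_grading lmode (Lgr act psi).
Proof.
split.
- by move=> n; exact: lgr_subspace.
- move=> x; have [m ->] := piJ_surj x.
  have mt : in_span (\bigcup_(d in [set d : int | 0 <= d]) mgr d) m by exact: Mtotal.
  have [N [f [Gf ->]]] := span_components_nat (Mgr_subspace act psi) mt.
  exists N, (fun n => piJ (f n)); split; last exact: (lin_sum piJ_linear).
  by move=> n; exists (f n).
- move=> N f Gf sum0 n nN.
  have gP k : exists m, mgr k%:Z m /\ piJ m = f k.
    by have [m dm mf] := Gf k; exists m.
  pose g k := sval (cid (gP k)).
  have g_gr k : mgr k%:Z (g k) := proj1 (svalP (cid (gP k))).
  have g_pi k : piJ (g k) = f k := proj2 (svalP (cid (gP k))).
  rewrite -g_pi; apply/piJ_eq0; apply: (J_homogeneous g_gr _ nN).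
  apply/piJ_eq0; rewrite (lin_sum piJ_linear) -[RHS]sum0.
  by apply: eq_bigr => i _; exact: g_pi.
- move=> v m n x Gx; have := @lgr_mode n v m x Gx.
  case: (n%:Z - m) => k // Gk; exact: (lgr_neg Gk).
Qed.

Lemma Ltop_linear : linear (Ltop act psi).
Proof.
by move=> a x y; exact (etrans (congr1 piJ (th_l a x y)) (piJ_linear a _ _)).
Qed.

(** P0 is the identity on U, so that U meets J(U) in 0. *)
Lemma Ltop_injective : injective (Ltop act psi).
Proof.
move=> x y E; apply/eqP; rewrite -subr_eq0; apply/eqP.
have : piJ (th (x - y)) = 0.
  rewrite (linB th_l) (linB piJ_linear); apply/eqP; rewrite subr_eq0; apply/eqP.
  exact: E.
move=> /piJ_eq0 /JP /(_ 1); rewrite mact1.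
by rewrite (P0_theta K_char0 U_mod psi_P theta_P).
Qed.

Lemma Ltop_range : range (Ltop act psi) = Lgr act psi 0%N.
Proof.
apply/seteqP; split=> [_ [w _ <-]|_ [m dm <-]].
  by exists (th w) => //; exact: Mgr_theta.
by have [w ->] := (proj2 theta_P) m dm; exists w.
Qed.

Lemma submodule_act (N : set L) : is_subspace N ->
  (forall v m x, N x -> N (lmode v m x)) ->
  forall a m, N (piJ m) -> N (piJ (mact a m)).
Proof.
move=> [N0 Nlin] Nmode a.
elim/palg_ind: a => [[v n]|||x y Hx Hy|c x Hx|x y Hx Hy] m Nm.
- by have := Nmode v n _ Nm; rewrite Lmode_pi.
- have -> : piJ (mact 0 m) = 0.
    exact (etrans (congr1 piJ (lin0 (Mact_linearl m))) (lin0 piJ_linear)).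
  exact: N0.
- by rewrite mact1.
- have -> : piJ (mact (x + y) m) = 1 *: piJ (mact x m) + piJ (mact y m).
    rewrite scale1r; exact (etrans (congr1 piJ (MactDl x y m)) (linD piJ_linear _ _)).
  exact: (Nlin _ _ _ (Hx m Nm) (Hy m Nm)).
- have -> : piJ (mact (c *: x) m) = c *: piJ (mact x m) + 0.
    rewrite addr0; exact (etrans (congr1 piJ (MactZl c x m)) (linZ piJ_linear _ _)).
  exact: (Nlin _ _ _ (Hx m Nm) N0).
- rewrite MactM; exact: (Hx _ (Hy m Nm)).
Qed.

(** If a graded submodule N contains the class of m outside J(U), then some a m has
a nonzero component in degree 0, and N being graded contains it.  The vectors of
U that lie in N form a nonzero submodule over Atilde, thus all of U, which
generates L(U). *)
Lemma Lmod_irreducible : Atilde_irreducible act -> phi_irreducible lmode (Lgr act psi).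
Proof.
move=> [[u0 u0N] U_irr]; split.
  exists (Ltop act psi u0); apply/eqP => E; move/eqP: u0N; apply.
  apply: Ltop_injective; rewrite E; apply: esym; exact: (lin0 Ltop_linear).
move=> N [Nsub Nmode Ngr]; have [N0 Nlin] := Nsub.
have Nact := submodule_act Nsub Nmode.
pose NU : set U := [set w | N (Ltop act psi w)].
have NU_sub : is_subspace NU := preim_subspace Ltop_linear Nsub.
have NU_act a w : NU w -> NU (act a w).
  move=> Nw; have -> : a = Acls Q (vrepr a) by rewrite /Acls vreprK.
  have := Nmode (vrepr a) 0 _ Nw; rewrite -[Ltop _ _ w]/(piJ (th w)) Lmode_pi.
  by rewrite (mode0_theta act psi_P).
have [NU0|NUT] := U_irr NU NU_sub NU_act; last first.
  right; apply/seteqP; split=> // x _; have [m ->] := piJ_surj x.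
  elim/Mtilde_ind: m => [|y z Hy Hz|a w].
  - by rewrite (lin0 piJ_linear).
  - rewrite (linD piJ_linear) -[piJ y]scale1r; exact: Nlin.
  - rewrite -Mact_theta; apply: Nact.
    have : NU w by rewrite NUT.
    by [].
left; apply/seteqP; split=> [x Nx|x ->]; last exact: N0.
have [m mE] := piJ_surj x; rewrite /= mE; apply/piJ_eq0/JP => a.
have Nam : N (piJ (mact a m)) by apply: Nact; rewrite -mE.
have [k [f [fP fsum]]] := Ngr _ Nam.
have gP i : exists y, mgr i%:Z y /\ piJ y = f i by have [[y dy yf] _] := fP i; exists y.
pose g i := sval (cid (gP i)).
have g_gr i : mgr i%:Z (g i) := proj1 (svalP (cid (gP i))).
have g_pi i : piJ (g i) = f i := proj2 (svalP (cid (gP i))).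
have Jdiff : J (mact a m - \sum_(i < k) g i).
  apply/piJ_eq0; rewrite (linB piJ_linear) fsum (lin_sum piJ_linear).
  apply/eqP; rewrite subr_eq0; apply/eqP.
  by apply: eq_bigr => i _; rewrite g_pi.
have /JP /(_ 1) := Jdiff; rewrite mact1 (linB proj0_l) => /eqP.
rewrite subr_eq0 => /eqP ->; rewrite (lin_sum proj0_l); apply: big1 => i _.
have [i0|i0] := eqVneq (i%:Z) 0; last first.
  exact: (P0_Mgr K_char0 U_mod psi_P theta_P i0 (g_gr i)).
have gi := g_gr i; rewrite i0 in gi; have [w wE] := (proj2 theta_P) _ gi.
have : NU w.
  by rewrite /NU /= -[Ltop _ _ w]/(piJ (th w)) -wE g_pi; have [_] := fP i.
rewrite NU0 => /= w0; rewrite wE (P0_theta K_char0 U_mod psi_P theta_P).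
exact: w0.
Qed.

End QuotientModule.

Theorem theorem3p6 (R : realType) (V : lmodType R[i]) (Q : weakQVA V)
  (S : {linear tens V V -> tens V V}) (U : lmodType R[i])
  (act : Atilde Q -> U -> U) (psi : Balg Q S -> Atilde Q) :
  constant_Smap Q S -> assumptionA Q S ->
  is_Atilde_module act -> is_psi psi -> theta_iso act psi ->
  [/\ is_phi_module Q (Lmode act psi),
      is_N_grading (Lmode act psi) (Lgr act psi),
      [/\ linear (Ltop act psi), injective (Ltop act psi) &
          range (Ltop act psi) = Lgr act psi 0%N] &
      Atilde_irreducible act ->
        phi_irreducible (Lmode act psi) (Lgr act psi)].
Proof.
move=> Sj A_b U_m psiP thP.
have char0 n : n.+1%:R != 0 :> R[i] by rewrite Num.Theory.pnatr_eq0.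
split.
- exact: Lmod_phi_module.
- exact: Lmod_grading.
- split; [exact: Ltop_linear|exact: Ltop_injective|exact: Ltop_range].
- exact: Lmod_irreducible.
Qed.
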